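(* The satisfiability problem and the finite satisfiability problem for modal inclusion logic $\mathcal{ML}(\subseteq)$ with strict semantics are in $\mathrm{NEXPTIME}$.
   Context: Let $\Pi$ be a countably infinite set of proposition symbols. Formulas of modal inclusion logic $\mathcal{ML}(\subseteq)$ are given by the grammar $\varphi ::= p \mid \neg p \mid (\varphi_1\wedge\varphi_2)\mid(\varphi_1\vee\varphi_2)\mid p_1\cdots p_k\subseteq q_1\cdots q_k \mid \Box\varphi\mid\Diamond\varphi$, where $p,p_i,q_i\in\Pi$ and $k\geq 1$. A Kripke model is $M=(W,R,V)$ with $W\neq\emptyset$, $R\subseteq W\times W$, $V:\Pi\to\mathcal{P}(W)$. A team is a subset $T\subseteq W$; $R(T)=\{s\in W\mid \exists s'\in T: (s',s)\in R\}$. Strict team semantics: $M,T\models p$ iff $T\subseteq V(p)$; $M,T\models\neg p$ iff $T\cap V(p)=\emptyset$; $M,T\models p_1\cdots p_k\subseteq q_1\cdots q_k$ iff for every $u\in T$ there is $v\in T$ with $u\in V(p_i)\Leftrightarrow v\in V(q_i)$ for all $i$; $M,T\models\varphi\wedge\psi$ iff both hold on $T$; $M,T\models\varphi\vee\psi$ iff there are $S,S'\subseteq T$ with $S\cup S'=T$, $S\cap S'=\emptyset$, $M,S\models\varphi$, $M,S'\models\psi$; $M,T\models\Box\varphi$ iff $M,R(T)\models\varphi$; $M,T\models\Diamond\varphi$ iff $M,f(T)\models\varphi$ for some function $f:T\to W$ with $(u,f(u))\in R$ for all $u\in T$, where $f(T)=\{f(u)\mid u\in T\}$. The satisfiability problem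 asks whether there exist $M$ and a nonempty team $T$ with $M,T\models\varphi$; finite satisfiability additionally requires $W$ finite. *)

(* Defs.v *)
From HB Require Import structures.
From mathcomp Require Import all_boot.
From mathcomp Require Import boolp classical_sets cardinality.

Set Implicit Arguments.
Unset Strict Implicit.
Unset Printing Implicit Defensive.

Local Open Scope classical_set_scope.

Inductive formula (Pi : Type) : Type :=
| Lit (p : Pi)
| NLit (p : Pi)
| And (phi psi : formula Pi)
| Or (phi psi : formula Pi)
| Incl (k : nat) (p q : k.+1.-tuple Pi)
| Box (phi : formula Pi)
| Diamond (phi : formula Pi).

Record kripke (Pi : Type) : Type := Kripke {
  world :> Type;
  world_inhabited : inhabited world;
  acc : world -> world -> Prop;
  valuation : Pi -> set world
}.
Arguments valuation {Pi} k p.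

Definition successors (Pi : Type) (M : kripke Pi) (T : set M) : set M :=
  [set s | exists2 s', T s' & acc s' s].

(* In the Diamond clause the choice function is total on W; only its values
   on T matter. *)
Fixpoint team_sat (Pi : Type) (M : kripke Pi) (T : set M) (phi : formula Pi)
    : Prop :=
  match phi with
  | Lit p => T `<=` valuation M p
  | NLit p => T `&` valuation M p = set0
  | And phi1 phi2 => team_sat T phi1 /\ team_sat T phi2
  | Or phi1 phi2 => exists S S' : set M,
      [/\ S `|` S' = T, S `&` S' = set0, team_sat S phi1 & team_sat S' phi2]
  | Incl k p q => forall u, T u -> exists2 v, T v &
      forall i : 'I_k.+1, valuation M (tnth p i) u <-> valuation M (tnth q i) v
  | Box phi1 => team_sat (successors T) phi1
  | Diamond phi1 => exists f : M -> M,
      (forall u, T u -> acc u (f u)) /\ team_sat (f @` T) phi1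
  end.

Definition satisfiable (Pi : Type) (phi : formula Pi) : Prop :=
  exists (M : kripke Pi) (T : set M), T !=set0 /\ team_sat T phi.

Definition finitely_satisfiable (Pi : Type) (phi : formula Pi) : Prop :=
  exists (M : kripke Pi) (T : set M),
    [/\ finite_set [set: M], T !=set0 & team_sat T phi].

Inductive token : Type :=
| TBit of bool | TProp | TNot | TAnd | TOr | TBox | TDiamond
| TOpen | TSub | TClose.

Definition token_code (t : token) : bool + 'I_9 :=
  match t with
  | TBit b => inl b
  | TProp => inr (inord 0) | TNot => inr (inord 1) | TAnd => inr (inord 2)
  | TOr => inr (inord 3) | TBox => inr (inord 4) | TDiamond => inr (inord 5)
  | TOpen => inr (inord 6) | TSub => inr (inord 7) | TClose => inr (inord 8)
  end.

Definition token_decode (c : bool + 'I_9) : token :=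
  match c with
  | inl b => TBit b
  | inr i => nth TProp
      [:: TProp; TNot; TAnd; TOr; TBox; TDiamond; TOpen; TSub; TClose] i
  end.

Lemma token_codeK : cancel token_code token_decode.
Proof. by case=> //= *; rewrite inordK. Qed.

HB.instance Definition _ := Finite.copy token (can_type token_codeK).

Definition encode_symbol (Pi : Type) (name : Pi -> seq bool) (p : Pi)
    : seq token :=
  TProp :: [seq TBit b | b <- name p].

(* Polish notation, the proposition symbol p being written as a marker
   followed by the binary word [name p].  A countably infinite [Pi] is one
   admitting a bijective [name]; injectivity makes the encoding faithful
   ([encode_inj]), surjectivity makes the set of encodings decidable. *)
Fixpoint encode (Pi : Type) (name : Pi -> seq bool) (phi : formula Pi)
    : seq token :=
  match phi with
  | Lit p => encode_symbol name p
  | NLit p => TNot :: encode_symbol name p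
  | And phi1 phi2 => TAnd :: encode name phi1 ++ encode name phi2
  | Or phi1 phi2 => TOr :: encode name phi1 ++ encode name phi2
  | Incl k p q =>
      TOpen :: flatten [seq encode_symbol name r | r <- p]
      ++ TSub :: flatten [seq encode_symbol name r | r <- q] ++ [:: TClose]
  | Box phi1 => TBox :: encode name phi1
  | Diamond phi1 => TDiamond :: encode name phi1
  end.

Definition encoded_problem (Pi : Type) (name : Pi -> seq bool)
    (P : formula Pi -> Prop) : seq token -> Prop :=
  fun w => exists phi : formula Pi, w = encode name phi /\ P phi.

Section EncodeInj.
Variables (Pi : Type) (name : Pi -> seq bool).
Hypothesis name_inj : injective name.

Let nobit (s : seq token) := if s is TBit _ :: _ then false else true.

Let bits_inj (a b : seq bool) s t : nobit s -> nobit t ->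
  map TBit a ++ s = map TBit b ++ t -> a = b /\ s = t.
Proof.
move=> hs ht; elim: a b => [|x a IH] [|y b] //=.
- by move=> e; move: hs; rewrite e.
- by move=> e; move: ht; rewrite -e.
- by case=> -> /IH[-> ->].
Qed.

Let symb_inj p q s t : nobit s -> nobit t ->
  encode_symbol name p ++ s = encode_symbol name q ++ t -> p = q /\ s = t.
Proof. by move=> hs ht [] /(bits_inj hs ht)[/name_inj-> ->]. Qed.

Let symbs (ps : seq Pi) := flatten [seq encode_symbol name r | r <- ps].

Let symbs_nobit ps s : nobit s -> nobit (symbs ps ++ s).
Proof. by case: ps. Qed.

Let noprop (s : seq token) := if s is TProp :: _ then false else true.

Let symbs_inj ps qs s t : nobit s -> nobit t -> noprop s -> noprop t ->
  symbs ps ++ s = symbs qs ++ t -> ps = qs /\ s = t.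
Proof.
move=> hs ht ks kt; elim: ps qs => [|p ps IH] [|q qs] //.
- by move=> /= e; move: ks; rewrite e.
- by move=> /= e; move: kt; rewrite -e.
- rewrite /symbs /= -!catA => /(symb_inj (symbs_nobit _ hs) (symbs_nobit _ ht)).
  by case=> -> /IH[-> ->].
Qed.

Let encode_nobit phi s : nobit (encode name phi ++ s).
Proof. by case: phi. Qed.

Let encode_cat_inj phi psi s t : nobit s -> nobit t ->
  encode name phi ++ s = encode name psi ++ t -> phi = psi /\ s = t.
Proof.
move=> hs ht; elim: phi psi s t hs ht
  => [p|p|f1 IH1 f2 IH2|f1 IH1 f2 IH2|k p q|f IH|f IH]
     [p'|p'|g1 g2|g1 g2|k' p' q'|g|g] s t hs ht //.
- by move=> /(symb_inj hs ht)[-> ->].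
- by rewrite /= => -[] /(bits_inj hs ht)[/name_inj-> ->].
- rewrite /= -!catA => -[] /(IH1 _ _ _ (encode_nobit _ _) (encode_nobit _ _)).
  by case=> -> /(IH2 _ _ _ hs ht)[-> ->].
- rewrite /= -!catA => -[] /(IH1 _ _ _ (encode_nobit _ _) (encode_nobit _ _)).
  by case=> -> /(IH2 _ _ _ hs ht)[-> ->].
- rewrite /= -!catA /= -!catA /= => -[].
  move=> /symbs_inj[]// ep [] /symbs_inj[]// eq [est]; split=> //.
  have /succn_inj ek : k.+1 = k'.+1 by rewrite -(size_tuple p) ep size_tuple.
  by case: k' / ek p' q' ep eq => p' q' /val_inj-> /val_inj->.
- by rewrite /= => -[] /(IH _ _ _ hs ht)[-> ->].
- by rewrite /= => -[] /(IH _ _ _ hs ht)[-> ->].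
Qed.

Lemma encode_inj : injective (encode name).
Proof.
move=> phi psi e; have := @encode_cat_inj phi psi [::] [::] isT isT.
by rewrite e => /(_ erefl)[].
Qed.

End EncodeInj.

(* Tapes are infinite in both directions: [tleft] is read away from the head
   and all cells outside [tleft] and [tright] are blank ([None]). *)
Record tape (S : Type) : Type := Tape {
  tleft : seq (option S);
  thead : option S;
  tright : seq (option S)
}.

Inductive move : Type := MoveLeft | Stay | MoveRight.

Definition tape_act (S : Type) (t : tape S) (a : option S * move) : tape S :=
  match a.2 with
  | MoveLeft => Tape (behead (tleft t)) (head None (tleft t))
                     (a.1 :: tright t)
  | Stay => Tape (tleft t) a.1 (tright t)
  | MoveRight => Tape (a.1 :: tleft t) (head None (tright t))
                      (behead (tright t))
  end.

Definition tape_of (S : Type) (w : seq S) : tape S :=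
  Tape [::] (ohead w) [seq Some a | a <- behead w].

(* A is the input alphabet; the tape alphabet consists of the input symbols,
   the symbols of [aux] and the blank. *)
Record ntm (A : finType) : Type := NTM {
  state : finType;
  aux : finType;
  extra_tapes : nat;
  start : state;
  accept : {set state};
  delta : state -> {ffun 'I_extra_tapes.+1 -> option (A + aux)} ->
    state -> {ffun 'I_extra_tapes.+1 -> option (A + aux) * move} -> bool
}.

Record config (A : finType) (M : ntm A) : Type := Config {
  cstate : state M;
  ctapes : 'I_(extra_tapes M).+1 -> tape (A + aux M)
}.

Definition initial (A : finType) (M : ntm A) (w : seq A) : config M :=
  Config (start M) (fun i => tape_of (if i == ord0 then map inl w else [::])).

Definition step (A : finType) (M : ntm A) (c c' : config M) : Prop :=
  exists a : {ffun 'I_(extra_tapes M).+1 -> option (A + aux M) * move},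
    delta (cstate c) [ffun i => thead (ctapes c i)] (cstate c') a /\
    (forall i, ctapes c' i = tape_act (ctapes c i) (a i)).

Fixpoint steps (A : finType) (M : ntm A) (n : nat) (c c' : config M) : Prop :=
  if n is m.+1 then exists2 d, step c d & steps m d c' else c = c'.

Definition halted (A : finType) (M : ntm A) (c : config M) : Prop :=
  ~ exists c' : config M, step c c'.

Definition accepts (A : finType) (M : ntm A) (w : seq A) : Prop :=
  exists (n : nat) (c : config M),
    [/\ steps n (initial M w) c, halted c & cstate c \in accept M].

(* The bound is on all computation branches, accepting or not. *)
Definition runs_in_time (A : finType) (M : ntm A) (t : nat -> nat) : Prop :=
  forall (w : seq A) (n : nat) (c : config M),
    steps n (initial M w) c -> n <= t (size w).

Definition NTIME (t : nat -> nat) (A : finType) (L : seq A -> Prop) : Prop :=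
  exists (M : ntm A) (c : nat),
    runs_in_time M (fun n => c * t n) /\ (forall w, accepts M w <-> L w).

Definition NEXPTIME (A : finType) (L : seq A -> Prop) : Prop :=
  exists k : nat, NTIME (fun n => 2 ^ (n ^ k)) L.

(* Main.v *)
(* Replacing a node by several copies with the same successors does not change
   the value of a formula on the preimage of a team, even under strict
   semantics, provided the disjuncts and the choice functions are pulled back;
   conversely, duplicating nodes lets a strict Diamond reach every successor
   that some choice reaches.  So a formula is satisfiable iff there is a finite
   set of types (which subformula occurrences have the node in their team,
   the valuation, the modality through which the node was entered, its depth)
   closed under local conditions: every type of positive depth has a
   predecessor, every Diamond a successor, every inclusion atom a witness.
   A type is a word aligned with the input, so there are exponentially many.
   The machine guesses rows, which are types that also carry one syntactic fact
   about the input (such as the positions where a subformula starts and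
   ends), and checks the conditions, including the parsing of the input, as a
   fixed first-order sentence over positions and rows.  A clock bounds all of
   its branches.  Since the model built from the rows is finite, satisfiability
   and finite satisfiability coincide. *)
From mathcomp Require Import all_boot zify.
From mathcomp Require Import boolp classical_sets cardinality.
Require Import Defs.

Set Implicit Arguments.
Unset Strict Implicit.
Unset Printing Implicit Defensive.

(** * Nondeterministic programs on several tapes *)

(** Strictness is the obstacle: a node may go to one side of a disjunction only, and a Diamond
    selects one successor per node, so types alone do not determine a team. Copies provide the
    missing freedom, and the model built from rows has to contain enough of them at once: a node is
    a whole branch of rows with a depth, whose entries beyond the depth act as a stock of future
    choices. Recording the depth makes the predecessor relation well-founded; it stays below the
    input length because each modality passed occupies a position. Facts are needed because a fixed
    sentence that only steps to the next position cannot follow a subformula or a name of unbounded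
    length. Each fact is justified by facts further right, so induction on the distance to the end
    shows that it is true. Names are certified to differ rather than to agree: a difference is found
    locally, and two values of a symbol must agree unless a difference is certified. Only guessing,
    disjunction and existential quantification are nondeterministic. A universal quantifier is a
    sweep over a tape of exponential length, and nesting a fixed number of sweeps keeps the time
    exponential. *)

Section Programs.
Variables (I : Type) (S : finType).

Definition tapes := I -> tape S.
Definition heads (t : tapes) : I -> option S := fun i => thead (t i).
Definition act (t : tapes) (a : I -> option S * move) : tapes :=
  fun i => tape_act (t i) (a i).
Definition rule := (I -> option S) -> (I -> option S * move) -> Prop.

Inductive prog :=
| Act of rule
| Seq of prog & prog
| Alt of prog & prog
| Star of prog.

Definition idle : rule := fun h a => a = fun i => (h i, Stay).

Lemma act_idle t a : idle (heads t) a -> act t a = t.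
Proof. by move=> ->; apply/funext => i; rewrite /act /heads; case: (t i). Qed.

(** The control points of a program, glued by idle transitions as in Thompson's construction of an
    automaton from a regular expression. A [Star] has one new point, which is both its entry and its
    exit. *)
Fixpoint node (p : prog) : finType :=
  match p with
  | Act _ => bool
  | Seq p q => (node p + node q)%type
  | Alt p q => (node p + node q + bool)%type
  | Star p => option (node p)
  end.

Fixpoint entry (p : prog) : node p :=
  match p with
  | Act _ => false
  | Seq p q => inl (entry p)
  | Alt p q => inr false
  | Star p => None
  end.

Fixpoint exit (p : prog) : node p :=
  match p with
  | Act _ => true
  | Seq p q => inr (exit q)
  | Alt p q => inr true
  | Star p => None
  end.

Fixpoint edge (p : prog) : node p -> node p -> rule :=
  match p with
  | Act r => fun x y h a => [/\ x = false, y = true & r h a]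
  | Seq p q => fun x y h a =>
      match x, y with
      | inl x, inl y => edge x y h a
      | inr x, inr y => edge x y h a
      | inl x, inr y => [/\ x = exit p, y = entry q & idle h a]
      | inr _, inl _ => False
      end
  | Alt p q => fun x y h a =>
      match x, y with
      | inl (inl x), inl (inl y) => edge x y h a
      | inl (inr x), inl (inr y) => edge x y h a
      | inr false, inl (inl y) => y = entry p /\ idle h a
      | inr false, inl (inr y) => y = entry q /\ idle h a
      | inl (inl x), inr true => x = exit p /\ idle h a
      | inl (inr x), inr true => x = exit q /\ idle h a
      | _, _ => False
      end
  | Star p => fun x y h a =>
      match x, y with
      | Some x, Some y => edge x y h a
      | None, Some y => y = entry p /\ idle h a
      | Some x, None => x = exit p /\ idle h a
      | None, None => False
      end
  end.

Definition pstep p (x : node p) t (y : node p) t' : Prop :=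
  exists a, edge x y (heads t) a /\ t' = act t a.

Inductive psteps p : nat -> node p -> tapes -> node p -> tapes -> Prop :=
| psteps0 x t : psteps 0 x t x t
| pstepsS n x t y t' z t'' :
    pstep x t y t' -> psteps n y t' z t'' -> psteps n.+1 x t z t''.

Inductive reach p t : node p -> tapes -> Prop :=
| reach0 : reach t (entry p) t
| reachS x t1 y t2 : reach t x t1 -> pstep x t1 y t2 -> reach t y t2.

(** The [2] pays for the idle moves by which a round leaves the loop point and returns to it. A loop
    may stop after any round. *)
Inductive iterate (E : nat -> tapes -> tapes -> Prop)
  : nat -> tapes -> tapes -> Prop :=
| iterate0 n t : iterate E n t t
| iterateS n1 n2 n t1 t2 t3 : E n1 t1 t2 -> iterate E n2 t2 t3 ->
    n1 + n2 + 2 <= n -> iterate E n t1 t3.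

(* [n] is an upper bound on the number of machine steps. *)
Fixpoint exec (p : prog) (n : nat) (t t' : tapes) : Prop :=
  match p with
  | Act r => 0 < n /\ exists a, r (heads t) a /\ t' = act t a
  | Seq p q => exists n1 n2 t1,
      [/\ exec p n1 t t1, exec q n2 t1 t' & n1 + n2 < n]
  | Alt p q => 1 < n /\ (exec p n.-2 t t' \/ exec q n.-2 t t')
  | Star p => iterate (exec p) n t t'
  end.

Lemma exec_seq p q n t t' : exec (Seq p q) n t t' = exists n1 n2 t1,
  [/\ exec p n1 t t1, exec q n2 t1 t' & n1 + n2 < n].
Proof. by []. Qed.

Lemma exec_seqI n1 n2 t1 p q n t t' : exec p n1 t t1 -> exec q n2 t1 t' ->
  n1 + n2 < n -> exec (Seq p q) n t t'.
Proof. by rewrite exec_seq; exists n1, n2, t1. Qed.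

Lemma exec_alt p q n t t' :
  exec (Alt p q) n t t' = (1 < n /\ (exec p n.-2 t t' \/ exec q n.-2 t t')).
Proof. by []. Qed.

Lemma exec_star p n t t' : exec (Star p) n t t' = iterate (exec p) n t t'.
Proof. by []. Qed.

Lemma exec_leq p m n t t' : m <= n -> exec p m t t' -> exec p n t t'.
Proof.
elim: p m n t t' => [r|p IHp q IHq|p IHp q IHq|p IH] m n t t' le_mn /=.
- by case=> m0 H; split=> //; lia.
- by case=> n1 [n2] [t1] [H1 H2 H3]; exists n1, n2, t1; split=> //; lia.
- case=> m1 [H|H]; (split; first lia); [left; apply: IHp H|right; apply: IHq H];
  lia.
- move=> H; case: H le_mn => [*|n1 n2 k s s1 s2 H1 H2 le le_mn]; first exact: iterate0.
  by apply: iterateS H1 H2 _; lia.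
Qed.

Lemma psteps_cat p m n (x y z : node p) t t1 t2 :
  psteps m x t y t1 -> psteps n y t1 z t2 -> psteps (m + n) x t z t2.
Proof. by elim=> // {}m {}x {}t u t' v t'' st _ IH /IH; rewrite addSn; econstructor; eauto. Qed.

Lemma psteps_hom p q (f : node p -> node q) :
  (forall x y h a, edge x y h a -> edge (f x) (f y) h a) ->
  forall n x t y t', psteps n x t y t' -> psteps n (f x) t (f y) t'.
Proof.
move=> hom n x t y t'; elim=> [*|{}n {}x {}t u s v s' [a [e ->]] _ IH]; first exact: psteps0.
by apply: pstepsS IH; exists a; split=> //; apply: hom.
Qed.

Lemma pstep_idle p (x y : node p) t :
  (forall a, idle (heads t) a -> edge x y (heads t) a) -> pstep x t y t.
Proof.
move=> e; exists (fun i => (heads t i, Stay)); split; first exact: e.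
by rewrite act_idle.
Qed.

Lemma exec_psteps p n t t' : exec p n t t' ->
  exists2 m, m <= n & psteps m (entry p) t (exit p) t'.
Proof.
elim: p n t t' => [r|p IHp q IHq|p IHp q IHq|p IH] n t t' /=.
- case=> n0 [a [ra ->]]; exists 1 => //; apply: pstepsS (psteps0 _ _).
  by exists a.
- move=> [n1 [n2 [t1 [/IHp[m1 le1 s1] /IHq[m2 le2 s2] lt]]]].
  exists (m1 + m2.+1); first lia.
  apply: psteps_cat (psteps_hom (q := Seq p q) (f := inl) _ s1) _ => //.
  apply: pstepsS (psteps_hom (q := Seq p q) (f := inr) _ s2) => //.
  exact: pstep_idle.
- case=> n1 [/IHp|/IHq] [m le s]; exists m.+2; try lia.
  + apply: (@pstepsS (Alt p q) _ _ _ (inl (inl (entry p)))); first exact: pstep_idle.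
    rewrite -addn1; apply: psteps_cat (psteps_hom (q := Alt p q) (f := inl \o inl) _ s) _ => //.
    by apply: pstepsS (psteps0 _ _); apply: pstep_idle.
  + apply: (@pstepsS (Alt p q) _ _ _ (inl (inr (entry q)))); first exact: pstep_idle.
    rewrite -addn1; apply: psteps_cat (psteps_hom (q := Alt p q) (f := inl \o inr) _ s) _ => //.
    by apply: pstepsS (psteps0 _ _); apply: pstep_idle.
- elim=> [*|n1 n2 {}n t1 t2 t3 /IH[m le s] _ [m2 le2 s2] le3].
    by exists 0 => //; apply: psteps0.
  exists (m.+1 + m2.+1); first lia.
  apply: (@psteps_cat (Star p) _ _ _ (Some (exit p)) _ _ t2).
    apply: (@pstepsS (Star p) _ _ _ (Some (entry p))); first exact: pstep_idle.
    by apply: (psteps_hom (q := Star p) (f := Some)).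
  by apply: pstepsS s2; apply: pstep_idle.
Qed.

(** For a composite program the invariant [H] records, at each control point, which parts have been
    executed completely before it. *)
Lemma reach_exec p t t' : reach t (exit p) t' -> exists n, exec p n t t'.
Proof.
elim: p t t' => [r|p IHp q IHq|p IHp q IHq|p IH] t t' /=.
- have H x s : @reach (Act r) t x s -> if x then exec (Act r) 1 t s else s = t.
    elim=> //= {}x t1 y t2 _ Hx [a [[ex -> ra] et]] /=.
    by rewrite ex in Hx; subst; split=> //; exists a.
  by move/H; exists 1.
- have H x s : @reach (Seq p q) t x s ->
    match x with
    | inl x => reach t x s
    | inr y => exists n t1, exec p n t t1 /\ reach t1 y s
    end.
    elim=> [|{}x t1 y t2 _ Hx [a []]]; first exact: reach0.
    case: x y Hx => [x|x] [y|y] //= Hx.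
    + by move=> e ->; apply: reachS Hx _; exists a.
    + case=> ex -> /act_idle-> ->; rewrite ex in Hx.
      by have [n Hn] := IHp _ _ Hx; exists n, t1; split=> //; apply: reach0.
    + case: Hx => n [s1 [Hn Hx]] e ->; exists n, s1; split=> //.
      by apply: reachS Hx _; exists a.
  move=> /H[n [t1 [Hn /IHq[m Hm]]]]; exists (n + m).+1, n, m, t1; split=> //.
- have H x s : @reach (Alt p q) t x s ->
    match x with
    | inl (inl x) => reach t x s
    | inl (inr x) => reach t x s
    | inr false => s = t
    | inr true => exists n, exec (Alt p q) n t s
    end.
    elim=> // {}x t1 y t2 _ Hx [a []].
    case: x y Hx => [[x|x]|[]] [[y|y]|[]] //= Hx.
    + by move=> e ->; apply: reachS Hx _; exists a.
    + case=> ex /act_idle-> ->; rewrite ex in Hx.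
      by have [n Hn] := IHp _ _ Hx; exists n.+2; split=> //; left.
    + by move=> e ->; apply: reachS Hx _; exists a.
    + case=> ex /act_idle-> ->; rewrite ex in Hx.
      by have [n Hn] := IHq _ _ Hx; exists n.+2; split=> //; right.
    + by case=> -> /act_idle-> ->; rewrite Hx; apply: reach0.
    + by case=> -> /act_idle-> ->; rewrite Hx; apply: reach0.
  by move/H.
- pose it s := exists n, iterate (exec p) n t s.
  (* [iterate] grows at its front, a computation at its end, so a round has to be appended. *)
  have it_snoc n s s' : it s -> exec p n s s' -> it s'.
    rewrite /it; case=> m Hi; elim: Hi s' => [{}m t1|n1 n2 {}m t1 t2 t3 Hn1 _ Hk _] s' Hs.
      by exists (n + 0 + 2); apply: (iterateS Hs (iterate0 _ 0 _)).
    by have [k Hk'] := Hk _ Hs; exists (n1 + k + 2); apply: (iterateS Hn1 Hk').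
  have H x s : @reach (Star p) t x s ->
    match x with
    | Some x => exists2 t1, it t1 & reach t1 x s
    | None => it s
    end.
    elim=> [|{}x t1 y t2 _ Hx [a []]]; first by exists 0; apply: iterate0.
    case: x y Hx => [x|] [y|] //=.
    + case=> s1 His Hx e ->; exists s1 => //.
      by apply: reachS Hx _; exists a.
    + case=> s1 His Hx [ex /act_idle-> ->]; rewrite ex in Hx.
      by have [n Hn] := IH _ _ Hx; apply: it_snoc His Hn.
    + by move=> Hx [-> /act_idle-> ->]; exists t1 => //; apply: reach0.
  by move/H.
Qed.

End Programs.

(** * A clocked Turing machine running a program *)

Section Machine.
Variables (A G : finType) (b : nat).

Definition extra : finType := ('I_b.+1 + (bool + option G))%type.
Definition sym : finType := (A + extra)%type.
Definition tok (c : A) : sym := inl c.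
Definition dig (d : 'I_b.+1) : sym := inr (inl d).
Definition lmark : sym := inr (inr (inl false)).
Definition rmark : sym := inr (inr (inl true)).
Definition hash : sym := inr (inr (inr None)).
Definition gl (g : G) : sym := inr (inr (inr (Some g))).

Variables (K : nat) (I : Type) (idx : 'I_K -> I) (xdi : I -> 'I_K).
Hypotheses (idxK : cancel idx xdi) (xdiK : cancel xdi idx).
Variables (isw : I -> bool) (p : prog I sym).

(** The states [inl] load the input. In [inr (q, c)] the program is at the control point [q], and
    [c] holds while a carry runs through the clock. *)
Definition mstate : finType := (bool + node p * bool)%type.

(** Copying the input turns its tape into the clock, one zero digit per letter, so that the clock
    has [b.+1 ^ size w] values without any arithmetic on the length. When a carry runs past the last
    digit no clause applies, and the machine halts in a state that is not accepting. *)
Inductive Delta : mstate -> option sym -> (I -> option sym) ->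
    mstate -> option sym * move -> (I -> option sym * move) -> Prop :=
| D_start h0 h : Delta (inl false) h0 h (inl true) (h0, Stay)
    (fun _ => (Some lmark, MoveRight))
| D_copy c h : Delta (inl true) (Some (tok c)) h
    (inl true) (Some (dig ord0), MoveRight)
    (fun v => if isw v then (Some (tok c), MoveRight) else (h v, Stay))
| D_go h : Delta (inl true) None h (inr (entry p, false)) (None, Stay)
    (fun v => if isw v then (Some rmark, Stay) else (h v, Stay))
| D_back q (d : 'I_b.+1) h a : idle h a -> Delta (inr (q, false)) (Some (dig d)) h
    (inr (q, false)) (Some (dig d), MoveRight) a
| D_run q q' h a : edge q q' h a -> Delta (inr (q, false)) None h
    (inr (q', true)) (None, MoveLeft) a
| D_carry q h a : idle h a -> Delta (inr (q, true)) (Some (dig ord_max)) h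
    (inr (q, true)) (Some (dig ord0), MoveLeft) a
| D_incr q (d : 'I_b.+1) h a : idle h a -> d < b -> Delta (inr (q, true)) (Some (dig d)) h
    (inr (q, false)) (Some (dig (inord d.+1)), MoveRight) a.

Definition restr X (h : 'I_K.+1 -> X) : I -> X := fun v => h (lift ord0 (xdi v)).
Definition join X (x : X) (h : I -> X) : 'I_K.+1 -> X :=
  fun j => if unlift ord0 j is Some k then h (idx k) else x.

Lemma join0 X x (h : I -> X) : join x h ord0 = x.
Proof. by rewrite /join unlift_none. Qed.

Lemma restr_join X x (h : I -> X) : restr (join x h) = h.
Proof. by apply/funext => v; rewrite /restr /join liftK xdiK. Qed.

Lemma join_restr X (h : 'I_K.+1 -> X) : join (h ord0) (restr h) = h.
Proof.
apply/funext => j; rewrite /join /restr.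
by case: unliftP => [k|] -> /=; rewrite ?idxK.
Qed.

Definition machine : ntm A := {|
  state := mstate; aux := extra; extra_tapes := K;
  start := inl false; accept := [set inr (exit p, false)];
  delta := fun s h s' a => `[< Delta s (h ord0) (restr h) s' (a ord0) (restr a) >]
|}.

Definition mconf := (mstate * tape sym * tapes I sym)%type.
Definition mstep (c c' : mconf) : Prop := exists a0 a,
  [/\ Delta c.1.1 (thead c.1.2) (heads c.2) c'.1.1 a0 a,
      c'.1.2 = tape_act c.1.2 a0 & c'.2 = act c.2 a].

Fixpoint msteps n (c c' : mconf) : Prop :=
  if n is m.+1 then exists2 d, mstep c d & msteps m d c' else c = c'.

Definition view (c : config machine) : mconf :=
  (cstate c, ctapes c ord0, restr (ctapes c)).
Definition unview (c : mconf) : config machine :=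
  @Config A machine c.1.1 (join c.1.2 c.2).

Lemma unviewK : cancel unview view.
Proof. by case=> [[s k] t]; rewrite /view /= join0 restr_join. Qed.

Lemma viewK : cancel view unview.
Proof. by case=> s t; rewrite /unview /view /= join_restr. Qed.

Lemma step_mstep c c' : step c c' <-> mstep (view c) (view c').
Proof.
split.
  case=> a [/asboolP d e]; exists (a ord0), (restr a); split.
  - by move: d; rewrite ffunE (_ : restr _ = heads (view c).2) //;
       apply/funext => v; rewrite /restr ffunE.
  - exact: e.
  - by apply/funext => v; rewrite /act -e.
case=> a0 [a [d e0 e]]; exists [ffun j => join a0 a j]; split.
  apply/asboolP; move: d.
  rewrite !ffunE join0 (_ : restr [ffun j => join a0 a j] = a); last first.
    by rewrite -[RHS](restr_join a0); apply/funext => v; rewrite /restr ffunE.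
  by rewrite (_ : restr _ = heads (view c).2) //;
       apply/funext => v; rewrite /restr ffunE.
move=> j; rewrite ffunE /join; case: unliftP => [k|] -> //.
  by have := congr1 (fun t => t (idx k)) e; rewrite /view /act /restr /= idxK.
Qed.

Lemma steps_msteps n c c' : steps n c c' -> msteps n (view c) (view c').
Proof.
elim: n c => [c ->//|n IH c [d /step_mstep cd /IH H]] /=.
by exists (view d).
Qed.

Lemma msteps_steps n c x : msteps n (view c) x -> steps n c (unview x).
Proof.
elim: n c => [c <-|n IH c [d cd H]] /=; first by rewrite viewK.
exists (unview d); first by apply/step_mstep; rewrite unviewK.
by apply: IH; rewrite unviewK.
Qed.

Lemma msteps_cat m n x y z : msteps m x y -> msteps n y z -> msteps (m + n) x z.
Proof.
by elim: m x => [x -> //|m IH x [d xd H] /(IH _ H) yz]; exists d.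
Qed.

Lemma msteps1 x y : mstep x y -> msteps 1 x y.
Proof. by exists y. Qed.

Definition digits (ds : seq 'I_b.+1) : seq (option sym) := [seq Some (dig d) | d <- ds].
Definition clock (ds : seq 'I_b.+1) : nat := foldr (fun d v => nat_of_ord d + b.+1 * v) 0 ds.

Lemma clock_lt ds : clock ds < b.+1 ^ size ds.
Proof.
elim: ds => //= d ds IH; rewrite expnS.
have := ltn_ord d; nia.
Qed.

Lemma clock_cat ds ds' : clock (ds ++ ds') = clock ds + b.+1 ^ size ds * clock ds'.
Proof. by elim: ds => [|d ds IH] /=; rewrite ?mul1n // IH expnS; lia. Qed.

Lemma clock_nseq0 j : clock (nseq j ord0) = 0.
Proof. by elim: j => //= j ->; rewrite muln0. Qed.

Lemma clock_nseq_max j : (clock (nseq j ord_max)).+1 = b.+1 ^ j.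
Proof. by elim: j => //= j IH; rewrite expnS -IH; lia. Qed.

Lemma clock_incr j (d d' : 'I_b.+1) l : d' = d.+1 :> nat ->
  clock (nseq j ord0 ++ d' :: l) = (clock (nseq j ord_max ++ d :: l)).+1.
Proof.
move=> e; rewrite !clock_cat /= !size_nseq clock_nseq0 e -addSn clock_nseq_max; nia.
Qed.

Lemma nseq_consr (T : Type) j (x : T) s : nseq j x ++ x :: s = nseq j.+1 x ++ s.
Proof. by elim: j => //= j ->. Qed.

Definition toks (w : seq A) : seq sym := [seq tok c | c <- w].

(* The clock on tape 0 is written with its least significant digit next to the
   blank on the right, where its head rests between two steps of the program.
   The last argument bounds the number of remaining steps. *)
Inductive Inv (n : nat) : mstate -> tape sym -> nat -> Prop :=
| I_start w : size w = n -> Inv n (inl false) (tape_of (toks w))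
    (b.+1 ^ n * (2 * n + 3) + n + 2)
| I_copy k w : k + size w = n ->
    Inv n (inl true) (Tape (digits (nseq k ord0)) (ohead (toks w))
      [seq Some c | c <- behead (toks w)]) (b.+1 ^ n * (2 * n + 3) + size w + 1)
| I_rest q ds : size ds = n -> Inv n (inr (q, false)) (Tape (digits ds) None [::])
    ((b.+1 ^ n - clock ds) * (2 * n + 3))
| I_back q l d r : size l + (size r).+1 = n -> Inv n (inr (q, false))
    (Tape (digits l) (Some (dig d)) (digits r ++ [:: None]))
    ((b.+1 ^ n - clock (rev r ++ d :: l)) * (2 * n + 3) + (size r).+1)
| I_sweep q l d j : size l + j.+1 = n -> Inv n (inr (q, true))
    (Tape (digits l) (Some (dig d)) (digits (nseq j ord0) ++ [:: None]))
    ((b.+1 ^ n - clock (nseq j ord_max ++ d :: l)) * (2 * n + 3) - j.+1)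
| I_over q k : thead k = None -> Inv n (inr (q, true)) k 0.

(** A tick consists of one program step, a carry to the left and the return to the right, which the
    factor [2 * n + 3] covers. In [I_sweep] the digits already reset still count as maximal, so the
    clock value in the bound changes only when the incremented digit is written. *)
Lemma Inv_step n s k t s' k' t' m : Inv n s k m -> mstep (s, k, t) (s', k', t') ->
  exists2 m', m' < m & Inv n s' k' m'.
Proof.
case=> {s k m} [w ew|j w ew|q ds es|q l d r es|q l d j es|q k ek] [a0 [a []]] /=.
- move E: (inl false) => s; move E0: (ohead _) => h0 D; case: D E E0 => //= {}h0 h _ e -> _.
  exists (b.+1 ^ n * (2 * n + 3) + size w + 1); first lia.
  by rewrite -e; apply: (@I_copy _ 0).
- move E: (inl true) => s; move E0: (ohead _) => h0 D; case: D E E0 => //=.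
  + move=> c h _; case: w ew => //= c' w ew [<-] -> _.
    exists (b.+1 ^ n * (2 * n + 3) + size w + 1); first lia.
    have -> : tape_act (Tape (digits (nseq j ord0)) (Some (tok c')) [seq Some c | c <- toks w])
      (Some (dig ord0), MoveRight) = Tape (digits (nseq j.+1 ord0)) (ohead (toks w))
      [seq Some c | c <- behead (toks w)] by case: (w).
    by apply: I_copy; lia.
  + move=> h _; case: w ew => //= ew _ -> _.
    have := @I_rest n (entry p) (nseq j ord0); rewrite clock_nseq0 subn0 size_nseq => H.
    exists (b.+1 ^ n * (2 * n + 3)); first lia.
    by apply: H; lia.
- move E: (inr _) => s; move E0: None => h0 D; case: D E E0 => //= {}q q' h {}a _ _ _ -> _.
  have lt := clock_lt ds; rewrite es in lt.
  rewrite /tape_act /=; case: ds es lt => [|d ds] /= es lt.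
    by exists 0; [nia | apply: I_over].
  exists ((b.+1 ^ n - (clock (d :: ds))) * (2 * n + 3) - 1); first by rewrite /=; nia.
  by have := @I_sweep n q' ds d 0; apply; lia.
- move E: (inr _) => s; move E0: (Some _) => h0 D; case: D E E0 => //= {}q d' h {}a _ _ [<-] -> _.
  rewrite /tape_act /=; case: r es => [|d2 r] es /=.
    exists ((b.+1 ^ n - clock (d :: l)) * (2 * n + 3)).
      by rewrite /= addn1.
    by apply: (@I_rest _ _ (d :: l)); rewrite -es addn1.
  exists ((b.+1 ^ n - clock (rev r ++ d2 :: d :: l)) * (2 * n + 3) + (size r).+1).
    by rewrite rev_cons cat_rcons; lia.
  by apply: (@I_back _ _ (d :: l)) => /=; move: es => /=; lia.
- have := clock_lt (nseq j ord_max ++ d :: l).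
  rewrite size_cat size_nseq /= (_ : j + (size l).+1 = n); last lia.
  move=> lt.
  move E: (inr _) => s; move E0: (Some _) => h0 D; case: D E E0 => //=.
  + move=> {}q h {}a _ _ [ed] -> _; subst d.
    rewrite /tape_act /=; case: l es lt => [|d2 l] /= es lt.
      by exists 0; [nia | apply: I_over].
    exists ((b.+1 ^ n - clock (nseq j.+1 ord_max ++ d2 :: l)) * (2 * n + 3) - j.+2).
      by rewrite nseq_consr /= in lt *; nia.
    by apply: (@I_sweep _ _ _ _ j.+1); lia.
  + move=> {}q d' h {}a _ ltb _ [ed] -> _; subst d'.
    have := @clock_incr j d (inord d.+1) l (inordK (ltb : d.+1 < b.+1)).
    move: (clock (nseq j ord_max ++ d :: l)) lt => M lt.
    rewrite /tape_act; case: j es => [|j] es e1.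
      exists ((b.+1 ^ n - M.+1) * (2 * n + 3)); first nia.
      by rewrite -e1; apply: (@I_rest _ _ (_ :: _)); rewrite -es addn1.
    exists ((b.+1 ^ n - M.+1) * (2 * n + 3) + j.+1); first nia.
    rewrite -e1 -nseq_consr -[in clock _]rev_nseq.
    have := @I_back n q ((inord d.+1) :: l) ord0 (nseq j ord0).
    by rewrite size_nseq; apply; rewrite /=; lia.
- move E: (inr _) => s; rewrite ek; move E0: None => h0 D; by case: D E E0.
Qed.

Lemma msteps_Inv n x y m m' : msteps n x y -> Inv m x.1.1 x.1.2 m' -> n <= m'.
Proof.
elim: n x m' => // n IH [[s k] t] m' [[[s' k'] t'] st H] /Inv_step -/(_ _ _ _ _ st) [m2 lt I2].
by have := IH _ _ H I2; lia.
Qed.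

Lemma view_initial w : view (initial machine w) =
  (inl false, tape_of (toks w), fun _ => tape_of [::]).
Proof. by []. Qed.

Lemma machine_time :
  runs_in_time machine (fun n => b.+1 ^ n * (2 * n + 3) + n + 2).
Proof.
move=> w n c /steps_msteps; rewrite view_initial => /msteps_Inv; apply.
exact: I_start.
Qed.

Lemma tape_act_keep (k : tape sym) : tape_act k (thead k, Stay) = k.
Proof. by case: k. Qed.

(** For [q = size s] the head stands on the blank behind the word, which is where a word is
    extended. *)
Definition tp (s : seq sym) (q : nat) : tape sym :=
  Tape (rev [seq Some x | x <- take q s]) (onth s q) [seq Some x | x <- drop q.+1 s].

Lemma tp_append s c :
  tape_act (tp s (size s)) (Some c, MoveRight) = tp (rcons s c) (size s).+1.
Proof.
rewrite /tape_act /tp [onth (rcons _ _) _]onth_default ?size_rcons //=.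
rewrite !drop_oversize ?size_rcons // take_size.
by rewrite take_oversize ?size_rcons // map_rcons rev_rcons.
Qed.

Lemma tp_last s c : tape_act (tp s (size s)) (Some c, Stay) = tp (rcons s c) (size s).
Proof.
rewrite /tape_act /tp -cats1 onth_cat ltnn subnn /= !drop_oversize ?size_cat ?addn1 //.
by rewrite take_size take_size_cat.
Qed.

Definition copied (w : seq A) : tapes I sym :=
  fun v => if isw v then tp (lmark :: toks w) (size w).+1 else tp [:: lmark] 1.

Definition loaded (w : seq A) : tapes I sym :=
  fun v => if isw v then tp (lmark :: toks w ++ [:: rmark]) (size w).+1
           else tp [:: lmark] 1.

Lemma act_start : act (fun _ => tape_of [::]) (fun _ => (Some lmark, MoveRight)) = copied [::].
Proof. by apply/funext => v; rewrite /act /copied; case: isw. Qed.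

Lemma act_copy w c : act (copied w) (fun v => if isw v then (Some (tok c), MoveRight)
  else (heads (copied w) v, Stay)) = copied (rcons w c).
Proof.
apply/funext => v; rewrite /act /heads /copied; case: isw; last first.
  exact: tape_act_keep.
have := tp_append (lmark :: toks w) (tok c); rewrite /= size_map => ->.
by rewrite /toks map_rcons size_rcons.
Qed.

Lemma act_go w : act (copied w) (fun v => if isw v then (Some rmark, Stay)
  else (heads (copied w) v, Stay)) = loaded w.
Proof.
apply/funext => v; rewrite /act /heads /copied /loaded; case: isw; last first.
  exact: tape_act_keep.
by have := tp_last (lmark :: toks w) rmark; rewrite /= size_map => ->; rewrite cats1.
Qed.

(** Once the program runs, the clock is forgotten: it can stop a computation but never alters the
    tapes of the program. *)
Definition Sound w (c : mconf) : Prop :=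
  match c.1.1 with
  | inl false => c = (inl false, tape_of (toks w), fun _ => tape_of [::])
  | inl true => exists w1 w2, [/\ w = w1 ++ w2, c.2 = copied w1 &
      c.1.2 = Tape (digits (nseq (size w1) ord0)) (ohead (toks w2))
                [seq Some c | c <- behead (toks w2)]]
  | inr (q, _) => reach (loaded w) q c.2
  end.

Lemma Sound_step w c c' : Sound w c -> mstep c c' -> Sound w c'.
Proof.
case: c c' => [[s k] t] [[s' k'] t'] S [a0 [a []]] /=.
move E: (thead k) => h0; move Eh: (heads t) => h D.
case: D E Eh S => {s s' h0 h a0 a} [h0 h|c h|h|q d h a e|q q' h a e|q h a e|q d h a e _] E Eh.
- move=> S -> ->; rewrite /Sound /=; case: S E Eh => -> -> E Eh.
  by exists [::], w; split=> //; [exact: act_start|by rewrite -E].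
- move=> S -> ->; rewrite /Sound /=; case: S => /= w1 [w2 [ew et ek]]; subst.
  case: w2 E => //= c' w2 [<-]; exists (rcons w1 c'), w2.
  split; [by rewrite cat_rcons|exact: act_copy|].
  by rewrite size_rcons; case: (w2).
- move=> S -> ->; rewrite /Sound /=; case: S => /= w1 [w2 [ew et ek]]; subst.
  case: w2 E => // _; rewrite cats0 act_go; exact: reach0.
- by rewrite -Eh in e; rewrite /Sound /= => S _ ->; rewrite act_idle.
- by rewrite -Eh in e; rewrite /Sound /= => S _ ->; apply: reachS S _; exists a.
- by rewrite -Eh in e; rewrite /Sound /= => S _ ->; rewrite act_idle.
- by rewrite -Eh in e; rewrite /Sound /= => S _ ->; rewrite act_idle.
Qed.

Lemma machine_sound w : accepts machine w -> exists n t, exec p n (loaded w) t.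
Proof.
case=> n [c [/steps_msteps + _]]; rewrite view_initial inE => st /eqP ec.
have : Sound w (view c).
  move: st; have : Sound w (inl false, tape_of (toks w), fun _ => tape_of [::]) by [].
  elim: n (inl false, _, _) => [x S <- //|n IH x S [y /(Sound_step S) Sy /IH]]; exact.
rewrite /Sound /= ec => /reach_exec[m Hm].
by exists m, (view c).2.
Qed.

Definition on_left ds r := Tape (behead (digits ds)) (head None (digits ds)) r.
Definition on_right ds (r : seq (option sym)) := Tape (digits ds) (head None r) (behead r).

Lemma mstep_idle s k h0 t s' a0 : thead k = h0 ->
  Delta s h0 (heads t) s' a0 (fun i => (heads t i, Stay)) ->
  mstep (s, k, t) (s', tape_act k a0, t).
Proof.
by move=> <- D; exists a0, (fun i => (heads t i, Stay)); split; rewrite //= act_idle.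
Qed.

Lemma msteps_carry q j ds r t :
  msteps j (inr (q, true), on_left (nseq j ord_max ++ ds) r, t)
    (inr (q, true), on_left ds (digits (nseq j ord0) ++ r), t).
Proof.
elim: j r => //= j IH r.
exists (inr (q, true), on_left (nseq j ord_max ++ ds) (Some (dig ord0) :: r), t).
  exact: (@mstep_idle _ (on_left (ord_max :: nseq j ord_max ++ ds) r) _ _ _ _
    (erefl _) (D_carry q (erefl _))).
by have := IH (Some (dig ord0) :: r); rewrite /digits !map_nseq nseq_consr.
Qed.

Lemma msteps_back q ds rs t :
  msteps (size rs) (inr (q, false), on_right ds (digits rs ++ [:: None]), t)
    (inr (q, false), Tape (digits (catrev rs ds)) None [::], t).
Proof.
elim: rs ds => //= d rs IH ds.
exists (inr (q, false), on_right (d :: ds) (digits rs ++ [:: None]), t) => //.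
exact: (@mstep_idle _ (on_right ds (digits (d :: rs) ++ [:: None])) _ _ _ _
  (erefl _) (D_back q d (erefl _))).
Qed.

(** The carry passes the [j] maximal digits in front; the absence of overflow provides a digit at
    which it stops. *)
Lemma clock_split ds : (clock ds).+1 < b.+1 ^ size ds ->
  exists j (d : 'I_b.+1) l, d < b /\ ds = nseq j ord_max ++ d :: l.
Proof.
elim: ds => //= d ds IH; case: (ltnP d b) => [lt _|le]; first by exists 0, d, ds.
have ed : d = ord_max by apply/val_inj => /=; have := ltn_ord d; lia.
rewrite ed expnS => /= H; case: IH => [|j [d' [l [lt ->]]]].
  by rewrite -(ltn_pmul2l (ltn0Sn b)); move: H; rewrite mulnS; lia.
by exists j.+1, d', l.
Qed.

Lemma msteps_tick q ds t : (clock ds).+1 < b.+1 ^ size ds ->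
  exists n ds', [/\ size ds' = size ds, clock ds' = (clock ds).+1 &
    msteps n (inr (q, true), on_left ds [:: None], t)
             (inr (q, false), Tape (digits ds') None [::], t)].
Proof.
case/clock_split => j [d [l [lt ->]]].
exists (j + (1 + size (nseq j (ord0 : 'I_b.+1)))),
  (catrev (nseq j ord0) ((inord d.+1 : 'I_b.+1) :: l)); split.
- by rewrite catrevE !size_cat size_rev !size_nseq.
- by rewrite catrevE rev_nseq (clock_incr _ _ (inordK (lt : d.+1 < b.+1))).
- apply: msteps_cat (msteps_carry _ _ _ _ _) _; apply: msteps_cat _ (msteps_back _ _ _ _).
  apply: msteps1.
  exact: (@mstep_idle _ (on_left (d :: l) (digits (nseq j ord0) ++ [:: None])) _ _ _ _
    (erefl _) (D_incr q (erefl _) lt)).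
Qed.

Lemma msteps_prog m x t y t' ds : psteps m x t y t' -> clock ds + m < b.+1 ^ size ds ->
  exists n ds', [/\ size ds' = size ds, clock ds' = clock ds + m &
    msteps n (inr (x, false), Tape (digits ds) None [::], t)
             (inr (y, false), Tape (digits ds') None [::], t')].
Proof.
move=> H; elim: H ds => [{}x {}t ds _|{}m {}x {}t z s {}y {}t' [a [e ->]] _ IH ds lt].
  by exists 0, ds; rewrite addn0.
have [|n1 [ds1 [e1 c1 s1]]] := @msteps_tick z ds (act t a); first lia.
have [|n2 [ds2 [e2 c2 s2]]] := IH ds1; first by rewrite c1 e1; lia.
exists (1 + (n1 + n2)), ds2; split; [lia|lia|].
apply: msteps_cat (msteps_cat s1 s2); apply: msteps1.
by exists (None, MoveLeft), a; split=> //; apply: D_run.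
Qed.

Lemma msteps_load w1 w2 :
  msteps (size w2).+1 (inl true, Tape (digits (nseq (size w1) ord0)) (ohead (toks w2))
     [seq Some c | c <- behead (toks w2)], copied w1)
   (inr (entry p, false), Tape (digits (nseq (size w1 + size w2) ord0)) None [::],
    loaded (w1 ++ w2)).
Proof.
elim: w2 w1 => [|c w2 IH] w1.
  apply: msteps1; exists (None, Stay), (fun v => if isw v then (Some rmark, Stay)
    else (heads (copied w1) v, Stay)); split; rewrite ?addn0 //; first exact: D_go.
  by rewrite /= act_go cats0.
exists (inl true, Tape (digits (nseq (size w1).+1 ord0)) (ohead (toks w2))
     [seq Some c | c <- behead (toks w2)], copied (rcons w1 c)).
  eexists; eexists; split; first exact: D_copy.
    by case: (w2).
  by rewrite act_copy.
by have := IH (rcons w1 c); rewrite size_rcons cat_rcons addSnnS.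
Qed.

(** Without an edge out of [exit p] the accepting configuration has no successor, as [halted]
    demands. The strict bound on [n] keeps the clock from overflowing. *)
Lemma machine_complete w n t :
  (forall y h a, ~ edge (exit p) y h a) ->
  exec p n (loaded w) t -> n < b.+1 ^ size w -> accepts machine w.
Proof.
move=> final /exec_psteps[m le /msteps_prog H lt].
have [|k [ds [_ _ s2]]] := H (nseq (size w) ord0).
  by rewrite clock_nseq0 size_nseq; lia.
have s1 := msteps_load [::] w.
have s0 : msteps 1 (view (initial machine w)) (inl true, tape_of (toks w), copied [::]).
  apply: msteps1; exists (thead (tape_of (toks w)), Stay), (fun _ => (Some lmark, MoveRight)).
  by rewrite view_initial act_start; split=> //; apply: D_start.
have {s0 s1 s2} := msteps_cat s0 (msteps_cat s1 s2).
set c := (inr _, _, t) => /msteps_steps st.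
exists (1 + ((size w).+1 + k)), (unview c); split=> //; last by rewrite inE.
case=> c' /step_mstep; rewrite unviewK => -[a0 [a [D _ _]]].
move: D; rewrite /c /=; move: (cstate c') (heads t) => s h; move E: (inr _) => s1.
by move Eh: None => h0 D; case: D E Eh => // q q' h' a' e [eq] _; subst q; apply: final e.
Qed.

End Machine.

(** * First-order sentences over a word and a list of rows *)

Section Formulas.
Variables (A G : finType) (g0 : G) (b : nat) (W R : finType) (x0 : W).
Notation I := (W + R)%type.
Notation sym := (sym A G b).
Notation prog := (prog I sym).
Notation lmark := (lmark A G b).
Notation rmark := (rmark A G b).
Notation hash := (hash A G b).
Notation gl := (@gl A G b).
Notation tok := (@tok A G b).

(** Every variable is a tape and its value is the place of its head, so a variable cannot be bound
    again within its own scope. [FTst] and [FRd] continue according to the letter read, which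
    replaces atomic predicates and makes negation dispensable. *)
Inductive fm :=
| FCst of bool
| FTst of W & (option A -> fm)
| FRd of R & W & (G -> fm)
| FAnd of fm & fm
| FOr of fm & fm
| FAll of I & fm
| FEx of I & fm
| FNext of W & fm.

Definition upd (e : I -> nat) v k : I -> nat := fun u => if u == v then k else e u.

Section Semantics.
Variables (w : seq A) (rows : seq (seq G)).

Definition lim (v : I) : nat := if v is inl _ then size w else size rows.

(* The resting value [lim v] marks the variables that are not in scope. *)
Fixpoint sat (phi : fm) (e : I -> nat) : Prop :=
  match phi with
  | FCst c => c
  | FTst x F => sat (F (onth w (e (inl x)))) e
  | FRd a x F => [/\ e (inl x) < size w, e (inr a) < size rows &
      sat (F (nth g0 (nth [::] rows (e (inr a))) (e (inl x)))) e]
  | FAnd phi psi => sat phi e /\ sat psi e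
  | FOr phi psi => sat phi e \/ sat psi e
  | FAll v phi => e v = lim v /\ forall k, k < lim v -> sat phi (upd e v k)
  | FEx v phi => e v = lim v /\ exists2 k, k < lim v & sat phi (upd e v k)
  | FNext x phi => e (inl x) < size w /\ sat phi (upd e (inl x) (e (inl x)).+1)
  end.
End Semantics.

Definition mv (g : (I -> option sym) -> Prop) (m : I -> move) : prog :=
  Act (fun h a => g h /\ a = fun v => (h v, m v)).
Definition still : I -> move := fun _ => Stay.
Definition only (v : I) (d : move) : I -> move := fun u => if u == v then d else Stay.
Definition is_tok (c : option sym) : bool := if c is Some (inl _) then true else false.
(** One cell for each value of a variable: a letter of the input, or the separator in front of a
    row. *)
Definition target (c : option sym) : bool :=
  match c with Some (inl _) | Some (inr (inr (inr None))) => true | _ => false end.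
Definition read (c : option sym) : option A := if c is Some (inl c) then Some c else None.

(** The guard restricts the moves but not the end of the loop. This freedom is the guess of a
    witness in [FEx]; elsewhere a test behind the loop discards the early stops. *)
Definition go_left v := Star (mv (fun h => h v <> Some lmark) (only v MoveLeft)).
Definition go_right v := Star (mv (fun h => h v <> Some rmark) (only v MoveRight)).
Definition branch (T : Type) (s : seq T) (f : T -> prog) : prog :=
  foldr (fun x q => Alt (f x) q) (mv (fun _ => False) still) s.

Definition opposite (x a : I) (dx da : move) : I -> move :=
  fun u => if u == x then dx else if u == a then da else Stay.

(** A successful run leaves all heads where it found them, so that programs compose. [FRd] finds its
    letter without a counter: the head of [x] walks to the left mark while the head of [a] walks
    right from its separator, and walking back to the separator restores both. [FAll] sweeps its
    tape from right to left and passes over the cells that are not values. *)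
Fixpoint prog_of (phi : fm) : prog :=
  match phi with
  | FCst c => mv (fun _ => c) still
  | FTst x F => branch (enum {: option A}) (fun t =>
      Seq (mv (fun h => read (h (inl x)) = t) still) (prog_of (F t)))
  | FRd a x F =>
      Seq (mv (fun h => is_tok (h (inl x)) /\ h (inr a) = Some hash) still)
     (Seq (Star (mv (fun h => h (inl x) <> Some lmark)
                  (opposite (inl x) (inr a) MoveLeft MoveRight)))
     (Seq (mv (fun h => h (inl x) = Some lmark) still)
     (branch (enum G) (fun g =>
      Seq (mv (fun h => h (inr a) = Some (gl g)) still)
     (Seq (Star (mv (fun h => h (inr a) <> Some hash)
                  (opposite (inl x) (inr a) MoveRight MoveLeft)))
     (Seq (mv (fun h => h (inr a) = Some hash) still)
      (prog_of (F g))))))))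
  | FAnd phi psi => Seq (prog_of phi) (prog_of psi)
  | FOr phi psi => Alt (prog_of phi) (prog_of psi)
  | FAll v phi =>
      Seq (mv (fun h => h v = Some rmark) still)
     (Seq (Star (Seq (mv (fun h => h v <> Some lmark) (only v MoveLeft))
                (Alt (mv (fun h => ~~ target (h v)) still)
                     (Seq (mv (fun h => target (h v)) still) (prog_of phi)))))
     (Seq (mv (fun h => h v = Some lmark) still)
     (Seq (go_right v) (mv (fun h => h v = Some rmark) still))))
  | FEx v phi =>
      Seq (mv (fun h => h v = Some rmark) still)
     (Seq (go_left v)
     (Seq (mv (fun h => target (h v)) still)
     (Seq (prog_of phi)
     (Seq (go_right v) (mv (fun h => h v = Some rmark) still)))))
  | FNext x phi =>
      Seq (mv (fun h => is_tok (h (inl x))) (only (inl x) MoveRight))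
     (Seq (prog_of phi) (mv (fun _ => True) (only (inl x) MoveLeft)))
  end.

(** [L] stands for a bound on the length of all tapes. The constants are generous: what matters is
    polynomial growth in [L] for a fixed sentence, and that the digit base [b] does not enter. *)
Fixpoint cost (phi : fm) (L : nat) : nat :=
  match phi with
  | FCst c => 1
  | FTst x F => sumn [seq cost (F t) L | t <- enum {: option A}] + 2 * #|{: option A}| + 2
  | FRd a x F => sumn [seq cost (F g) L | g <- enum G] + 2 * #|G| + 6 * L + 20
  | FAnd phi psi => cost phi L + cost psi L + 1
  | FOr phi psi => cost phi L + cost psi L + 2
  | FAll v phi => L * (cost phi L + 8) + 3 * L + 20
  | FEx v phi => 6 * L + cost phi L + 20
  | FNext x phi => cost phi L + 4
  end.

(** * Head movements over fixed tape contents *)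

Definition Tr (s : I -> seq sym) (ps : I -> nat) : tapes I sym := fun v => tp (s v) (ps v).

Definition shift (d : move) (q : nat) : nat :=
  match d with MoveLeft => q.-1 | Stay => q | MoveRight => q.+1 end.

Lemma onth_lt (T : Type) c (s : seq T) n : n < size s -> onth s n = Some (nth c s n).
Proof. by move=> lt; rewrite onthE (nth_map c). Qed.

Lemma tp_shift (s : seq sym) q d : (d <> Stay -> q < size s) -> (d = MoveLeft -> 0 < q) ->
  tape_act (tp s q) (thead (tp s q), d) = tp s (shift d q).
Proof.
case: d => [lt /(_ erefl) q0 | _ _ | lt _]; last 2 first.
- exact: tape_act_keep.
- have {}lt : q < size s by apply: lt.
  case: s lt => // c s' ; move: (c :: s') => {}s lt.
  rewrite /tape_act /tp /= (onth_lt c lt) (take_nth c lt) map_rcons rev_rcons.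
  congr Tape; last by rewrite -drop1 -map_drop drop_drop.
  case: (ltnP q.+1 (size s)) => [lt'|le].
    by rewrite (drop_nth c lt'); apply/esym/(onth_lt c lt').
  by rewrite drop_oversize //; apply/esym/(onth_default le).
- have {}lt : q < size s by apply: lt.
  case: s q q0 lt => // c s' [//|q] _; move: (c :: s') => {}s lt.
  rewrite /tape_act /tp (onth_lt c lt) [shift _ _]/= (onth_lt c (ltnW lt)) /=.
  by rewrite (take_nth c (ltnW lt)) map_rcons rev_rcons /= [in RHS](drop_nth c lt).
Qed.

Section Moves.
Variable s : I -> seq sym.

Lemma mv_sound g m n ps t : (forall v, m v <> Stay -> ps v < size (s v)) ->
  (g (fun v => onth (s v) (ps v)) -> forall v, m v = MoveLeft -> 0 < ps v) ->
  exec (mv g m) n (Tr s ps) t ->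
  g (fun v => onth (s v) (ps v)) /\ t = Tr s (fun v => shift (m v) (ps v)).
Proof.
move=> lt pos [n0 [a [[gh ->] ->]]]; split=> //.
by apply/funext => v; apply: tp_shift; [apply: lt|apply: pos].
Qed.

Lemma mv_complete (g : (I -> option sym) -> Prop) m n ps : 0 < n ->
  (forall v, m v <> Stay -> ps v < size (s v)) ->
  (forall v, m v = MoveLeft -> 0 < ps v) ->
  g (fun v => onth (s v) (ps v)) ->
  exec (mv g m) n (Tr s ps) (Tr s (fun v => shift (m v) (ps v))).
Proof.
move=> n0 lt pos gh; split=> //; eexists; split; first by split; [exact: gh|reflexivity].
by apply/funext => v; apply/esym/tp_shift; [apply: lt|apply: pos].
Qed.

Lemma still_sound g n ps t : exec (mv g still) n (Tr s ps) t ->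
  g (fun v => onth (s v) (ps v)) /\ t = Tr s ps.
Proof. by move/mv_sound; apply. Qed.

Lemma still_complete (g : (I -> option sym) -> Prop) n ps : 0 < n ->
  g (fun v => onth (s v) (ps v)) -> exec (mv g still) n (Tr s ps) (Tr s ps).
Proof. by move=> n0; apply: (@mv_complete _ still n _ n0). Qed.

Lemma upd_upd e v k l : upd (upd e v k) v l = upd e v l.
Proof. by apply/funext => u; rewrite /upd; case: eqP. Qed.

Lemma upd_id e v : upd e v (e v) = e.
Proof. by apply/funext => u; rewrite /upd; case: eqP => [->|]. Qed.

Lemma updE e v k : upd e v k v = k.
Proof. by rewrite /upd eqxx. Qed.

Lemma shift_only v d ps :
  (fun u => shift (only v d u) (ps u)) = upd ps v (shift d (ps v)).
Proof. by apply/funext => u; rewrite /only /upd; case: eqP => [->|]. Qed.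

Lemma only_range v d ps : ps v < size (s v) ->
  forall u, only v d u <> Stay -> ps u < size (s u).
Proof. by move=> lt u; rewrite /only; case: eqP => [->|]. Qed.

Lemma upd_lt ps v k : (forall v, ps v < size (s v)) -> k < size (s v) ->
  forall u, upd ps v k u < size (s u).
Proof. by move=> lt ltk u; rewrite /upd; case: eqP => [->|]. Qed.

Lemma go_left_sound v n ps t : ps v < size (s v) ->
  onth (s v) 0 = Some lmark ->
  exec (go_left v) n (Tr s ps) t -> exists2 k, k <= ps v & t = Tr s (upd ps v k).
Proof.
move=> lt e0 /=; move E: (Tr s ps) => t0 H.
elim: H ps lt E => [{}n {}t0 ps lt <-|n1 n2 {}n t1 t2 t3 H _ IH _ ps lt e1].
  by exists (ps v) => //; rewrite upd_id.
have {}H : exec (mv (fun h => h v <> Some lmark) (only v MoveLeft)) n1 (Tr s ps) t2.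
  by rewrite e1.
have [|ne e2] := mv_sound (only_range lt) _ H.
  by move=> ne u; rewrite /only; case: eqP => // -> _; rewrite lt0n; apply/eqP => pv; apply: ne; rewrite pv.
rewrite shift_only /= in e2.
have [|k le ->] := IH (upd ps v (ps v).-1) _ (esym e2).
  by rewrite updE; lia.
by exists k; [move: le; rewrite updE; lia | rewrite upd_upd].
Qed.

Lemma go_left_complete v n ps k : ps v < size (s v) ->
  (forall q, 0 < q < size (s v) -> onth (s v) q <> Some lmark) -> k <= ps v ->
  3 * ps v <= n -> exec (go_left v) n (Tr s ps) (Tr s (upd ps v k)).
Proof.
move=> lt ne; move E: (ps v) => q; elim: q n ps lt E => [|q IH] n ps lt E.
  by rewrite leqn0 => /eqP-> _; rewrite -E upd_id; apply: iterate0.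
rewrite leq_eqVlt => /predU1P[->|lek] len; first by rewrite -E upd_id; apply: iterate0.
apply: (@iterateS _ _ _ 1 (3 * q) _ _ (Tr s (upd ps v q))); last lia.
  have := @mv_complete (fun h => h v <> Some lmark) (only v MoveLeft) 1 ps isT (only_range lt).
  rewrite shift_only E; apply; last by apply: ne; lia.
  by move=> u; rewrite /only; case: eqP => // -> _; rewrite E.
rewrite -[upd ps v k](upd_upd _ _ q); apply: IH; rewrite ?updE //.
by lia.
Qed.

Lemma go_right_sound v n ps t : ps v < size (s v) ->
  onth (s v) (size (s v)).-1 = Some rmark ->
  exec (go_right v) n (Tr s ps) t ->
  exists2 k, ps v <= k < size (s v) & t = Tr s (upd ps v k).
Proof.
move=> lt e0 /=; move E: (Tr s ps) => t0 H.
elim: H ps lt E => [{}n {}t0 ps lt <-|n1 n2 {}n t1 t2 t3 H _ IH _ ps lt e1].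
  by exists (ps v); rewrite ?upd_id // leqnn lt.
have {}H : exec (mv (fun h => h v <> Some rmark) (only v MoveRight)) n1 (Tr s ps) t2.
  by rewrite e1.
have [|ne e2] := mv_sound (only_range lt) _ H; first by move=> _ u; rewrite /only; case: eqP.
rewrite shift_only /= in e2.
have ltv : (ps v).+1 < size (s v).
  rewrite ltn_neqAle lt andbT; apply/eqP => ev; apply: ne.
  by move: e0; rewrite -ev.
have [|k /andP[le ltk] ->] := IH (upd ps v (ps v).+1) _ (esym e2); first by rewrite updE.
by exists k; [move: le; rewrite updE; lia | rewrite upd_upd].
Qed.

Lemma go_right_complete v n ps k : ps v < size (s v) ->
  (forall q, q < (size (s v)).-1 -> onth (s v) q <> Some rmark) ->
  ps v <= k < size (s v) ->
  3 * (k - ps v) <= n -> exec (go_right v) n (Tr s ps) (Tr s (upd ps v k)).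
Proof.
move=> lt ne; move E: (k - ps v) => q; elim: q n ps lt E => [|q IH] n ps lt E /andP[le ltk] len.
  by have -> : k = ps v by [lia]; rewrite upd_id; apply: iterate0.
apply: (@iterateS _ _ _ 1 (3 * q) _ _ (Tr s (upd ps v (ps v).+1))); last lia.
  have := @mv_complete (fun h => h v <> Some rmark) (only v MoveRight) 1 ps isT (only_range lt).
  rewrite shift_only; apply; last by apply: ne; lia.
  by move=> u; rewrite /only; case: eqP.
rewrite -[upd ps v k](upd_upd _ _ (ps v).+1); apply: IH; rewrite ?updE //; try lia.
Qed.

End Moves.

(** * Evaluating a sentence by its program *)

Section Layout.
Variables (w : seq A) (rows : seq (seq G)).
Hypothesis rows_size : forall r, r \in rows -> size r = size w.
Notation lim := (lim w rows).

Definition blocks (rs : seq (seq G)) : seq sym :=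
  flatten [seq hash :: [seq gl g | g <- r] | r <- rs].

Definition cont (v : I) : seq sym :=
  lmark :: (if v is inl _ then toks G b w else blocks rows) ++ [:: rmark].

(** The left mark accounts for the outer successor; a row takes its separator and [size w]
    letters. *)
Definition posn (v : I) (k : nat) : nat :=
  if v is inl _ then k.+1 else (k * (size w).+1).+1.

Lemma size_blocks (rs : seq (seq G)) : (forall r, r \in rs -> size r = size w) ->
  size (blocks rs) = size rs * (size w).+1.
Proof.
elim: rs => //= r rs IH H; rewrite size_cat /= size_map H ?mem_head // IH.
  by rewrite mulSn.
by move=> r' Hr; apply: H; rewrite in_cons Hr orbT.
Qed.

Lemma onth_blocks (rs : seq (seq G)) k i : (forall r, r \in rs -> size r = size w) ->
  k < size rs -> i <= size w ->
  onth (blocks rs) (k * (size w).+1 + i) =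
  Some (if i is i'.+1 then gl (nth g0 (nth [::] rs k) i') else hash).
Proof.
elim: rs k i => // r rs IH [|k] i H ltk lei.
  have er : size r = size w by apply: H; rewrite mem_head.
  rewrite mul0n add0n (onth_cat (hash :: _)) /= size_map er ltnS lei.
  case: i lei => // i lti; rewrite [LHS](onth_map i r gl) (onth_lt g0) ?er //.
have er : size r = size w by apply: H; rewrite mem_head.
rewrite (onth_cat (hash :: _)) /= size_map er mulSn -addnA ltnNge leq_addr /=.
rewrite addKn; apply: IH => // r' Hr; apply: H; by rewrite in_cons Hr orbT.
Qed.

Lemma size_cont v : size (cont v) = (posn v (lim v)).+1.
Proof.
case: v => v /=; rewrite size_cat addn1 ?size_map //.
by rewrite size_blocks.
Qed.

Lemma onth_cont0 v : onth (cont v) 0 = Some lmark. Proof. by []. Qed.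

Lemma onth_cont_last v : onth (cont v) (posn v (lim v)) = Some rmark.
Proof.
by case: v => v /=; rewrite onth_cat ?size_map ?size_blocks // ltnn subnn.
Qed.

Lemma onth_contW x i : i < size w -> onth (cont (inl x)) i.+1 = omap tok (onth w i).
Proof. by move=> lt; rewrite /= onth_cat size_map lt onth_map. Qed.

Lemma onth_contR a k i : k < size rows -> i <= size w ->
  onth (cont (inr a)) (posn (inr a) k + i) =
  Some (if i is i'.+1 then gl (nth g0 (nth [::] rows k) i') else hash).
Proof.
move=> ltk lei; rewrite /= onth_cat size_blocks // ifT; first exact: onth_blocks.
by rewrite -ltnS -addnS; nia.
Qed.

Lemma cont_split v q : q < posn v (lim v) -> 0 < q ->
  (exists2 k, k < lim v & q = posn v k) /\ target (onth (cont v) q) \/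
  [/\ forall k, q <> posn v k, ~~ target (onth (cont v) q),
      onth (cont v) q <> Some lmark & onth (cont v) q <> Some rmark].
Proof.
case: v => v; case: q => // q.
  rewrite [posn _ _]/= ltnS => lt _; left; split; first by exists q.
  by rewrite onth_contW //; have := onthTE w q; rewrite lt; case: onth.
rewrite [posn _ _]/= ltnS => lt _.
have lti : q %% (size w).+1 <= size w by rewrite -ltnS ltn_mod.
have ltk : q %/ (size w).+1 < size rows by rewrite ltn_divLR.
have := onth_contR v ltk lti; rewrite [posn _ _ + _]/= addSn -divn_eq => ->.
case E: (q %% _) => [|i].
  by left; split=> //; exists (q %/ (size w).+1) => //=; rewrite {1}(divn_eq q (size w).+1) E addn0.
right; split=> // k [ek]; move: E; by rewrite ek modnMl.
Qed.

Lemma onth_cont_ok v q : onth (cont v) q = Some rmark -> q = posn v (lim v).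
Proof.
move=> e; have ltq : q < size (cont v) by rewrite -onthTE e.
move: ltq; rewrite size_cont ltnS leq_eqVlt => /predU1P[//|lt].
case: q e lt => // q e lt.
have [[_ +]|[_ _ _]] := cont_split lt isT; by rewrite e.
Qed.

Lemma onth_cont_lmark v q : onth (cont v) q = Some lmark -> q = 0.
Proof.
case: q => // q e.
have : q.+1 < size (cont v) by rewrite -onthTE e.
rewrite size_cont ltnS leq_eqVlt => /predU1P[eq|lt].
  by move: e; rewrite eq onth_cont_last.
have [[_ +]|[_ _ + _]] := cont_split lt isT; by rewrite e.
Qed.

Lemma cont_target v q : target (onth (cont v) q) ->
  exists2 k, k < lim v & q = posn v k.
Proof.
move=> tq; case: (posnP q) => [q0|q0]; first by move: tq; rewrite q0.
have : q < size (cont v) by rewrite -onthTE; case: onth tq.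
rewrite size_cont ltnS leq_eqVlt => /predU1P[eq|lt].
  by move: tq; rewrite eq onth_cont_last.
by have [[]|[_]] := cont_split lt q0; rewrite ?tq.
Qed.

Lemma posn_target v k : k < lim v -> target (onth (cont v) (posn v k)).
Proof.
move=> lt; have ltp : posn v k < posn v (lim v) by case: v lt => v /=; nia.
have pos : 0 < posn v k by case: (v).
by have [[]|[/(_ k)]] := cont_split ltp pos.
Qed.

Lemma posn_inj v : injective (posn v).
Proof. by case: v => v k l /= [] // /eqP; rewrite eqn_pmul2r // => /eqP. Qed.

Lemma posn_mono v k l : k <= l -> posn v k <= posn v l.
Proof. by case: v => v /=; nia. Qed.

Definition Te (e : I -> nat) : tapes I sym := Tr cont (fun v => posn v (e v)).
Definition inscope (e : I -> nat) : Prop := forall v, e v <= lim v.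

Lemma posn_upd e v k : (fun u => posn u (upd e v k u)) = upd (fun u => posn u (e u)) v (posn v k).
Proof. by apply/funext => u; rewrite /upd; case: eqP => [->|]. Qed.

Lemma inscope_lt e : inscope e -> forall v, posn v (e v) < size (cont v).
Proof. by move=> ok v; rewrite size_cont ltnS; apply: posn_mono. Qed.

Lemma inscope_upd e v k : inscope e -> k <= lim v -> inscope (upd e v k).
Proof. by move=> ok le u; rewrite /upd; case: eqP => [->|]. Qed.

Lemma branch_sound (T : Type) (s : seq T) (f : T -> prog) n ps t :
  exec (branch s f) n (Tr cont ps) t -> exists x m, exec (f x) m (Tr cont ps) t.
Proof.
elim: s n => [n /still_sound[]//|x s IH n].
by rewrite exec_alt => -[_ [H|/IH//]]; exists x, n.-2.
Qed.

Lemma branch_complete (T : eqType) (s : seq T) (f : T -> prog) x n m t t' :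
  x \in s -> exec (f x) n t t' -> n + 2 * size s <= m -> exec (branch s f) m t t'.
Proof.
elim: s m => //= y s IH m; rewrite in_cons => xs H le; split; first lia.
case/predU1P: xs => [exy|xs]; last by right; apply: IH H _ => //; lia.
by left; rewrite -exy; apply: exec_leq H; lia.
Qed.

Lemma leq_sumn_map (T : eqType) (f : T -> nat) s x : x \in s -> f x <= sumn [seq f y | y <- s].
Proof.
elim: s => //= y s IH; rewrite in_cons => /predU1P[->|/IH]; lia.
Qed.

Definition pos2 ps x a q p := upd (upd ps (inl x) q) (inr a) p.

Lemma pos2x ps x a q p : pos2 ps x a q p (inl x) = q.
Proof. by rewrite /pos2 /upd /= eqxx. Qed.

Lemma pos2a ps x a q p : pos2 ps x a q p (inr a) = p.
Proof. by rewrite /pos2 updE. Qed.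

Lemma pos2_id ps x a : pos2 ps x a (ps (inl x)) (ps (inr a)) = ps.
Proof. by rewrite /pos2 !upd_id. Qed.

Lemma shift_opposite ps x a q p dx da :
  (fun u => shift (opposite (inl x) (inr a) dx da u) (pos2 ps x a q p u)) =
  pos2 ps x a (shift dx q) (shift da p).
Proof.
apply/funext => u; rewrite /opposite /pos2 /upd.
by case: (eqVneq u (inl x)) => [->|_] //=; case: (eqVneq u (inr a)).
Qed.

Lemma pos2_lt ps x a q p : (forall v, ps v < size (cont v)) -> q < size (cont (inl x)) ->
  p < size (cont (inr a)) -> forall v, pos2 ps x a q p v < size (cont v).
Proof. by move=> lt ltq ltp; apply: upd_lt => //; apply: upd_lt. Qed.

Section Reading.
Variables (ps : I -> nat) (x : W) (a : R).
Hypothesis ps_lt : forall v, ps v < size (cont v).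
Notation state q p := (Tr cont (pos2 ps x a q p)).
Notation forth := (mv (fun h => h (inl x) <> Some lmark)
  (opposite (inl x) (inr a) MoveLeft MoveRight)).
Notation back := (mv (fun h => h (inr a) <> Some hash)
  (opposite (inl x) (inr a) MoveRight MoveLeft)).

Lemma forth_sound n q p t : q < size (cont (inl x)) -> p + q < size (cont (inr a)) ->
  exec (Star forth) n (state q p) t -> exists2 j, j <= q & t = state (q - j) (p + j).
Proof.
rewrite [exec _ _ _ _]/=; move E: (state q p) => t0 + + H.
elim: H q p E => [{}n {}t0 q p <- _ _|n1 n2 {}n t1 t2 t3 H _ IH _ q p e1 lt1 lt2].
  by exists 0; rewrite ?subn0 ?addn0.
have {}H : exec forth n1 (state q p) t2 by rewrite e1.
have lt : forall v, pos2 ps x a q p v < size (cont v) by apply: pos2_lt => //; lia.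
have q0 : onth (cont (inl x)) q <> Some lmark -> 0 < q by case: (q) => // /(_ erefl).
have [|ne e2] := mv_sound (fun v _ => lt v) _ H.
  rewrite pos2x => /q0 {}q0 u; rewrite /opposite.
  by case: eqP => [-> _|_]; [rewrite pos2x | case: eqP].
rewrite shift_opposite /= in e2; rewrite pos2x in ne; have {}q0 := q0 ne.
have [||j le ->] := IH _ _ (esym e2); try lia.
exists j.+1; first lia.
by congr (Tr _ (pos2 _ _ _ _ _)); lia.
Qed.

Lemma forth_complete n q p : q < size (cont (inl x)) -> p + q < size (cont (inr a)) ->
  3 * q <= n -> exec (Star forth) n (state q p) (state 0 (p + q)).
Proof.
elim: q p n => [|q IH] p n ltq ltp le; first by rewrite addn0; apply: iterate0.
apply: (@iterateS _ _ _ 1 (3 * q) _ _ (state q p.+1)); last lia.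
  have := @mv_complete cont (fun h => h (inl x) <> Some lmark)
    (opposite (inl x) (inr a) MoveLeft MoveRight) 1 (pos2 ps x a q.+1 p) isT.
  rewrite shift_opposite /= pos2x; apply.
  - by move=> v _; apply: pos2_lt => //; lia.
  - by move=> u; rewrite /opposite; case: eqP => [-> _|_]; [rewrite pos2x | case: eqP].
  - by move=> e; have := onth_cont_lmark (v := inl x) e.
by rewrite -addSnnS; apply: IH; lia.
Qed.

Lemma back_sound n q p r t : onth (cont (inr a)) r = Some hash -> 0 < r <= p ->
  q + (p - r) < size (cont (inl x)) -> p < size (cont (inr a)) ->
  exec (Star back) n (state q p) t ->
  exists2 j, r <= j <= p & t = state (q + (p - j)) j.
Proof.
move=> er; rewrite [exec _ _ _ _]/=; move E: (state q p) => t0 + + + H.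
elim: H q p E => [{}n {}t0 q p <- le _ _|n1 n2 {}n t1 t2 t3 H _ IH _ q p e1 le lt1 lt2].
  by exists p; rewrite ?subnn ?addn0 // leqnn andbT; lia.
have {}H : exec back n1 (state q p) t2 by rewrite e1.
have lt : forall v, pos2 ps x a q p v < size (cont v) by apply: pos2_lt => //; lia.
have [|ne e2] := mv_sound (fun v _ => lt v) _ H.
  move=> _ u; rewrite /opposite.
  by case: eqP => // _; case: eqP => // ->; rewrite pos2a; lia.
rewrite shift_opposite /= in e2; rewrite pos2a in ne.
have nr : p <> r by move=> epr; apply: ne; rewrite epr.
have [|||j le2 ->] := IH _ _ (esym e2); try lia.
exists j; first lia.
by congr (Tr _ (pos2 _ _ _ _ _)); lia.
Qed.

Lemma back_complete n q r i : 0 < r ->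
  (forall i', 0 < i' <= i -> onth (cont (inr a)) (r + i') <> Some hash) ->
  q + i < size (cont (inl x)) -> r + i < size (cont (inr a)) ->
  3 * i <= n -> exec (Star back) n (state q (r + i)) (state (q + i) r).
Proof.
move=> r0; elim: i q n => [|i IH] q n ne ltq ltp le; first by rewrite !addn0; apply: iterate0.
apply: (@iterateS _ _ _ 1 (3 * i) _ _ (state q.+1 (r + i))); last lia.
  have := @mv_complete cont (fun h => h (inr a) <> Some hash)
    (opposite (inl x) (inr a) MoveRight MoveLeft) 1 (pos2 ps x a q (r + i.+1)) isT.
  rewrite shift_opposite addnS /= pos2a; apply.
  - by move=> v _; apply: pos2_lt => //; lia.
  - by move=> u; rewrite /opposite; case: eqP => // _; case: eqP => // ->; rewrite pos2a.
  - by rewrite -addnS; apply: ne; lia.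
rewrite -addSnnS; apply: IH; try lia.
by move=> i' le'; apply: ne; lia.
Qed.

End Reading.

Lemma is_tok_cont x k : k <= size w -> is_tok (onth (cont (inl x)) (posn (inl x) k)) = (k < size w).
Proof.
case: ltnP => [lt _|ge le].
  by rewrite onth_contW //; have := onthTE w k; rewrite lt; case: onth.
by rewrite (_ : k = lim (inl x)) ?onth_cont_last //=; apply/eqP; rewrite eqn_leq le.
Qed.

Lemma read_cont x k : k <= size w -> read (onth (cont (inl x)) (posn (inl x) k)) = onth w k.
Proof.
rewrite leq_eqVlt => /predU1P[->|lt].
  by rewrite -[size w]/(lim (inl x)) onth_cont_last /= onth_default.
by rewrite onth_contW //; case: onth.
Qed.

Lemma posn_last v : (size (cont v)).-1 = posn v (lim v).
Proof. by rewrite size_cont. Qed.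

Lemma Te_upd e v k : Tr cont (upd (fun u => posn u (e u)) v (posn v k)) = Te (upd e v k).
Proof. by rewrite /Te posn_upd. Qed.

Lemma at_rest e v : onth (cont v) (posn v (e v)) = Some rmark <-> e v = lim v.
Proof. by split=> [/onth_cont_ok/posn_inj//|->]; rewrite onth_cont_last. Qed.

Lemma rest_right e v n t : inscope e -> e v = lim v -> forall q, q < size (cont v) ->
  exec (Seq (go_right v) (mv (fun h => h v = Some rmark) still)) n
    (Tr cont (upd (fun u => posn u (e u)) v q)) t -> t = Te e.
Proof.
move=> ok ev q ltq; rewrite exec_seq => -[n1 [n2 [t1 [/go_right_sound H1 H2 _]]]].
have [||k /andP[_ ltk] et] := H1.
- by rewrite updE.
- by rewrite posn_last onth_cont_last.
rewrite upd_upd in et; subst t1.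
have [+ ->] := still_sound H2.
by rewrite updE => /onth_cont_ok->; rewrite Te_upd -ev upd_id.
Qed.

Lemma rest_right_complete e v n q : inscope e -> e v = lim v -> q < size (cont v) ->
  3 * size (cont v) + 2 <= n ->
  exec (Seq (go_right v) (mv (fun h => h v = Some rmark) still)) n
    (Tr cont (upd (fun u => posn u (e u)) v q)) (Te e).
Proof.
move=> ok ev ltq le; rewrite exec_seq; exists (3 * size (cont v)), 1, (Te e); split; last lia.
- rewrite -[e in Te e](upd_id e v) -Te_upd.
  rewrite -[X in exec _ _ _ (Tr cont X)](upd_upd _ v q).
  apply: go_right_complete; rewrite ?updE.
  + by [].
  + by move=> r; rewrite posn_last => lt /onth_cont_ok er; lia.
  + by rewrite ev -posn_last; lia.
  + by rewrite ev -posn_last; lia.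
- by apply: still_complete => //; apply/at_rest.
Qed.

(** Every loop is followed by a test that passes only at an intended end, so any completed run,
    whatever its guesses, establishes the sentence and restores the heads. *)
Lemma prog_sound phi n e t : inscope e ->
  exec (prog_of phi) n (Te e) t -> t = Te e /\ sat w rows phi e.
Proof.
elim: phi n e t => [c|x F IH|a x F IH|phi IH1 psi IH2|phi IH1 psi IH2|v phi IH|v phi IH|x phi IH] n e t ok.
- by case/still_sound.
- case/branch_sound => o [m]; rewrite exec_seq => -[n1 [n2 [t1 [/still_sound[eo ->] H _]]]].
  by have [-> S] := IH _ _ _ _ ok H; split=> //=; rewrite -(@read_cont x) ?eo //; apply: (ok (inl x)).
- rewrite exec_seq => -[n1 [n2 [t1 [/still_sound[[ex ea] ->] H _]]]].
  move: H; rewrite exec_seq => -[m1 [m2 [t2 [H1 H2 _]]]].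
  rewrite is_tok_cont in ex; last exact: (ok (inl x)).
  have [k ltk /posn_inj ek] : exists2 k, k < lim (inr a) & posn (inr a) (e (inr a)) = posn (inr a) k.
    by apply: cont_target; rewrite ea.
  rewrite /= -ek in ltk; set ps := fun v => posn v (e v).
  have e1 := onth_contR a ltk ex; rewrite /= in ltk.
  have ltx : (e (inl x)).+1 < size (cont (inl x)) by rewrite size_cont ltnS; apply: leqW.
  have lta : posn (inr a) (e (inr a)) + (e (inl x)).+1 < size (cont (inr a)).
    by rewrite -onthTE e1.
  have [|j le et2] := forth_sound (inscope_lt ok) ltx lta (t := t2) (n := m1).
    by rewrite (pos2_id ps).
  move: H2; rewrite et2 exec_seq => -[k1 [k2 [t3 [/still_sound[+ ->] + _]]]].
  rewrite pos2x => /onth_cont_lmark ej; have {ej le} ej : j = (e (inl x)).+1 by lia.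
  rewrite ej subnn => H.
  have {H} [g [m]] := branch_sound H.
  rewrite exec_seq => -[l1 [l2 [t4 [H1' H2 _]]]].
  have [+ et4] := still_sound H1'; rewrite pos2a e1 => -[eg].
  move: H2; rewrite et4 exec_seq => -[q1 [q2 [t5 [H3 H4 _]]]].
  have p0 : 0 < posn (inr a) (e (inr a)) by [].
  have [|||j2 /andP[le2 le3] et5] := back_sound (inscope_lt ok) ea _ _ _ H3; try by rewrite ?addKn ?add0n //; lia.
  move: H4; rewrite et5 exec_seq => -[r1 [r2 [t6 [/still_sound[+ et6] H6 _]]]].
  rewrite pos2a => ej2.
  (* Only row letters lie between the separator of the row and the letter read, so the walk back
     stops at the separator it started from. *)
  have ej3 : j2 = posn (inr a) (e (inr a)).
    have := @onth_contR a (e (inr a)) (j2 - posn (inr a) (e (inr a))) ltk.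
    rewrite subnKC // ej2 => /(_ _); case E: (_ - _) => [|i]; first lia.
    by move=> H; have := H ltac:(lia).
  move: H6; rewrite et6 ej3 add0n addKn (pos2_id ps).
  by move=> /(IH _ _ _ _ ok)[-> S]; split=> //=; rewrite eg.
- rewrite exec_seq => -[n1 [n2 [t1 [/(IH1 _ _ _ ok)[-> S1] /(IH2 _ _ _ ok)[-> S2] _]]]]; by [].
- by rewrite exec_alt => -[_ [/(IH1 _ _ _ ok)|/(IH2 _ _ _ ok)]] [-> S]; split=> //; [left|right].
- rewrite exec_seq => -[n1 [n2 [t1 [/still_sound[/at_rest ev ->] H _]]]].
  move: H; rewrite exec_seq => -[m1 [m2 [t2 [+ H2 _]]]].
  rewrite exec_star => H1.
  (* Invariant of the sweep: the body holds for all values whose cell is at the head or to its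
     right. *)
  have {H1} [q ltq [et2 S]] : exists2 q, q < size (cont v) &
     t2 = Tr cont (upd (fun u => posn u (e u)) v q) /\
     forall k, k < lim v -> q <= posn v k -> sat w rows phi (upd e v k).
    have E0 : Te e = Tr cont (upd (fun u => posn u (e u)) v (posn v (lim v))).
      by rewrite -ev upd_id.
    have S0 : forall k, k < lim v -> posn v (lim v) <= posn v k -> sat w rows phi (upd e v k).
      by move=> k ltk; case: (v) ltk => v' /=; nia.
    have lt0 : posn v (lim v) < size (cont v) by rewrite size_cont.
    move: H1; rewrite -/(Te e); move: (Te e) E0 => t00 E0 H1.
    elim: H1 (posn v (lim v)) lt0 S0 E0 => [k t0 q ltq S ->|k1 k2 k t0 t1' t3 H _ IHi _ q ltq S et0].
      by exists q.
    move: H; rewrite exec_seq => -[l1 [l2 [t4 [H3 H4 _]]]].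
    have ltu := upd_lt (inscope_lt ok) ltq.
    move: H3; rewrite et0 => H3.
    have [|ne et4] := mv_sound (fun v _ => ltu v) _ H3.
      rewrite updE => ne u; rewrite /only; case: eqP => // -> _.
      by rewrite updE lt0n; apply/eqP => q0; apply: ne; rewrite q0.
    rewrite shift_only updE upd_upd /= in et4; rewrite updE in ne.
    have q0 : 0 < q by rewrite lt0n; apply/eqP => q0; apply: ne; rewrite q0.
    have ltq1 : q.-1 < size (cont v) by lia.
    suff [et1' S1] : t1' = t4 /\ (forall k, k < lim v -> q.-1 <= posn v k -> sat w rows phi (upd e v k)).
      by apply: (IHi q.-1) => //; rewrite et1'.
    move: H4; rewrite et4 exec_alt => -[_ [/still_sound[+ ->]|]].
      rewrite updE => nt; split=> // k' ltk' le; apply: S => //.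
      case: (ltnP (posn v k') q) => // lt; move: nt.
      by rewrite (_ : q.-1 = posn v k'); [rewrite posn_target|lia].
    rewrite exec_seq => -[j1 [j2 [t5 [/still_sound[+ ->] H5 _]]]].
    rewrite updE => /cont_target[k' ltk' eq'].
    move: H5; rewrite eq' Te_upd => /IH[|-> Sk]; first by apply: inscope_upd => //; lia.
    split=> // k2' ltk2 le; case: (eqVneq k2' k') => [->//|ne2]; apply: S => //.
    case: (ltnP (posn v k2') q) => // lt; move/eqP: ne2; case.
    by apply: (@posn_inj v); lia.
  move: H2; rewrite et2 exec_seq => -[k1 [k2 [t3 [H3 H4 _]]]].
  have [+ et3] := still_sound H3.
  rewrite updE => /onth_cont_lmark q0; move: H4; rewrite et3.
  move/(rest_right ok ev ltq) => ->; split=> //=; split=> // k ltk.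
  by apply: S => //; rewrite q0.
- rewrite exec_seq => -[n1 [n2 [t1 [/still_sound[/at_rest ev ->] H _]]]].
  move: H; rewrite exec_seq => -[m1 [m2 [t2 [H1 H2 _]]]].
  have [q leq et2] := go_left_sound (inscope_lt ok v) (onth_cont0 v) H1.
  have ltq : q < size (cont v) by have := inscope_lt ok v; lia.
  move: H2; rewrite et2 exec_seq => -[k1 [k2 [t3 [H3 + _]]]].
  rewrite exec_seq => -[j1 [j2 [t4 [H4 H5 _]]]].
  have [+ et3] := still_sound H3.
  rewrite updE => /cont_target[k ltk eq]; subst.
  have okk : inscope (upd e v k) by apply: inscope_upd => //; lia.
  move: H4 H5; rewrite Te_upd => /(IH _ _ _ okk)[-> S].
  rewrite -Te_upd => /(rest_right ok ev ltq) ->; split=> //; split=> //.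
  by exists k.
- rewrite exec_seq => -[n1 [n2 [t1 [H1 + _]]]].
  rewrite exec_seq => -[m1 [m2 [t2 [H2 H3 _]]]].
  have [|+ et1] := mv_sound (fun v _ => inscope_lt ok v) _ H1; first by move=> _ u; rewrite /only; case: eqP.
  rewrite is_tok_cont; last exact: (ok (inl x)).
  move=> ltx; move: et1; rewrite shift_only -[shift _ _]/(posn (inl x) (e (inl x)).+1) Te_upd => et1.
  have oku : inscope (upd e (inl x) (e (inl x)).+1) by apply: inscope_upd.
  move: H2; rewrite et1 => /(IH _ _ _ oku)[et2 S]; split=> //.
  move: H3; rewrite et2 => /(mv_sound (fun v _ => inscope_lt oku v))[|_ ->].
    by move=> _ u; rewrite /only; case: eqP => // ->.
  rewrite (shift_only (inl x) MoveLeft (fun u => posn u _)) updE -posn_upd upd_upd.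
  by rewrite upd_id.
Qed.

Lemma prog_complete phi e L : inscope e -> (forall v, size (cont v) <= L) ->
  sat w rows phi e -> exec (prog_of phi) (cost phi L) (Te e) (Te e).
Proof.
move=> + leL; elim: phi e => [c|x F IH|a x F IH|phi IH1 psi IH2|phi IH1 psi IH2|v phi IH|v phi IH|x phi IH] e ok.
- by move=> sc; apply: still_complete.
- move=> /= S; have H := IH _ _ ok S.
  set o := onth _ _ in H.
  have oE : o \in enum {: option A} by rewrite mem_enum.
  apply: (branch_complete (n := cost (F o) L + 2) oE); last first.
    have /= := leq_sumn_map (fun t => cost (F t) L) oE; rewrite -cardE.
    by rewrite -addnA [2 + _]addnC addnA !leq_add2r.
  apply: (@exec_seqI _ _ (1) ((cost (F o) L)) (Te e))=> //; last lia.
  by apply: still_complete => //; rewrite read_cont //; apply: (ok (inl x)).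
- move=> S0; have [ltx lta] := S0; set g := nth g0 _ _ => S; have H := IH _ _ ok S.
  have gE : g \in enum G by rewrite mem_enum.
  have lt := inscope_lt ok.
  have eh := @onth_contR a (e (inr a)) 0 lta isT; rewrite addn0 in eh.
  have eg := onth_contR a lta ltx; rewrite -/g in eg.
  set ps := fun v => posn v (e v) in lt.
  have ltx' : (e (inl x)).+1 < size (cont (inl x)) by rewrite size_cont ltnS; apply: leqW.
  have lta' : posn (inr a) (e (inr a)) + (e (inl x)).+1 < size (cont (inr a)).
    by rewrite -onthTE eg.
  set p := posn (inr a) (e (inr a)) in eg eh lta'; set q := (e (inl x)).+1 in ltx' lta' eg.
  have LX := leL (inl x).
  have q3 : 3 * q <= 3 * L by lia.
  pose c := cost (F g) L.
  have le_c : c <= sumn [seq cost (F g) L | g <- enum G] := leq_sumn_map _ gE.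
  have sizeG : size (enum G) = #|G| by rewrite cardE.
  have le_cost : c + 2 * #|G| + 6 * L + 20 <= cost (FRd a x F) L by rewrite !leq_add2r.
  apply: (@exec_seqI _ _ 1 (c + 2 * #|G| + 6 * L + 15) (Tr cont ps)); last by apply: leq_trans le_cost; lia.
    apply: still_complete => //; split=> //.
    by rewrite (@is_tok_cont x); last exact: ltnW.
  apply: (@exec_seqI _ _ ((3 * L)) ((c + 2 * #|G| + 3 * L + 14)) (Tr cont (pos2 ps x a 0 (p + q)))); last lia.
    rewrite -{1}(pos2_id ps x a); exact: forth_complete.
  apply: (@exec_seqI _ _ (1) ((c + 2 * #|G| + 3 * L + 12)) (Tr cont (pos2 ps x a 0 (p + q)))); last lia.
    by apply: still_complete => //; rewrite pos2x.
  apply: (branch_complete (n := c + 3 * L + 10) gE); last by rewrite sizeG; lia.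
  apply: (@exec_seqI _ _ (1) ((c + 3 * L + 8)) (Tr cont (pos2 ps x a 0 (p + q)))); last lia.
    by apply: still_complete => //; rewrite pos2a.
  have id_ps : pos2 ps x a (0 + q) p = ps by rewrite add0n; apply: pos2_id.
  apply: (@exec_seqI _ _ ((3 * L)) ((c + 3)) (Tr cont (pos2 ps x a (0 + q) p))); last lia.
    apply: back_complete => // i' /andP[i0 lei].
    have lei' : i' <= size w by apply: leq_trans lei _.
    by rewrite (onth_contR a lta lei'); case: (i') i0.
  rewrite id_ps; apply: (@exec_seqI _ _ 1 c (Tr cont ps)); last lia.
    exact: still_complete.
  exact: H.
- move=> S; have [S1 S2] := S; apply: (@exec_seqI _ _ (cost phi L) (cost psi L) (Te e)); [exact: IH1|exact: IH2|rewrite /=; lia].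
- move=> S; change (exec (Alt (prog_of phi) (prog_of psi)) (cost (FOr phi psi) L) (Te e) (Te e)).
  rewrite exec_alt; split; first by rewrite /= addn2.
  case: S => S; [left|right].
    by apply: exec_leq (IH1 _ ok S); rewrite /=; lia.
  by apply: exec_leq (IH2 _ ok S); rewrite /=; lia.
- move=> S0; have [ev S] := S0; have LV := leL v.
  apply: (@exec_seqI _ _ 1 (L * (cost phi L + 8) + 3 * L + 10) (Te e)); last by rewrite /=; lia.
    by apply: still_complete => //; apply/at_rest.
  apply: (@exec_seqI _ _ ((L * (cost phi L + 8))) ((3 * L + 6)) (Tr cont (upd (fun u => posn u (e u)) v 0))); last lia.
    have E0 : Te e = Tr cont (upd (fun u => posn u (e u)) v (posn v (lim v))) by rewrite -ev upd_id.
    rewrite E0; have : posn v (lim v) < size (cont v) by rewrite size_cont.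
    move: (posn v (lim v)) => q ltq.
    (* Each cell costs one round, whether or not it is a value of [v]; the induction is on the
       number of cells left of the head. *)
    apply: (@exec_leq _ _ _ (q * (cost phi L + 8))); first by rewrite leq_mul2r; apply/orP; right; lia.
    elim: q ltq {E0} => [_|q IHq ltq]; first exact: iterate0.
    rewrite exec_star; apply: (@iterateS _ _ _ (cost phi L + 6) (q * (cost phi L + 8)) _ _
      (Tr cont (upd (fun u => posn u (e u)) v q))); last by rewrite mulSn; lia.
      apply: (@exec_seqI _ _ (1) ((cost phi L + 4)) (Tr cont (upd (fun u => posn u (e u)) v q))); last lia.
        have := @mv_complete cont (fun h => h v <> Some lmark) (only v MoveLeft) 1 _ isT (fun u _ => upd_lt (inscope_lt ok) ltq u).
        rewrite shift_only updE upd_upd; apply; last by move/onth_cont_lmark.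
        by move=> u; rewrite /only; case: eqP => // -> _; rewrite updE.
      rewrite exec_alt; split; first lia.
      case T: (target (onth (cont v) q)); last first.
        by left; apply: still_complete; [lia|rewrite updE T].
      right; apply: (@exec_seqI _ _ (1) ((cost phi L)) (Tr cont (upd (fun u => posn u (e u)) v q))); last lia.
        by apply: still_complete => //; rewrite updE T.
      have [k ltk ->] := cont_target T; rewrite Te_upd; apply: IH; last exact: S.
      exact: inscope_upd (ltnW ltk).
    by apply: IHq; apply: ltnW.
  apply: (@exec_seqI _ _ (1) ((3 * L + 4)) (Tr cont (upd (fun u => posn u (e u)) v 0))); last lia.
    by apply: still_complete => //; rewrite updE.
  by apply: rest_right_complete => //; lia.
- move=> S0; have [ev [k ltk S]] := S0.
  have LV := leL v.
  have okk : inscope (upd e v k) by apply: inscope_upd => //; apply: ltnW.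
  have ltk' := inscope_lt okk v; rewrite updE in ltk'.
  apply: (@exec_seqI _ _ 1 (6 * L + cost phi L + 16) (Te e)); last by rewrite /=; lia.
    by apply: still_complete => //; apply/at_rest.
  apply: (@exec_seqI _ _ ((3 * L)) ((3 * L + cost phi L + 14)) (Te (upd e v k))); last lia.
    rewrite -Te_upd; apply: go_left_complete (inscope_lt ok v) _ _ _.
    - by move=> q /andP[q0 _] /onth_cont_lmark eq; rewrite eq in q0.
    - by rewrite ev; apply: posn_mono; apply: ltnW.
    - by rewrite ev -posn_last; lia.
  apply: (@exec_seqI _ _ (1) ((3 * L + cost phi L + 12)) (Te (upd e v k))); last lia.
    by apply: still_complete => //; rewrite updE posn_target.
  apply: (@exec_seqI _ _ ((cost phi L)) ((3 * L + 10)) (Te (upd e v k))); last lia.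
    exact: IH.
  by rewrite -Te_upd; apply: rest_right_complete => //; lia.
- move=> S0; have [ltx S] := S0.
  have oku : inscope (upd e (inl x) (e (inl x)).+1) by apply: inscope_upd.
  apply: (@exec_seqI _ _ 1 (cost phi L + 2) (Te (upd e (inl x) (e (inl x)).+1))); last by rewrite /=; lia.
    have := @mv_complete cont (fun h => is_tok (h (inl x))) (only (inl x) MoveRight) 1 _ isT (fun u _ => inscope_lt ok u).
    rewrite shift_only -[shift _ _]/(posn (inl x) (e (inl x)).+1) Te_upd; apply.
      by move=> u; rewrite /only; case: eqP.
    by rewrite is_tok_cont //; apply: ltnW.
  apply: (@exec_seqI _ _ ((cost phi L)) (1) (Te (upd e (inl x) (e (inl x)).+1))); last lia.
    exact: IH.
  have := @mv_complete cont (fun=> True) (only (inl x) MoveLeft) 1 _ isT (fun u _ => inscope_lt oku u).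
  rewrite (shift_only (inl x) MoveLeft (fun u => posn u _)) updE -posn_upd upd_upd upd_id; apply=> //.
  by move=> u; rewrite /only; case: eqP => // ->.
Qed.

End Layout.

(** * Guessing the rows *)

Definition write_rows (g : (I -> option sym) -> Prop) (c : sym -> Prop) (d dx : move) : prog :=
  Act (fun h a => g h /\ exists2 s, c s & a = fun v =>
    match v with inl x => (h v, if x == x0 then dx else Stay) | inr _ => (Some s, d) end).

(** All row tapes receive the same symbols, so they remain copies of one list. The input copy on the
    tape of [x0] is the ruler: one letter is written for each of its tokens, which fixes the length
    of the row. *)
Definition guess_row : prog :=
  Seq (go_left (inl x0))
 (Seq (write_rows (fun h => h (inl x0) = Some lmark) (fun s => s = hash) MoveRight MoveRight)
 (Seq (Star (write_rows (fun h => is_tok (h (inl x0))) (fun s => exists g, s = gl g)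
               MoveRight MoveRight))
      (mv (fun h => h (inl x0) = Some rmark) still))).

Definition guess : prog :=
  Seq (Star guess_row) (write_rows (fun _ => True) (fun s => s = rmark) Stay Stay).

Section Guess.
Variable w : seq A.

Definition gcont (s : seq sym) (v : I) : seq sym :=
  if v is inl _ then lmark :: toks G b w ++ [:: rmark] else s.
Definition gpos (s : seq sym) (q : nat) (v : I) : nat :=
  match v with inl x => if x == x0 then q else (size w).+1 | inr _ => size s end.
Definition gstate s q : tapes I sym := Tr (gcont s) (gpos s q).

Lemma size_gcontW s x : size (gcont s (inl x)) = (size w).+2.
Proof. by rewrite /= size_cat size_map addn1. Qed.

Lemma gpos_upd s q k : upd (gpos s q) (inl x0) k = gpos s k.
Proof.
apply/funext => -[x|a]; rewrite /upd //=.
by rewrite -[inl x == inl x0]/(x == x0); case: eqP.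
Qed.

Lemma write_rows_act s q c d dx : q < (size w).+2 -> (dx = MoveLeft -> 0 < q) ->
  d = MoveRight ->
  act (gstate s q) (fun v => match v with
    | inl x => (heads (gstate s q) v, if x == x0 then dx else Stay)
    | inr _ => (Some c, d) end) = gstate (rcons s c) (shift dx q).
Proof.
move=> ltq pos ->; apply/funext => -[x|a]; last first.
  by rewrite /act /gstate /Tr /= tp_append size_rcons.
rewrite /act tp_shift.
- by rewrite /gstate /Tr /=; case: eqP.
- by rewrite size_gcontW /=; case: eqP.
- by rewrite /=; case: eqP.
Qed.

Lemma onth_gcont s x k : k <= size w ->
  onth (gcont s (inl x)) k.+1 = if k == size w then Some rmark else omap tok (onth w k).
Proof.
move=> le; rewrite /= onth_cat size_map; case: (ltngtP k (size w)) le => // [lt|->] _.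
  by rewrite onth_map.
by rewrite subnn.
Qed.

Lemma write_rows_sound g c s q dx n t : q < (size w).+2 -> (dx = MoveLeft -> 0 < q) ->
  exec (write_rows g c MoveRight dx) n (gstate s q) t ->
  g (heads (gstate s q)) /\ exists2 x, c x & t = gstate (rcons s x) (shift dx q).
Proof.
move=> ltq pos [_ [a [[gh [x cx ->]] ->]]]; split=> //; exists x => //.
exact: write_rows_act.
Qed.

Lemma write_rows_complete (g : _ -> Prop) (c : _ -> Prop) s q dx n x : 0 < n ->
  q < (size w).+2 -> (dx = MoveLeft -> 0 < q) ->
  g (heads (gstate s q)) -> c x ->
  exec (write_rows g c MoveRight dx) n (gstate s q) (gstate (rcons s x) (shift dx q)).
Proof.
move=> n0 ltq pos gh cx; split=> //; eexists; split.
  by split; [exact: gh|exists x; [exact: cx|reflexivity]].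
by rewrite write_rows_act.
Qed.

Lemma guess_letters_sound s q n t : 0 < q < (size w).+2 ->
  exec (Star (write_rows (fun h => is_tok (h (inl x0))) (fun s => exists g, s = gl g)
               MoveRight MoveRight)) n (gstate s q) t ->
  exists r, q + size r < (size w).+2 /\ t = gstate (s ++ [seq gl g | g <- r]) (q + size r).
Proof.
rewrite exec_star; move E: (gstate s q) => t0 + H.
elim: H s q E => [{}n {}t0 s q <- /andP[_ lt]|n1 n2 {}n t1 t2 t3 H _ IH _ s q e1 /andP[q0 lt]].
  by exists [::]; rewrite cats0 addn0.
move: H; rewrite -e1 => /(write_rows_sound lt)[//|T [_ [g ->] et2]].
have ltq : q < (size w).+1.
  rewrite ltnS; move: T; rewrite /heads /gstate /Tr /= eqxx.
  case: q q0 lt {e1 et2} => // q _; rewrite ltnS => lt; rewrite -/(is_tok _).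
  have := @onth_gcont s x0 q; rewrite /= => ->; last lia.
  by case: eqP => // ne _; lia.
rewrite [shift _ _]/= in et2; have [|r [lr ->]] := IH _ _ (esym et2); first lia.
exists (g :: r); rewrite /= addnS -addSn; split=> //.
by rewrite cat_rcons.
Qed.

Lemma guess_letters_complete s q r n : 0 < q -> q + size r = (size w).+1 ->
  3 * size r <= n ->
  exec (Star (write_rows (fun h => is_tok (h (inl x0))) (fun s => exists g, s = gl g)
               MoveRight MoveRight)) n (gstate s q)
    (gstate (s ++ [seq gl g | g <- r]) (size w).+1).
Proof.
rewrite exec_star; elim: r s q n => [|g r IH] s q n q0 /=.
  by rewrite addn0 cats0 => -> _; apply: iterate0.
move=> eq le; apply: (@iterateS _ _ _ 1 (3 * size r) _ _ (gstate (rcons s (gl g)) q.+1)); last lia.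
  apply: (@write_rows_complete (fun h => is_tok (h (inl x0))) (fun c => exists g, c = gl g)
    s q MoveRight 1 (gl g)) => //; [lia| |by exists g].
  rewrite /heads /gstate /Tr /= eqxx; case: q q0 eq => // q _ eq.
  have lt : q < size w by lia.
  have := @onth_gcont s x0 q (ltnW lt); rewrite /= => ->.
  by rewrite (ltn_eqF lt); have := onthTE w q; rewrite lt; case: onth.
by rewrite -cat_rcons; apply: IH; lia.
Qed.

Definition written (rs : seq (seq G)) : seq sym := lmark :: blocks rs.

Lemma written_rcons rs r :
  rcons (written rs) hash ++ [seq gl g | g <- r] = written (rcons rs r).
Proof.
have e : blocks (rcons rs r) = blocks rs ++ hash :: [seq gl g | g <- r].
  by rewrite /blocks map_rcons -cats1 flatten_cat /= cats0.
by rewrite /written e -cats1 /= -catA.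
Qed.

Lemma guess_row_sound rs q n t : q < (size w).+2 ->
  exec guess_row n (gstate (written rs) q) t ->
  exists2 r, size r = size w & t = gstate (written (rcons rs r)) (size w).+1.
Proof.
move=> lt; rewrite /guess_row exec_seq => -[n1 [n2 [t1 [H1 + _]]]].
have ltp : gpos (written rs) q (inl x0) < size (gcont (written rs) (inl x0)).
  by rewrite size_gcontW /= eqxx.
have [k lek e1] := go_left_sound ltp (erefl _) H1.
rewrite gpos_upd in e1; rewrite /= eqxx in lek.
rewrite exec_seq => -[n3 [n4 [t2 [H2 + _]]]].
have ltk : k < (size w).+2 by lia.
move: H2; rewrite e1 -/(gstate _ _) => /(write_rows_sound ltk)[//|k0 [_ -> e2]].
have {}k0 : k = 0.
  case: (k) ltk k0 => // k' ltk; rewrite /heads /gstate /Tr /= eqxx.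
  have := @onth_gcont (written rs) x0 k'; rewrite /= => ->; last lia.
  by case: eqP => // _; case: onth.
rewrite exec_seq => -[n5 [n6 [t3 [H3 H4 _]]]].
move: H3; rewrite e2 k0 => /guess_letters_sound[//|r [ltr e3]].
rewrite written_rcons in e3; rewrite add1n in e3.
have {}ltr : size r <= size w := ltr.
have H5 : onth (gcont (written (rcons rs r)) (inl x0)) (size r).+1 = Some rmark -> size r = size w.
  by rewrite onth_gcont //; case: eqP => // _; case: onth.
move: H4; rewrite e3 => /still_sound[]; rewrite [X in onth _ X]/= eqxx => /H5 er ->.
by exists r; rewrite // er.
Qed.

Lemma guess_row_complete rs r n : size r = size w -> 6 * size w + 20 <= n ->
  exec guess_row n (gstate (written rs) (size w).+1) (gstate (written (rcons rs r)) (size w).+1).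
Proof.
move=> er le; rewrite /guess_row.
have eq0 : upd (gpos (written rs) (size w).+1) (inl x0) 0 = gpos (written rs) 0 by rewrite gpos_upd.
apply: (@exec_seqI _ _ (3 * (size w).+1) (3 * size w + 10) (gstate (written rs) 0)); last lia.
  rewrite /gstate -eq0.
  apply: go_left_complete; rewrite ?size_gcontW /= ?eqxx //.
  move=> [//|q] /andP[_ ltq]; have := @onth_gcont (written rs) x0 q; rewrite /= => ->; last first.
    by move: ltq; rewrite /= ?size_cat ?size_map; lia.
  by case: eqP => // _; case: onth.
apply: (@exec_seqI _ _ 1 (3 * size w + 5) (gstate (rcons (written rs) hash) 1)); last lia.
  apply: (@write_rows_complete (fun h => h (inl x0) = Some lmark) (fun c => c = hash)
    (written rs) 0 MoveRight 1 hash) => //.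
  by rewrite /heads /gstate /Tr /= eqxx.
apply: (@exec_seqI _ _ (3 * size w) 1 (gstate (written (rcons rs r)) (size w).+1)); last lia.
  by rewrite -written_rcons; apply: guess_letters_complete; rewrite ?er.
apply: still_complete => //; rewrite /= eqxx.
by have := @onth_gcont (written (rcons rs r)) x0 (size w) (leqnn _); rewrite eqxx.
Qed.

(** Writing the right mark without moving leaves each row tape at its resting value, so the sentence
    starts with no variable in scope. *)
Lemma guess_end_act rs : all (fun r => size r == size w) rs ->
  act (gstate (written rs) (size w).+1) (fun v => match v with
    | inl x => (heads (gstate (written rs) (size w).+1) v, if x == x0 then Stay else Stay)
    | inr _ => (Some rmark, Stay) end) = Te w rs (lim w rs).
Proof.
move=> /allP H; apply/funext => -[x|a].
  by rewrite /act /heads if_same tape_act_keep /gstate /Te /Tr /= if_same.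
rewrite /act /gstate /Te /Tr /= tp_last -cats1; congr tp.
by rewrite /written /= (@size_blocks w) // => r /H/eqP.
Qed.

Lemma guess_sound n t : exec guess n (gstate (written [::]) (size w).+1) t ->
  exists2 rs, all (fun r => size r == size w) rs & t = Te w rs (lim w rs).
Proof.
rewrite /guess exec_seq => -[n1 [n2 [t1 [H1 [_ [a [[_ [s -> ->]] ->]]] _]]]].
rewrite exec_star in H1; have : exists2 rs, all (fun r => size r == size w) rs & t1 = gstate (written rs) (size w).+1.
  have : exists2 rs, all (fun r => size r == size w) rs &
    gstate (written [::]) (size w).+1 = gstate (written rs) (size w).+1 by exists [::].
  move: (gstate (written [::]) _) H1 => t0 H1; elim: H1 => // n3 n4 n5 t3 t4 t5 H _ IH _ [rs Hrs e3]; apply: IH.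
  move: H; rewrite e3 => /guess_row_sound[//|r er ->].
  by exists (rcons rs r); rewrite // all_rcons er eqxx.
by case=> rs Hrs ->; exists rs => //; rewrite guess_end_act.
Qed.

Lemma guess_complete rs n : all (fun r => size r == size w) rs ->
  size rs * (6 * size w + 22) + 2 <= n ->
  exec guess n (gstate (written [::]) (size w).+1) (Te w rs (lim w rs)).
Proof.
move=> Hrs le; apply: (@exec_seqI _ _ (size rs * (6 * size w + 22)) 1
  (gstate (written rs) (size w).+1)); last lia.
  suff H rs0 : exec (Star guess_row) (size rs * (6 * size w + 22))
    (gstate (written rs0) (size w).+1) (gstate (written (rs0 ++ rs)) (size w).+1).
    exact: (H [::]).
  rewrite exec_star; move: {le} rs0.
  elim: rs Hrs => [|r rs IH] /= Hrs rs0; first by rewrite cats0; apply: iterate0.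
  case/andP: Hrs => /eqP er Hrs; apply: (iterateS (guess_row_complete rs0 er (leqnn _))).
    by rewrite -cat_rcons; apply: IH.
  by rewrite mulSn; lia.
split=> //; eexists; split; first by split=> //; exists rmark.
by rewrite guess_end_act.
Qed.

Lemma loaded_gstate : @loaded A G b I (fun v : I => if v is inl _ then true else false) w =
  gstate (written [::]) (size w).+1.
Proof.
by apply/funext => -[x|a]; rewrite /loaded /gstate /Tr //= if_same.
Qed.

End Guess.
End Formulas.

(** * Exponential bounds *)

Definition expbound (f : nat -> nat) : Prop := exists B, forall n, 0 < n -> f n <= B ^ n.

Lemma expbound_leq f g : (forall n, f n <= g n) -> expbound g -> expbound f.
Proof. by move=> le [B H]; exists B => n n0; apply: leq_trans (le n) (H n n0). Qed.

Lemma expbound_const c : expbound (fun _ => c).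
Proof.
by exists c => -[//|n] _; rewrite expnS; case: c => // c; rewrite leq_pmulr ?expn_gt0.
Qed.

Lemma expbound_id : expbound id.
Proof. by exists 2 => n _; apply/ltnW/ltn_expl. Qed.

Lemma expbound_exp B : expbound (fun n => B ^ n).
Proof. by exists B. Qed.

Lemma expbound_mul f g : expbound f -> expbound g -> expbound (fun n => f n * g n).
Proof.
by move=> [B fB] [C gC]; exists (B * C) => n n0; rewrite expnMn leq_mul ?fB ?gC.
Qed.

(** Here the restriction to positive lengths is essential: [2 * (B + C) ^ n <= (2 * (B + C)) ^ n]
    fails for [n = 0]. *)
Lemma expbound_add f g : expbound f -> expbound g -> expbound (fun n => f n + g n).
Proof.
move=> [B fB] [C gC]; exists (2 * (B + C)) => n n0.
rewrite expnMn; apply: (@leq_trans (2 * (B + C) ^ n)); last first.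
  by rewrite leq_mul2r -{1}[2]expn1 leq_exp2l ?n0 ?orbT.
rewrite mul2n -addnn leq_add //.
- by apply: leq_trans (fB n n0) _; rewrite leq_exp2r // leq_addr.
- by apply: leq_trans (gC n n0) _; rewrite leq_exp2r // leq_addl.
Qed.

Lemma expbound_sumn (T : Type) (f : T -> nat -> nat) s : (forall x, expbound (f x)) ->
  expbound (fun n => sumn [seq f x n | x <- s]).
Proof.
move=> H; elim: s => [|x s IH] /=; first exact: expbound_const.
exact: expbound_add.
Qed.

(** For a fixed sentence, [cost] is a polynomial in the length of the tapes. *)
Lemma expbound_cost (A G W R : finType) (phi : fm A G W R) L :
  expbound L -> expbound (fun n => cost phi (L n)).
Proof.
move=> HL; have C := expbound_const.
elim: phi => [c|x F IH|a x F IH|phi IH1 psi IH2|phi IH1 psi IH2|v phi IH|v phi IH|x phi IH] /=;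
  do ?[exact: IH|exact: C|exact: HL|apply: expbound_add|apply: expbound_mul
      |apply: expbound_sumn]; by [exact: IH1 | exact: IH2].
Qed.

(** [C ^ n <= 2 ^ (C * n)] and [C * n <= C * C + n ^ 2], so the base is absorbed by the exponent [2]
    and the constant [2 ^ (C * C)]; the summand [f 0] settles the empty input. *)
Lemma expbound_time f : expbound f -> exists c, forall n, f n <= c * 2 ^ (n ^ 2).
Proof.
case=> C H; exists (f 0 + 2 ^ (C * C)) => -[|n].
  by rewrite muln1 leq_addr.
apply: leq_trans (H n.+1 isT) _; rewrite mulnDl; apply: leq_trans (leq_addl _ _).
rewrite -expnD; apply: (@leq_trans ((2 ^ C) ^ n.+1)).
  by rewrite leq_exp2r //; apply/ltnW/ltn_expl.
by rewrite -expnM leq_exp2l //; nia.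
Qed.

(** * From a sentence to nondeterministic exponential time *)

Section Main.
Variables (A G : finType) (g0 : G) (W R : finType) (x0 : W) (phi : fm A G W R).
Variables (L : seq A -> Prop) (B : nat).
Hypothesis sound : forall w rows, all (fun r => size r == size w) rows ->
  sat g0 w rows phi (lim w rows) -> L w.
Hypothesis complete : forall w, L w -> 0 < size w /\ exists rows,
  [/\ all (fun r => size r == size w) rows, size rows <= B ^ size w &
      sat g0 w rows phi (lim w rows)].

(** Bounds the length of every tape: [B ^ n] rows with their separators, or the input, together with
    the two marks. *)
Let cells n := B ^ n * n.+1 + n + 3.
Let time n := B ^ n * (6 * n + 22) + cost phi (cells n) + 10.

Lemma NEXPTIME_sat : NEXPTIME L.
Proof.
have C := expbound_const.
have Hcells : expbound cells.
  do 2?[apply: expbound_add] => //; [|exact: expbound_id].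
  apply: expbound_mul; first exact: expbound_exp.
  by apply: (@expbound_leq _ (fun n => n + 1)); [move=> n; rewrite addn1|
    apply: expbound_add => //; exact: expbound_id].
have [b0 Hb] : expbound time.
  apply: expbound_add => //; apply: expbound_add; last exact: expbound_cost.
  apply: expbound_mul; first exact: expbound_exp.
  by apply: expbound_add => //; apply: expbound_mul => //; exact: expbound_id.
(* The cost of the program is independent of the clock, so the digit base may be chosen after it;
   [b0 < b.+1] lets the clock outlast the program. *)
pose b := b0.+1; pose T : finType := (W + R)%type.
pose isw := fun v : W + R => if v is inl _ then true else false.
(* The last idle step provides an exit without outgoing edges, as [machine_complete] requires. *)
pose p := Seq (@guess A G b W R x0) (Seq (prog_of b phi) (mv (fun=> True) (@still W R))).
pose M := @machine A G b #|{: T}| T enum_rank isw p.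
have vK : cancel (@enum_val T predT) enum_rank by exact: enum_valK.
have [c Hc] : exists c, forall n, b.+1 ^ n * (2 * n + 3) + n + 2 <= c * 2 ^ (n ^ 2).
  apply: expbound_time; do 2?[apply: expbound_add] => //; try exact: expbound_id.
  apply: expbound_mul; first exact: expbound_exp.
  by apply: expbound_add => //; apply: expbound_mul => //; exact: expbound_id.
exists 2, M, c; split.
  by move=> w n k st; apply: leq_trans (Hc (size w)); exact: (machine_time vK (@enum_rankK T) st).
move=> w; split.
- case/(machine_sound vK enum_rankK) => n [t].
  rewrite exec_seq => -[n1 [n2 [t1 [+ + _]]]].
  rewrite (loaded_gstate _ _ _ x0) => /guess_sound[rows Hrows ->].
  have Hr : forall r, r \in rows -> size r = size w by move=> r /(allP Hrows)/eqP.
  rewrite exec_seq => -[m1 [m2 [t2 [/(prog_sound g0 Hr)[//|_ S] _ _]]]].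
  exact: sound Hrows S.
- case/complete => n0 [rows [Hrows leR S]].
  have Hr : forall r, r \in rows -> size r = size w by move=> r /(allP Hrows)/eqP.
  apply: (@machine_complete A G b _ T enum_val enum_rank vK enum_rankK isw p w
    (time (size w)) (Te b w rows (lim w rows))); last first.
  + apply: leq_ltn_trans (Hb _ n0) _; by rewrite ltn_exp2r // /b.
  + apply: (@exec_seqI _ _ (B ^ size w * (6 * size w + 22) + 2) (cost phi (cells (size w)) + 4)
      (Te b w rows (lim w rows))); last by rewrite /time; lia.
      rewrite (loaded_gstate _ _ _ x0); apply: guess_complete => //.
      by rewrite leq_add2r leq_mul2r leR orbT.
    apply: (@exec_seqI _ _ (cost phi (cells (size w))) 1 (Te b w rows (lim w rows))); last lia.
      apply: (prog_complete Hr) S => //.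
      case=> v; rewrite (size_cont b Hr) /= /cells; nia.
    exact: still_complete.
  + by move=> [x|[x|[]]] h a //= [].
Qed.
End Main.

(** * Certificates of satisfiability *)

(* A position is marked in a word by a phase in each letter: [Some false] before
   it, [None] at it and [Some true] after it. *)
Definition phase := option bool.
(** Neighbouring letters suffice to enforce the order before, at, after. A word without [None] can
    also pass; it marks no position. *)
Definition phase_step (x y : phase) : bool :=
  if x is Some false then y != Some true else y == Some true.

(* A letter holds: is the node in the team of the subformula starting here; is
   the symbol here true at the node; the kind of the fact carried by the row and
   the phases of its three positions; the phases of the position through which
   the node was entered and of its depth. *)
Definition letter : finType :=
  (bool * bool * (bool * bool) * (phase * phase * phase) * (phase * phase))%type.
Definition lX (g : letter) : bool := g.1.1.1.1.
Definition lV (g : letter) : bool := g.1.1.1.2.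
Definition lK (g : letter) : bool * bool := g.1.1.2.
Definition l1 (g : letter) : phase := g.1.2.1.1.
Definition l2 (g : letter) : phase := g.1.2.1.2.
Definition l3 (g : letter) : phase := g.1.2.2.
Definition lM (g : letter) : phase := g.2.1.
Definition lR (g : letter) : phase := g.2.2.
Definition letter0 : letter :=
  (false, false, (false, false), (None, None, None), (None, None)).

(* Facts about positions i, j, l carried by a row.
   KF: a subformula occupies the positions from i to j; if it is an inclusion
       atom, then l is the position of its TSub.
   KY: a proposition symbol occupies the positions from i to j.
   KG: the inclusion atom starting at l pairs the symbols starting at i and j.
   KN: the binary words after i and j, read up to the next non-bit, differ. *)
Definition KF := (false, false).
Definition KY := (false, true).
Definition KG := (true, false).
Definition KN := (true, true).

Definition letter_step (g h : letter) : bool :=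
  [&& phase_step (l1 g) (l1 h), phase_step (l2 g) (l2 h), phase_step (l3 g) (l3 h),
      phase_step (lM g) (lM h) & phase_step (lR g) (lR h)].

Definition is_bit (t : option token) : bool := if t is Some (TBit _) then true else false.
Definition is_symb (t : option token) : bool :=
  match t with Some (TBit _) | Some TProp => true | _ => false end.
Definition is_modal (t : option token) : bool :=
  match t with Some TBox | Some TDiamond => true | _ => false end.
Definition is_box (t : option token) : bool := if t is Some TBox then true else false.
Definition eqtok (t : option token) (c : token) : bool := t == Some c.

Notation fml := (fm token letter 'I_5 'I_4).
Notation fTst := (@FTst token letter 'I_5 'I_4).
Notation fCst := (@FCst token letter 'I_5 'I_4).
Notation vi := (@Ordinal 5 0 isT).
Notation vj := (@Ordinal 5 1 isT).
Notation vz := (@Ordinal 5 2 isT).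
Notation vk := (@Ordinal 5 3 isT).
Notation vl := (@Ordinal 5 4 isT).
Notation ra := (@Ordinal 4 0 isT).
Notation rb := (@Ordinal 4 1 isT).
Notation rc := (@Ordinal 4 2 isT).
Notation rd := (@Ordinal 4 3 isT).
Notation FAllP x := (@FAll token letter 'I_5 'I_4 (inl x)).
Notation FAllR a := (@FAll token letter 'I_5 'I_4 (inr a)).
Notation FExP x := (@FEx token letter 'I_5 'I_4 (inl x)).
Notation FExR a := (@FEx token letter 'I_5 'I_4 (inr a)).
Notation fRd := (@FRd token letter 'I_5 'I_4).

Definition FIf (c : bool) (phi : fml) : fml := if c then phi else fCst true.
Definition f_is (x : 'I_5) (P : option token -> bool) : fml := fTst x (fun t => fCst (P t)).
Definition f_letter (a : 'I_4) (x : 'I_5) (P : letter -> bool) : fml :=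
  fRd a x (fun g => fCst (P g)).

Definition at1 K (g : letter) : bool := (lK g == K) && (l1 g == None).
Definition at2 (g : letter) : bool := l2 g == None.
Definition at3 (g : letter) : bool := l3 g == None.

Definition f_fact K (i j : 'I_5) : fml :=
  FExR rc (FAnd (f_letter rc i (at1 K)) (f_letter rc j at2)).
Definition f_pair (l i j : 'I_5) : fml :=
  FExR rc (FAnd (f_letter rc i (at1 KG)) (FAnd (f_letter rc j at2) (f_letter rc l at3))).
Definition f_each K (phi : fml) : fml :=
  FAllR ra (FAllP vi (FAllP vj (fRd ra vi (fun g => fRd ra vj (fun h =>
    FIf (at1 K g && at2 h) phi))))).

Definition f_child (p d : 'I_4) : fml :=
  FAnd (FAllP vk (fTst vk (fun t => FIf (is_modal t) (fRd p vk (fun g =>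
          FNext vk (f_letter d vk (fun h => lX h == (lX g && is_box t) || (lM h == None))))))))
       (FExP vk (FAnd (f_letter p vk (fun g => lR g == None))
                      (FNext vk (f_letter d vk (fun h => lR h == None))))).

Definition f_phases : fml :=
  FAllR ra (FAllP vi (fRd ra vi (fun g => FNext vi (fTst vi (fun t =>
    FIf (t != None) (f_letter ra vi (letter_step g))))))).

Definition f_lit : fml := FAnd (f_fact KY vi vj)
  (FAllR rb (f_letter rb vi (fun g => lX g ==> lV g))).
Definition f_nlit : fml := FAnd (FNext vi (f_fact KY vi vj))
  (FAllR rb (fRd rb vi (fun g => FNext vi (f_letter rb vi (fun h => lX g ==> ~~ lV h))))).
Definition f_box : fml := FNext vi (f_fact KF vi vj).
Definition f_diamond : fml := FAnd (FNext vi (f_fact KF vi vj))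
  (FAllR rb (fRd rb vi (fun g => FIf (lX g) (FExR rd
     (FAnd (f_child rb rd) (FNext vi (f_letter rd vi (fun h => lM h == None)))))))).
Definition f_binary (P : bool -> bool -> bool -> bool) : fml :=
  FExP vz (FAnd (FNext vi (f_fact KF vi vz)) (FAnd (FNext vz (f_fact KF vz vj))
   (FAllR rb (fRd rb vi (fun g => FNext vi (fRd rb vi (fun h1 => FNext vz
      (f_letter rb vz (fun h2 => P (lX g) (lX h1) (lX h2)))))))))).
Definition p_and (x x1 x2 : bool) : bool := (x1 == x) && (x2 == x).
(** Strict disjunction partitions the team: each of its nodes goes to exactly one side. *)
Definition p_or (x x1 x2 : bool) : bool := (x == x1 (+) x2) && ~~ (x1 && x2).
Definition between (g : letter) : bool := (l1 g == Some true) && (l2 g == Some false).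
Definition f_same : fml :=
  FAllP vk (FAllP vl (FAllR rc (fRd rc vk (fun g1 => fRd rc vl (fun g2 => fRd rc vi (fun g3 =>
    FIf [&& at1 KG g1, at2 g2 & at3 g3]
      (fRd rb vk (fun h1 => f_letter rd vl (fun h2 => lV h1 == lV h2))))))))).
Definition f_witness : fml :=
  FAllR rb (fRd rb vi (fun g => FIf (lX g) (FExR rd (FAnd (f_letter rd vi lX) f_same)))).
Definition f_start : fml := FExR rc (FAnd (f_letter rc vi at3)
  (FAnd (FNext vi (f_letter rc vi (at1 KG))) (FNext vz (f_letter rc vz at2)))).
Definition f_between : fml :=
  FAllP vk (fRd ra vk (fun g => FIf (between g && ~~ at3 g) (f_is vk is_symb))).
Definition f_incl : fml := FAnd (f_is vj (eqtok^~ TClose)) (FExP vz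
  (FAnd (FAnd (f_letter ra vz (fun g => between g && at3 g)) (f_is vz (eqtok^~ TSub)))
  (FAnd f_between (FAnd f_start f_witness)))).

Definition f_formula : fml := f_each KF (fTst vi (fun t =>
  match t with
  | Some TProp => f_lit
  | Some TNot => f_nlit
  | Some TAnd => f_binary p_and
  | Some TOr => f_binary p_or
  | Some TBox => f_box
  | Some TDiamond => f_diamond
  | Some TOpen => f_incl
  | _ => fCst false
  end)).

Definition f_symbol : fml := f_each KY (FAnd (f_is vi (eqtok^~ TProp))
  (FAnd (f_letter ra vi (fun g => l2 g != Some true))
  (FAnd (FNext vj (f_is vj (fun t => ~~ is_bit t)))
        (FAllP vz (fRd ra vz (fun g => FIf ((l1 g == Some true) && (l2 g != Some true))
           (f_is vz is_bit))))))).

(** The two lists of an inclusion atom are walked in parallel. Each pair calls for the next one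
    until both lists end together, which forces equal lengths. *)
Definition f_chain : fml := f_each KG (FAllP vl (fRd ra vl (fun g => FIf (at3 g)
  (FExP vz (FExP vk (FAnd (f_fact KY vi vz) (FAnd (f_fact KY vj vk)
   (FNext vz (FNext vk (FOr
      (FAnd (FAnd (f_is vz (eqtok^~ TProp)) (f_is vk (eqtok^~ TProp))) (f_pair vl vz vk))
      (FAnd (f_is vz (eqtok^~ TSub)) (f_is vk (eqtok^~ TClose))))))))))))).

Definition f_compare (t t' : option token) : fml :=
  match t, t' with
  | Some (TBit x), Some (TBit y) => FIf (x == y) (f_fact KN vi vj)
  | _, _ => fCst (is_bit t (+) is_bit t')
  end.
(** A claimed difference is handed on one bit at a time and must be met before both words end, so a
    false claim cannot be upheld. *)
Definition f_differ : fml := f_each KN (FNext vi (FNext vj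
  (fTst vi (fun t => fTst vj (f_compare t))))).

(** Two values may disagree only where the names are certified to differ, so equal names need no
    certificate. *)
Definition f_valuation : fml := FAllR rb (FAllP vk (FAllP vl (fTst vk (fun t => fTst vl (fun t' =>
  FIf (eqtok t TProp && eqtok t' TProp) (fRd rb vk (fun g => fRd rb vl (fun h =>
    FIf (lV g != lV h) (f_fact KN vk vl))))))))).

(** A row is a root or has a predecessor whose depth is one less; following predecessors therefore
    terminates, which is what puts every row into the model. *)
Definition f_entered : fml := FAllR rb (FOr
  (FAnd (FAllP vk (fTst vk (fun t => FIf (is_modal t) (FNext vk (f_letter rb vk (fun g => ~~ lX g))))))
        (FExP vk (f_letter rb vk (fun g => lR g == None))))
  (FExR rd (FAnd (f_child rd rb) (FExP vz (FAnd (f_is vz is_modal) (FAnd (f_letter rd vz lX)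
     (FNext vz (f_letter rb vz (fun g => lM g == None))))))))).

(** The phases express that the formula fills the whole input: no position lies before its start or
    after its end. *)
Definition f_top : fml := FExR ra (FExP vi (FExP vj (FAnd
  (FAnd (f_letter ra vi (at1 KF)) (f_letter ra vj at2))
  (FAnd (FAllP vz (f_letter ra vz (fun g => (l1 g != Some false) && (l2 g != Some true))))
        (FExR rb (f_letter rb vi lX)))))).

Definition f_cert : fml :=
  FAnd f_phases (FAnd f_formula (FAnd f_symbol (FAnd f_chain (FAnd f_differ
  (FAnd f_valuation (FAnd f_entered f_top)))))).

(** * The meaning of the certificate sentence *)

Section Cert.
Variables (w : seq token) (rows : seq (seq letter)).
Notation n := (size w).
Notation m := (size rows).

Definition lt_at (a i : nat) : letter := nth letter0 (nth [::] rows a) i.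
Local Notation "a .[ i ]" := (lt_at a i).

Definition fact K i j : Prop :=
  exists c, [/\ c < m, i < n, j < n, at1 K c.[i] & at2 c.[j]].
Definition pair_fact l i j : Prop :=
  exists c, [/\ c < m, [/\ l < n, i < n & j < n], at1 KG c.[i], at2 c.[j] & at3 c.[l]].

(** Membership of the child at a modal argument is given by an equality, not an implication: this
    keeps the team of the argument from containing nodes that the team of the modality does not
    reach. *)
Definition child p d : Prop :=
  (forall k, k < n -> is_modal (onth w k) ->
     k.+1 < n /\ lX d.[k.+1] = (lX p.[k] && is_box (onth w k)) || (lM d.[k.+1] == None)) /\
  exists2 k, k.+1 < n & lR p.[k] = None /\ lR d.[k.+1] = None.

Definition formula_rule a i j : Prop :=
  match onth w i with
  | Some TProp => fact KY i j /\ forall b, b < m -> lX b.[i] -> lV b.[i]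
  | Some TNot => [/\ i.+1 < n, fact KY i.+1 j & forall b, b < m -> lX b.[i] -> ~~ lV b.[i.+1]]
  | Some TAnd => exists z, [/\ fact KF i.+1 z, fact KF z.+1 j &
      forall b, b < m -> p_and (lX b.[i]) (lX b.[i.+1]) (lX b.[z.+1])]
  | Some TOr => exists z, [/\ fact KF i.+1 z, fact KF z.+1 j &
      forall b, b < m -> p_or (lX b.[i]) (lX b.[i.+1]) (lX b.[z.+1])]
  | Some TBox => fact KF i.+1 j
  | Some TDiamond => fact KF i.+1 j /\ forall b, b < m -> lX b.[i] ->
      exists d, [/\ d < m, child b d & lM d.[i.+1] = None]
  | Some TOpen => onth w j = Some TClose /\ exists z,
      [/\ [/\ z.+1 < n, between a.[z], at3 a.[z] & onth w z = Some TSub],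
          forall k, k < n -> between a.[k] -> ~~ at3 a.[k] -> is_symb (onth w k),
          pair_fact i i.+1 z.+1 &
          forall b, b < m -> lX b.[i] -> exists d, [/\ d < m, lX d.[i] &
            forall k l, pair_fact i k l -> lV b.[k] = lV d.[l]]]
  | _ => False
  end.

Record cert : Prop := Cert {
  cert_phases : forall a i, a < m -> i.+1 < n -> letter_step a.[i] a.[i.+1];
  cert_formula : forall a i j, a < m -> i < n -> j < n ->
    at1 KF a.[i] -> at2 a.[j] -> formula_rule a i j;
  cert_symbol : forall a i j, a < m -> i < n -> j < n -> at1 KY a.[i] -> at2 a.[j] ->
    [/\ onth w i = Some TProp, l2 a.[i] != Some true, ~~ is_bit (onth w j.+1) &
        forall z, z < n -> l1 a.[z] = Some true -> l2 a.[z] != Some true -> is_bit (onth w z)];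
  cert_chain : forall i j l, pair_fact l i j ->
    exists z y, [/\ fact KY i z, fact KY j y &
      [/\ onth w z.+1 = Some TProp, onth w y.+1 = Some TProp & pair_fact l z.+1 y.+1] \/
      (onth w z.+1 = Some TSub /\ onth w y.+1 = Some TClose)];
  cert_differ : forall i j, fact KN i j ->
    match onth w i.+1, onth w j.+1 with
    | Some (TBit x), Some (TBit y) => x = y -> fact KN i.+1 j.+1
    | t, t' => is_bit t (+) is_bit t'
    end;
  cert_valuation : forall b k l, b < m -> onth w k = Some TProp -> onth w l = Some TProp ->
    lV b.[k] = lV b.[l] \/ fact KN k l;
  cert_entered : forall b, b < m ->
    ((forall k, is_modal (onth w k) -> k.+1 < n /\ ~~ lX b.[k.+1]) /\ exists2 k, k < n & lR b.[k] = None) \/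
    exists d k, [/\ d < m, child d b, is_modal (onth w k), lX d.[k] & k.+1 < n /\ lM b.[k.+1] = None];
  cert_top : exists a i j, [/\ [/\ a < m, i < n & j < n], at1 KF a.[i], at2 a.[j],
    forall z, z < n -> l1 a.[z] != Some false /\ l2 a.[z] != Some true &
    exists2 b, b < m & lX b.[i]]
}.

Notation sat := (sat letter0 w rows).
Notation env := ('I_5 + 'I_4 -> nat)%type.

Lemma satIf c phi (e : env) : sat (FIf c phi) e <-> (c -> sat phi e).
Proof. by case: c; split=> //; apply. Qed.

Lemma sat_fact K (i j : 'I_5) (e : env) : e (inr rc) = m ->
  sat (f_fact K i j) e <-> fact K (e (inl i)) (e (inl j)).
Proof.
move=> er; split.
  by move=> [_ [c ltc [[lti _ H1] [ltj _ H2]]]]; exists c.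
by move=> [c [ltc lti ltj H1 H2]]; split=> //; exists c.
Qed.

Lemma sat_pair (l i j : 'I_5) (e : env) : e (inr rc) = m ->
  sat (f_pair l i j) e <-> pair_fact (e (inl l)) (e (inl i)) (e (inl j)).
Proof.
move=> er; split.
  by move=> [_ [c ltc [[lti _ H1] [[ltj _ H2] [ltl _ H3]]]]]; exists c.
by move=> [c [ltc [ltl lti ltj] H1 H2 H3]]; split=> //; exists c.
Qed.

Lemma sat_each K phi : sat (f_each K phi) (lim w rows) <->
  (forall a i j, a < m -> i < n -> j < n -> at1 K a.[i] -> at2 a.[j] ->
   sat phi (upd (upd (upd (lim w rows) (inr ra) a) (inl vi) i) (inl vj) j)).
Proof.
split.
  move=> [_ H] a i j lta lti ltj H1 H2.
  have [_ _ [_ _ /satIf]] := ((H a lta).2 i lti).2 j ltj; apply.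
  exact/andP.
move=> H; split=> // a lta; split=> // i lti; split=> // j ltj; do 2?split=> //.
by apply/satIf => /andP[H1 H2]; apply: H.
Qed.

Lemma sat_child (p d : 'I_4) (e : env) : e (inl vk) = n -> e (inr p) < m -> e (inr d) < m ->
  sat (f_child p d) e <-> child (e (inr p)) (e (inr d)).
Proof.
move=> ek ltp ltd; split.
  move=> [[_ H1] [_ [k0 ltk0 [[_ _ /eqP H2] [_ [ltk1 _ /eqP H3]]]]]]; split; last by exists k0.
  move=> k ltk mk; have [_ _ [_ [ltk' _ H]]] := (satIf _ _ _).1 (H1 k ltk) mk.
  by split=> //; apply/eqP.
move=> [H1 [k0 ltk0 [H2 H3]]]; split.
  split=> // k ltk; apply/satIf => mk; have [ltk' H] := H1 k ltk mk.
  by do 4?split=> //; apply/eqP.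
split=> //; exists k0; first exact: ltnW.
by do 4?split; rewrite /upd /= ?(ltnW ltk0) //; apply/eqP.
Qed.

Lemma onth_some (i : nat) : (onth w i != None) = (i < n).
Proof. by rewrite -onthTE; case: onth. Qed.

Lemma sat_phases : sat f_phases (lim w rows) <->
  (forall a i, a < m -> i.+1 < n -> letter_step a.[i] a.[i.+1]).
Proof.
split.
  move=> [_ H] a i lta lti; have [_ _ [_ /satIf]] := (H a lta).2 i (ltnW lti).
  by case; first by rewrite onth_some.
move=> H; split=> // a lta; split=> // i lti; do 2?split=> //.
apply/satIf; rewrite onth_some => lt; by split=> //; apply: H.
Qed.

Lemma sat_symbol : sat f_symbol (lim w rows) <->
  (forall a i j, a < m -> i < n -> j < n -> at1 KY a.[i] -> at2 a.[j] ->
    [/\ onth w i = Some TProp, l2 a.[i] != Some true, ~~ is_bit (onth w j.+1) &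
        forall z, z < n -> l1 a.[z] = Some true -> l2 a.[z] != Some true -> is_bit (onth w z)]).
Proof.
split.
  move/sat_each => H a i j lta lti ltj H1 H2.
  have [/eqP e1 [[_ _ e2] [[_ e3] [_ H4]]]] := H a i j lta lti ltj H1 H2.
  split=> // z ltz z1 z2; have [_ _ /satIf] := H4 z ltz; apply.
  by apply/andP; split=> //; apply/eqP.
move=> H; apply/sat_each => a i j lta lti ltj H1 H2.
have [e1 e2 e3 e4] := H a i j lta lti ltj H1 H2.
split; first exact/eqP.
split; first by [].
split; first by [].
split=> // z ltz; split=> //; apply/satIf => /andP[/eqP z1 z2].
exact: e4.
Qed.

Lemma sat_chain : sat f_chain (lim w rows) <->
  (forall i j l, pair_fact l i j ->
    exists z y, [/\ fact KY i z, fact KY j y &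
      [/\ onth w z.+1 = Some TProp, onth w y.+1 = Some TProp & pair_fact l z.+1 y.+1] \/
      (onth w z.+1 = Some TSub /\ onth w y.+1 = Some TClose)]).
Proof.
split.
  move/sat_each => H i j l [a [lta [ltl lti ltj] H1 H2 H3]].
  have [_ _ /satIf/(_ H3)] := (H a i j lta lti ltj H1 H2).2 l ltl.
  move=> [_ [z ltz [_ [y lty [/sat_fact F1 [/sat_fact F2 [_ [_ O]]]]]]]].
  exists z, y; split; [exact: F1|exact: F2|].
  case: O => [[[/eqP ez /eqP ey] /sat_pair P]|[/eqP ez /eqP ey]]; last by right.
  by left; split=> //; apply: P.
move=> H; apply/sat_each => a i j lta lti ltj H1 H2; split=> // l ltl; split=> //.
apply/satIf => H3; have [|z [y [F1 F2 O]]] := H i j l; first by exists a.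
have [_ [_ _ ltz _ _]] := F1; have [_ [_ _ lty _ _]] := F2.
split=> //; exists z => //; split=> //; exists y => //.
split; first exact/sat_fact.
split; first exact/sat_fact.
do 2?split=> //; case: O => [[ez ey P]|[ez ey]]; [left|right].
  by split; [split; apply/eqP|apply/sat_pair].
by split; apply/eqP.
Qed.

Lemma sat_differ : sat f_differ (lim w rows) <-> (forall i j, fact KN i j ->
    match onth w i.+1, onth w j.+1 with
    | Some (TBit x), Some (TBit y) => x = y -> fact KN i.+1 j.+1
    | t, t' => is_bit t (+) is_bit t'
    end).
Proof.
split.
  move/sat_each => H i j [a [lta lti ltj H1 H2]].
  have [_ [_ H0]] := H a i j lta lti ltj H1 H2.
  pose e := upd (upd (upd (upd (upd (lim w rows) (inr ra) a) (inl vi) i) (inl vj) j)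
    (inl vi) i.+1) (inl vj) j.+1.
  have {H H0} : sat (f_compare (onth w i.+1) (onth w j.+1)) e := H0.
  case: (onth w i.+1) => [[x||||||||| ]|]; case: (onth w j.+1) => [[y||||||||| ]|]; try exact: id.
  by move=> /satIf + t exy; rewrite exy => /(_ (eqxx _)) /sat_fact; apply.
move=> H; apply/sat_each => a i j lta lti ltj H1 H2; do 2?split=> //.
have {}H := H i j (ex_intro _ a (And5 lta lti ltj H1 H2)).
pose e := upd (upd (upd (upd (upd (lim w rows) (inr ra) a) (inl vi) i) (inl vj) j)
    (inl vi) i.+1) (inl vj) j.+1.
suff : sat (f_compare (onth w i.+1) (onth w j.+1)) e by [].
case: (onth w i.+1) H => [[x||||||||| ]|]; case: (onth w j.+1) => [[y||||||||| ]|]; try exact: id.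
by move=> H; apply/satIf => /eqP/H F; apply/sat_fact.
Qed.

Lemma sat_valuation : sat f_valuation (lim w rows) <->
  (forall b k l, b < m -> onth w k = Some TProp -> onth w l = Some TProp ->
    lV b.[k] = lV b.[l] \/ fact KN k l).
Proof.
split.
  move=> [_ H] b k l ltb ek el.
  have ltk : k < n by rewrite -onthTE ek.
  have ltl : l < n by rewrite -onthTE el.
  have [|_ _ [_ _]] := (satIf _ _ _).1 (((H b ltb).2 k ltk).2 l ltl).
    by apply/andP; split; apply/eqP.
  move/satIf => H0; case: (eqVneq (lV b.[k]) (lV b.[l])) => [|ne]; [by left|right].
  by have /sat_fact F := H0 ne; apply: F.
move=> H; split=> // b ltb; split=> // k ltk; split=> // l ltl.
apply/satIf => /andP[/eqP ek /eqP el]; do 2?split=> //.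
apply/satIf => /eqP ne; case: (H b k l ltb ek el) => // F; exact/sat_fact.
Qed.

Lemma sat_entered : sat f_entered (lim w rows) <-> (forall b, b < m ->
    ((forall k, is_modal (onth w k) -> k.+1 < n /\ ~~ lX b.[k.+1]) /\ exists2 k, k < n & lR b.[k] = None) \/
    exists d k, [/\ d < m, child d b, is_modal (onth w k), lX d.[k] & k.+1 < n /\ lM b.[k.+1] = None]).
Proof.
split.
  move=> [_ H] b ltb; case: (H b ltb) => [[[_ H1] [_ [k0 ltk0 [_ _ /eqP Hk]]]]|].
    left; split; last by exists k0.
    move=> k mk; have ltk : k < n by rewrite -onthTE; case: onth mk.
    by have [_ [ltk' _ H2]] := (satIf _ _ _).1 (H1 k ltk) mk.
  move=> [_ [d ltd [/sat_child C [_ [k ltk [mk [[_ _ xk] [_ [ltk' _ /eqP Hk]]]]]]]]].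
  by right; exists d, k; split=> //; apply: C.
move=> H; split=> // b ltb; case: (H b ltb) => [[H1 [k0 ltk0 Hk]]|[d [k [ltd C mk xk [ltk' Hk]]]]].
  left; split; last by split=> //; exists k0 => //; split=> //; apply/eqP.
  split=> // k ltk; apply/satIf => mk; have [ltk' H2] := H1 k mk.
  by do 2?split=> //.
right; split=> //; exists d => //; split; first exact/sat_child.
have ltk : k < n by apply: ltnW.
split=> //; exists k => //; do 4?split=> //; exact/eqP.
Qed.

Lemma sat_top : sat f_top (lim w rows) <->
  (exists a i j, [/\ [/\ a < m, i < n & j < n], at1 KF a.[i], at2 a.[j],
    forall z, z < n -> l1 a.[z] != Some false /\ l2 a.[z] != Some true &
    exists2 b, b < m & lX b.[i]]).
Proof.
split.
  move=> [_ [a lta [_ [i lti [_ [j ltj [[[_ _ H1] [_ _ H2]] [[_ H3] [_ [b ltb [_ _ H4]]]]]]]]]]].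
  exists a, i, j; split=> //; last by exists b.
  by move=> z ltz; have [_ _ /andP] := H3 z ltz.
move=> [a [i [j [[lta lti ltj] H1 H2 H3 [b ltb H4]]]]].
split=> //; exists a => //; split=> //; exists i => //; split=> //; exists j => //.
split; first by split.
split; last by split=> //; exists b.
by split=> // z ltz; split=> //; apply/andP/H3.
Qed.

Lemma sat_binary P (e : env) : e (inl vz) = n -> e (inr rb) = m -> e (inr rc) = m ->
  sat (f_binary P) e <-> exists z,
    [/\ fact KF (e (inl vi)).+1 z, fact KF z.+1 (e (inl vj)) &
     forall b, b < m -> P (lX b.[e (inl vi)]) (lX b.[(e (inl vi)).+1]) (lX b.[z.+1])].
Proof.
move=> ez eb ec; split.
  move=> [_ [z ltz [[_ /sat_fact F1] [[_ /sat_fact F2] [_ H]]]]]; exists z.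
  split; [exact: F1|exact: F2|] => b ltb.
  by have [_ _ [_ [_ _ [_ [_ _]]]]] := H b ltb.
move=> [z [F1 F2 H]].
have [_ [_ lti1 ltz _ _]] := F1; have [_ [_ ltz1 ltj _ _]] := F2.
have lti := ltnW lti1.
split=> //; exists z => //; split; first by split=> //; apply/sat_fact.
split; first by split=> //; apply/sat_fact.
by split=> // b ltb; do 6?split=> //; apply: H.
Qed.

Lemma sat_incl a i j : a < m -> i < n -> j < n ->
  let e := upd (upd (upd (lim w rows) (inr ra) a) (inl vi) i) (inl vj) j in
  sat f_incl e <-> (onth w j = Some TClose /\ exists z,
      [/\ [/\ z.+1 < n, between a.[z], at3 a.[z] & onth w z = Some TSub],
          forall k, k < n -> between a.[k] -> ~~ at3 a.[k] -> is_symb (onth w k),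
          pair_fact i i.+1 z.+1 &
          forall b, b < m -> lX b.[i] -> exists d, [/\ d < m, lX d.[i] &
            forall k l, pair_fact i k l -> lV b.[k] = lV d.[l]]]).
Proof.
move=> lta lti ltj e; split.
  move=> [/eqP ej [_ [z ltz [[[_ _ /andP[z1 z3]] /eqP zs] [[_ Hb] [[_ [c ltc Hc]] [_ Hw]]]]]]].
  have [[_ _ c3] [[_ [lti1 _ c1]] [_ [ltz1 _ c2]]]] := Hc.
  split=> //; exists z; split=> //.
  - move=> k ltk bk k3; have [_ _ /satIf] := Hb k ltk; apply.
    exact/andP.
  - by exists c.
  - move=> b ltb xb; have [_ _ /satIf/(_ xb)] := Hw b ltb.
    move=> [_ [d ltd [[_ _ xd] [_ H]]]]; exists d; split=> // k l [c' [ltc' [_ ltk ltl] c1' c2' c3']].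
    have [_ _ [_ _ [_ _ /satIf Hk]]] := ((H k ltk).2 l ltl).2 c' ltc'.
    have [|_ _ [_ _ /eqP]] := Hk; last by [].
    by apply/and3P.
move=> [ej [z [[ltz1 z1 z3 zs] Hb [c [ltc [_ lti1 _] c1 c2 c3]] Hw]]].
have ltz := ltnW ltz1.
split; first exact/eqP.
split=> //; exists z => //.
split; first by split; [split=> //; apply/andP|apply/eqP].
split; first by split=> // k ltk; split=> //; apply/satIf => /andP[]; apply: Hb.
split; first by split=> //; exists c => //; do 4?split.
split=> // b ltb; split=> //; apply/satIf => xb; have [d [ltd xd H]] := Hw b ltb xb.
split=> //; exists d => //; split; first by split.
split=> // k ltk; split=> // l ltl; split=> // c' ltc'; do 3?split=> //.
apply/satIf => /and3P[c1' c2' c3']; do 2?split=> //.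
by apply/eqP/H; exists c'.
Qed.

Lemma sat_formula : sat f_formula (lim w rows) <->
  (forall a i j, a < m -> i < n -> j < n -> at1 KF a.[i] -> at2 a.[j] -> formula_rule a i j).
Proof.
suff E a i j : a < m -> i < n -> j < n ->
  let e := upd (upd (upd (lim w rows) (inr ra) a) (inl vi) i) (inl vj) j in
  sat (fTst vi (fun t => match t with
    | Some TProp => f_lit
    | Some TNot => f_nlit
    | Some TAnd => f_binary p_and
    | Some TOr => f_binary p_or
    | Some TBox => f_box
    | Some TDiamond => f_diamond
    | Some TOpen => f_incl
    | _ => fCst false
    end)) e <-> formula_rule a i j.
  split=> [/sat_each H a i j lta lti ltj H1 H2|H]; first exact/E/H.
  by apply/sat_each => a i j lta lti ltj H1 H2; apply/E/H.
move=> lta lti ltj e.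
set F := fun t => _; suff : forall t, onth w i = t -> (sat (F t) e <-> formula_rule a i j).
  by move/(_ _ erefl).
case=> [[x||||||||| ]|] et; rewrite /formula_rule et.
- by [].
- split; first move=> [/sat_fact F1 [_ H]].
    by split; [exact: F1|move=> b ltb xb; have [_ _ /implyP] := H b ltb; apply].
  move=> [F1 H]; split; first exact/sat_fact.
  by split=> // b ltb; split=> //; apply/implyP/H.
- split; first move=> [[_ /sat_fact F1] [_ H]].
    have [_ [_ lti1 _ _ _]] := F1 erefl.
    split; [exact: lti1|exact: F1|move=> b ltb xb].
    by have [_ _ [_ [_ _ /implyP]]] := H b ltb; apply.
  move=> [lti1 F1 H]; split; first by split=> //; apply/sat_fact.
  by split=> // b ltb; do 3?split=> //; apply/implyP/H.
- exact: sat_binary.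
- exact: sat_binary.
- split; first by move=> [_ /sat_fact F1]; apply: F1.
  by move=> F1; split=> //; apply/sat_fact.
- split; first move=> [[_ /sat_fact F1] [_ H]].
    split; [exact: F1|move=> b ltb xb].
    have [_ _ /satIf/(_ xb) [_ [d ltd [/sat_child C [_ [_ _ /eqP Hd]]]]]] := H b ltb.
    by exists d; split=> //; apply: C.
  move=> [F1 H]; split; first by split=> //; apply/sat_fact.
  have [_ [_ lti1 _ _ _]] := F1.
  split=> // b ltb; split=> //; apply/satIf => xb.
  have [d [ltd C Hd]] := H b ltb xb.
  split=> //; exists d => //; split; first exact/sat_child.
  by do 2?split=> //; apply/eqP.
- exact: sat_incl.
- by [].
- by [].
- by [].
Qed.

Lemma sat_cert : sat f_cert (lim w rows) <-> cert.
Proof.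
split.
  move=> [/sat_phases H1 [/sat_formula H2 [/sat_symbol H3 [/sat_chain H4
    [/sat_differ H5 [/sat_valuation H6 [/sat_entered H7 /sat_top H8]]]]]]].
  by constructor.
case=> H1 H2 H3 H4 H5 H6 H7 H8.
split; first exact/sat_phases.
split; first exact/sat_formula.
split; first exact/sat_symbol.
split; first exact/sat_chain.
split; first exact/sat_differ.
split; first exact/sat_valuation.
split; [exact/sat_entered|exact/sat_top].
Qed.

End Cert.

(** * Marked positions and binary words *)

Lemma phase_after n (p : nat -> phase) i k :
  (forall k, k.+1 < n -> phase_step (p k) (p k.+1)) ->
  p i <> Some false -> i < k -> k < n -> p k = Some true.
Proof.
move=> st pi; elim: k => // k IH; rewrite ltnS leq_eqVlt => /predU1P[<-|lt] ltn.
  by have := st _ ltn; rewrite /phase_step; case: (p i) pi => [[]|] // _ /eqP.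
by have := st _ ltn; rewrite /phase_step IH ?(ltnW ltn) // => /eqP.
Qed.

(** One [None] determines the whole word: any letter but [Some false] on its left would already
    force [Some true] at [i]. *)
Lemma phase_at n (p : nat -> phase) i :
  (forall k, k.+1 < n -> phase_step (p k) (p k.+1)) ->
  i < n -> p i = None -> forall k, k < n ->
  p k = if k < i then Some false else if k == i then None else Some true.
Proof.
move=> st lti pi k ltk; case: ltngtP => [lt|lt|-> //]; last first.
  by apply: phase_after st _ lt ltk; rewrite pi.
case E: (p k) => [[]|] //; suff : p i = Some true by rewrite pi.
  by apply: phase_after st _ lt lti; rewrite E.
by apply: phase_after st _ lt lti; rewrite E.
Qed.

Lemma drop_onth (T : Type) (s : seq T) k :
  drop k s = if onth s k is Some t then t :: drop k.+1 s else [::].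
Proof. by elim: s k => [|x s IH] [|k] //=; rewrite ?drop0 // IH. Qed.

Fixpoint bits (s : seq token) : seq bool :=
  if s is TBit x :: s' then x :: bits s' else [::].
(** The name written behind a marker at [k]. *)
Definition run (w : seq token) (k : nat) : seq bool := bits (drop k.+1 w).

Lemma runE w k : run w k = if onth w k.+1 is Some (TBit x) then x :: run w k.+1 else [::].
Proof. by rewrite /run drop_onth; case: (onth w k.+1) => [[]|]. Qed.

(** * A finite model from a certificate *)

Section Soundness.
Variables (Pi : Type) (name : Pi -> seq bool) (unname : seq bool -> Pi).
Hypotheses (nameK : cancel name unname) (unnameK : cancel unname name).
Variables (w : seq token) (rows : seq (seq letter)).
Notation n := (size w).
Notation m := (size rows).
Notation lt_at := (lt_at rows).
Local Notation "a .[ i ]" := (lt_at a i).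
Notation fact := (fact w rows).
Notation pair_fact := (pair_fact w rows).
Notation child := (child w rows).
Hypothesis C : cert w rows.

Definition symbol (k : nat) : Pi := unname (run w k).

Lemma steps_of a : a < m -> forall k, k.+1 < n ->
  [/\ phase_step (l1 a.[k]) (l1 a.[k.+1]), phase_step (l2 a.[k]) (l2 a.[k.+1]),
      phase_step (l3 a.[k]) (l3 a.[k.+1]), phase_step (lM a.[k]) (lM a.[k.+1]) &
      phase_step (lR a.[k]) (lR a.[k.+1])].
Proof. by move=> lta k ltk; apply/and5P; apply: cert_phases C _ _ lta ltk. Qed.

Lemma l1_at a i k : a < m -> i < n -> l1 a.[i] = None -> k < n ->
  l1 a.[k] = if k < i then Some false else if k == i then None else Some true.
Proof. by move=> lta lti e; apply: (phase_at (p := fun k => l1 a.[k]) _ lti e) => k' /(steps_of lta)[]. Qed.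
Lemma l2_at a i k : a < m -> i < n -> l2 a.[i] = None -> k < n ->
  l2 a.[k] = if k < i then Some false else if k == i then None else Some true.
Proof. by move=> lta lti e; apply: (phase_at (p := fun k => l2 a.[k]) _ lti e) => k' /(steps_of lta)[]. Qed.
Lemma l3_at a i k : a < m -> i < n -> l3 a.[i] = None -> k < n ->
  l3 a.[k] = if k < i then Some false else if k == i then None else Some true.
Proof. by move=> lta lti e; apply: (phase_at (p := fun k => l3 a.[k]) _ lti e) => k' /(steps_of lta)[]. Qed.
Lemma lM_at a i k : a < m -> i < n -> lM a.[i] = None -> k < n ->
  lM a.[k] = if k < i then Some false else if k == i then None else Some true.
Proof. by move=> lta lti e; apply: (phase_at (p := fun k => lM a.[k]) _ lti e) => k' /(steps_of lta)[]. Qed.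
Lemma lR_at a i k : a < m -> i < n -> lR a.[i] = None -> k < n ->
  lR a.[k] = if k < i then Some false else if k == i then None else Some true.
Proof. by move=> lta lti e; apply: (phase_at (p := fun k => lR a.[k]) _ lti e) => k' /(steps_of lta)[]. Qed.

Lemma lM_uniq a i k : a < m -> i < n -> k < n -> lM a.[i] = None -> lM a.[k] = None -> i = k.
Proof. by move=> lta lti ltk e; rewrite (lM_at lta lti e ltk); case: ltngtP. Qed.
Lemma lR_uniq a i k : a < m -> i < n -> k < n -> lR a.[i] = None -> lR a.[k] = None -> i = k.
Proof. by move=> lta lti ltk e; rewrite (lR_at lta lti e ltk); case: ltngtP. Qed.

Lemma onth_lt_size (i : nat) t : onth w i = Some t -> i < n.
Proof. by move=> e; rewrite -onthTE e. Qed.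

(** Surjectivity of [name] enters here through [unnameK]: whatever bits follow the marker, they are
    the name of some symbol. *)
Lemma symbol_sound i j : fact KY i j -> [/\ i <= j, j < n, onth w i = Some TProp,
  drop i w = encode_symbol name (symbol i) ++ drop j.+1 w &
  forall z, i < z <= j -> is_bit (onth w z)].
Proof.
case=> a [lta lti ltj A1 A2].
have [ei l2i nb B] := cert_symbol C lta lti ltj A1 A2.
case/andP: A1 => _ /eqP e1; move/eqP: A2 => e2.
have le : i <= j by move: l2i; rewrite (l2_at lta ltj e2 lti); case: ltngtP.
have B' z : i < z <= j -> is_bit (onth w z).
  case/andP=> ltz lez; have ltzn : z < n by lia.
  apply: B => //.
    by rewrite (l1_at lta lti e1 ltzn) ltnNge (ltnW ltz) gtn_eqF.
  by rewrite (l2_at lta ltj e2 ltzn); case: (ltngtP z j) lez.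
split=> //; rewrite drop_onth ei /encode_symbol unnameK; congr (_ :: _).
suff H d k : j - k = d -> i <= k <= j ->
    drop k.+1 w = [seq TBit b | b <- run w k] ++ drop j.+1 w by apply: H; rewrite ?leqnn.
elim: d k => [|d IH] k E /andP[lek lek'].
  have -> : k = j by lia.
  by rewrite runE; case: onth nb => // -[].
have : is_bit (onth w k.+1) by apply: B'; lia.
case E1: (onth w k.+1) => [[x||||||||| ]|] // _.
by rewrite runE E1 /= drop_onth E1 (IH k.+1) //; lia.
Qed.

Lemma differ_sound i j : fact KN i j -> run w i <> run w j.
Proof.
move E: (n - i) => d; elim: d i j E => [|d IH] i j E F.
  by case: F => a [_ lti _ _ _]; lia.
have := cert_differ C F; rewrite [run w i]runE [run w j]runE.
case: (onth w i.+1) => [[x||||||||| ]|]; case: (onth w j.+1) => [[y||||||||| ]|] //=.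
move=> H [exy]; apply: IH; last exact: H.
by case: F => a [_ lti _ _ _]; lia.
Qed.

Lemma n_gt0 : 0 < n.
Proof. by have [a [i [j [[_ lti _] _ _ _ _]]]] := cert_top C; lia. Qed.
Lemma m_gt0 : 0 < m.
Proof. by have [a [i [j [[lta _ _] _ _ _ _]]]] := cert_top C; lia. Qed.

Definition position := 'I_n.-1.+1.
Definition row := 'I_m.-1.+1.
(* A node is a branch of rows together with a depth on it; the rows beyond this
   depth say which successors are chosen, so that every row that is a possible
   successor is actually chosen by some copy of its predecessor. *)
Definition node_type := (position * {ffun position -> row})%type.
Definition depth (u : node_type) : nat := u.1.
Definition row_of (u : node_type) : nat := u.2 u.1.

Lemma pos_lt (q : position) : q < n.
Proof. by apply: leq_trans (ltn_ord q) _; rewrite prednK // n_gt0. Qed.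
Lemma row_lt (r : row) : r < m.
Proof. by apply: leq_trans (ltn_ord r) _; rewrite prednK // m_gt0. Qed.
Lemma pos_inord k : k < n -> (inord k : position) = k :> nat.
Proof. by move=> lt; rewrite inordK // prednK // n_gt0. Qed.
Lemma row_inord k : k < m -> (inord k : row) = k :> nat.
Proof. by move=> lt; rewrite inordK // prednK // m_gt0. Qed.

Definition successor_by k b d : Prop :=
  [/\ is_modal (onth w k), lX b.[k], k.+1 < n /\ lM d.[k.+1] = None & child b d].

Definition default k b : row := odflt ord0 [pick d : row | `[< successor_by k b d >]].

(** The branch is kept when its next entry is a possible successor, so every possible successor is
    chosen by some copy of its predecessor; otherwise a default is put in. *)
Definition next k (u : node_type) : node_type :=
  let q : position := inord (depth u).+1 in
  (q, [ffun r => if r == q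
       then if `[< successor_by k (row_of u) (u.2 q) >] then u.2 q else default k (row_of u)
       else u.2 r]).

Definition node_acc (u v : node_type) : Prop :=
  depth v = (depth u).+1 /\ exists2 k, successor_by k (row_of u) (row_of v) &
    onth w k = Some TDiamond -> v = next k u.

Definition is_root b : Prop := forall k, is_modal (onth w k) -> ~~ lX b.[k.+1].

(** A branch may list unrelated rows. Teams consist of valid nodes only, because a node in the team
    of a modal argument needs a genuine predecessor. *)
Inductive valid : node_type -> Prop :=
| valid_root u : is_root (row_of u) -> lR (row_of u).[depth u] = None -> valid u
| valid_next u v : valid u -> node_acc u v -> valid v.

Lemma valid_rank u : valid u -> lR (row_of u).[depth u] = None.
Proof.
elim=> {u} // u v _ IH [ed [k [_ _ _ [_ [k0 ltk0 [e1 e2]]]] _]].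
have -> : depth v = k0.+1; last exact: e2.
by rewrite ed; congr _.+1; apply: (lR_uniq (row_lt _) (pos_lt _)) IH e1; apply: ltnW.
Qed.

(** Induction on the depth, which drops by one at a predecessor. The entries beyond [z] stay free,
    so the same history can be continued by any row. *)
Lemma realized z b : b < m -> z < n -> lR b.[z] = None ->
  exists s : {ffun position -> row}, s (inord z) = b :> nat /\
  forall s' : {ffun position -> row}, (forall q : position, q <= z -> s' q = s q) ->
    valid (inord z, s').
Proof.
elim: z b => [|z IH] b ltb ltz eb.
all: have [[H _]|[d [k [ltd ch mk xk [ltk ek]]]]] := cert_entered C ltb.
- exists [ffun=> inord b]; rewrite ffunE row_inord //; split=> // s' es.
  have e : row_of (inord 0, s') = b by rewrite /row_of /= es ?pos_inord // ffunE row_inord.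
  apply: valid_root; rewrite e ?/depth /= ?pos_inord // => k0 mk0.
  by have [] := H k0 mk0.
- have [_ [k0 ltk0 [_ e2]]] := ch.
  by have := lR_uniq ltb ltz ltk0 eb e2.
- exists [ffun=> inord b]; rewrite ffunE row_inord //; split=> // s' es.
  have e : row_of (inord z.+1, s') = b by rewrite /row_of /= es ?pos_inord // ffunE row_inord.
  apply: valid_root; rewrite e ?/depth /= ?pos_inord // => k0 mk0.
  by have [] := H k0 mk0.
- have [_ [k0 ltk0 [e1 e2]]] := ch.
  have [ez] : z.+1 = k0.+1 := lR_uniq ltb ltz ltk0 eb e2.
  rewrite -ez in e1; have [s [es Hs]] := IH d ltd (ltnW ltz) e1.
  have ez1 := pos_inord ltz; have ez0 := pos_inord (ltnW ltz).
  exists [ffun q => if q == inord z.+1 then inord b else s q].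
  rewrite ffunE eqxx row_inord //; split=> // s' es'.
  have eb' : s' (inord z.+1) = b :> nat by rewrite es' ?ez1 // ffunE eqxx row_inord.
  have es0 (q : position) : q <= z -> s' q = s q.
    move=> leq; rewrite es'; last lia.
    by rewrite ffunE; case: eqP => // eq; move: leq; rewrite eq ez1 ltnn.
  apply: (valid_next (Hs s' es0)); split; first by rewrite /depth /= ez1 ez0.
  have ed : row_of (inord z, s') = d by rewrite /row_of /= es0 ?ez0.
  exists k; first by rewrite ed /row_of /= eb'.
  (* The entry of [s'] at [z.+1] is a possible successor, so [next] keeps it and returns this very
     node. *)
  move=> _; rewrite /next /depth ed /= ez0; congr pair; apply/ffunP => q; rewrite ffunE.
  case: eqP => [->|//]; case: asboolP => // nsucc; case: nsucc.
  by rewrite eb'.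
Qed.

Lemma row_realized b : b < m -> exists2 u, valid u & row_of u = b.
Proof.
move=> ltb; have [z ltz ez] : exists2 z, z < n & lR b.[z] = None.
  have [[_ //]|[d [k [_ [_ [k0 ltk0 [_ e2]]] _ _ _]]]] := cert_entered C ltb.
  by exists k0.+1.
have [s [es Hs]] := realized ltb ltz ez.
by exists (inord z, s); [exact: Hs|exact: es].
Qed.

Definition node_val (p : Pi) : set node_type :=
  [set u | exists k, [/\ onth w k = Some TProp, symbol k = p & lV (row_of u).[k]]].

Definition node_model : kripke Pi :=
  @Kripke Pi node_type (inhabits (ord0, [ffun=> ord0])) node_acc node_val.

(** A symbol may occur at several positions. [cert_valuation] makes the value independent of the
    position, because a claimed difference of equal names is refuted by [differ_sound]. *)
Lemma node_valE k u : onth w k = Some TProp -> node_val (symbol k) u <-> lV (row_of u).[k].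
Proof.
move=> ek; split=> [[l [el es vl]]|vk]; last by exists k.
have [<- //|/differ_sound] := cert_valuation C (row_lt (u.2 u.1)) el ek.
by case; rewrite -[LHS]unnameK -/(symbol l) es unnameK.
Qed.

Definition team i : set node_model := [set u | valid u /\ lX (row_of u).[i]].

Lemma next_acc k u : valid u -> onth w k = Some TDiamond ->
  (exists2 d, d < m & successor_by k (row_of u) d) -> node_acc u (next k u).
Proof.
move=> vu ek [d ltd sd]; have ltu : (depth u).+1 < n.
  have [_ _ _ [_ [k0 ltk0 [e1 _]]]] := sd.
  by rewrite /depth (lR_uniq (row_lt _) (pos_lt _) (ltnW ltk0) (valid_rank vu) e1).
split; first by rewrite /depth /= pos_inord.
exists k => //; rewrite /row_of /= ffunE eqxx.
case: asboolP => // _; rewrite /default; case: pickP => [d' /asboolP //|] /(_ (inord d)) /asboolP.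
by rewrite row_inord.
Qed.

(** For the converse inclusion, a root belongs to no argument team, so the node has a predecessor.
    That predecessor is in the team of the Box either by [child] or, if the node was entered at this
    Box, by [successor_by]. *)
Lemma team_box i : i.+1 < n -> onth w i = Some TBox -> successors (team i) = team i.+1.
Proof.
move=> lti ei; apply/seteqP; split=> [v [u [vu xu] uv]|v [vv xv]].
  split; first exact: valid_next vu uv.
  have [_ [k [_ _ _ [ch _]] _]] := uv.
  have [|_ ->] := ch i (ltnW lti); first by rewrite ei.
  by rewrite xu ei.
case: vv xv => [u ru _ /= xu|u v' vu uv xv].
  by have := ru i; rewrite ei xu => /(_ isT).
exists u => //; split=> //.
have [_ [k [mk xk [ltk lk] [ch _]] _]] := uv.
have [|_] := ch i (ltnW lti); first by rewrite ei.
rewrite xv ei andbT => /esym/orP[//|/eqP li].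
by have [->] := lM_uniq (row_lt _) lti ltk li lk.
Qed.

(** A Diamond passes no membership on to other successors: a node of the argument team was entered
    at this very position, and [node_acc] makes it the chosen successor. *)
Lemma team_diamond i : i.+1 < n -> onth w i = Some TDiamond ->
  (forall b, b < m -> lX b.[i] -> exists d, [/\ d < m, child b d & lM d.[i.+1] = None]) ->
  (forall u, team i u -> node_acc u (next i u)) /\ (next i @` team i = team i.+1)%classic.
Proof.
move=> lti ei H.
have A u : team i u -> node_acc u (next i u).
  case=> vu xu; apply: next_acc => //.
  have [d [ltd ch ld]] := H _ (row_lt _) xu.
  by exists d => //; split=> //; rewrite ei.
split=> //; apply/seteqP; split=> [_ [u Tu <-]|v [vv xv]].
  have [vu xu] := Tu; split; first exact: valid_next vu (A u Tu).
  have lti0 : i < n by apply: ltnW.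
  have [_ [k [mk xk [ltk lk] [ch _]] ek]] := A u Tu.
  have [|_ ->] := ch i lti0; first by rewrite ei.
  have [d [ltd ch' ld]] := H _ (row_lt _) xu.
  rewrite ei andbF /= /row_of /= ffunE eqxx; case: asboolP => [[_ _ [_ ->]]//|_].
  rewrite /default; case: pickP => [d' /asboolP[_ _ [_ ->]]//|] /(_ (inord d)) /asboolP.
  by case; rewrite row_inord //; split=> //; rewrite ei.
case: vv xv => [u ru _ /= xu|u v' vu uv xv].
  by have := ru i; rewrite ei xu => /(_ isT).
have [_ [k [mk xk [ltk lk] [ch _]] ek]] := uv.
have [|_] := ch i (ltnW lti); first by rewrite ei.
rewrite xv ei andbF /= => /esym/eqP li.
have [eik] := lM_uniq (row_lt _) lti ltk li lk.
by exists u; [split=> //; rewrite eik|rewrite eik -ek // -eik].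
Qed.

Definition symbols (ps : seq Pi) : seq token := flatten [seq encode_symbol name p | p <- ps].

Lemma chain_sound i z j : z < j -> onth w z = Some TSub -> onth w j = Some TClose ->
  (forall k, i < k < j -> k != z -> is_symb (onth w k)) ->
  forall k l, i < k <= z -> z < l <= j -> pair_fact i k l -> exists p q ps qs,
  [/\ size ps = size qs, drop k w = symbols (p :: ps) ++ drop z w,
      drop l w = symbols (q :: qs) ++ drop j w &
      forall t, t < (size ps).+1 -> exists k' l', [/\ pair_fact i k' l',
        onth w k' = Some TProp /\ onth w l' = Some TProp,
        symbol k' = nth p (p :: ps) t & symbol l' = nth q (q :: qs) t]].
Proof.
move=> ltzj ez ej sy k; have ltjn := onth_lt_size ej.
have [d] := ubnP (n - k); elim: d k => // d IH k E l /andP[ltik lekz] /andP[ltzl lelj] P.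
have [y1 [y2 [/symbol_sound[le1 lt1 e1 d1 b1] /symbol_sound[le2 lt2 e2 d2 b2] O]]] := cert_chain C P.
have ltkz : k < z by rewrite ltn_neqAle lekz andbT; apply/eqP => ekz; move: e1; rewrite ekz ez.
have ltlj : l < j by rewrite ltn_neqAle lelj andbT; apply/eqP => elj; move: e2; rewrite elj ej.
have lty1 : y1 < z.
  by rewrite ltnNge; apply/negP => le; have := b1 z; rewrite ltkz le ez => /(_ isT).
have lty2 : y2 < j.
  by rewrite ltnNge; apply/negP => le; have := b2 j; rewrite ltlj le ej => /(_ isT).
case: O => [[e3 e4 P']|[e3 e4]].
- have [|||p [q [ps [qs [es dp dq H]]]]] := IH y1.+1 _ y2.+1 _ _ P'; try lia.
  exists (symbol k), (symbol l), (p :: ps), (q :: qs); split.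
  + by rewrite /= es.
  + by rewrite d1 dp catA.
  + by rewrite d2 dq catA.
  + case=> [|t] ltt; first by exists k, l.
    have [k' [l' [P2 e5 e6 e7]]] := H t ltt; exists k', l'; split=> //=.
    * by rewrite e6; apply: set_nth_default.
    * by rewrite e7; apply: set_nth_default; rewrite /= -es.
- have ey1 : y1.+1 = z.
    apply/eqP; case: eqP => // /eqP ne; have := sy y1.+1; rewrite e3 ne => H.
    by have := H ltac:(lia) isT.
  have ey2 : y2.+1 = j.
    apply/eqP; case: eqP => // /eqP ne; have := sy y2.+1; rewrite e4 => H.
    by have := H ltac:(lia) ltac:(lia).
  exists (symbol k), (symbol l), [::], [::]; split=> //.
  + by rewrite /symbols /= cats0 -ey1.
  + by rewrite /symbols /= cats0 -ey2.
  + by case=> // _; exists k, l.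
Qed.


Lemma team_row b i : b < m -> lX b.[i] -> exists2 u, team i u & row_of u = b.
Proof. by move=> ltb xb; have [u vu eu] := row_realized ltb; exists u => //; split; rewrite // eu. Qed.

(** Facts about immediate subformulas start further right, so induction on the distance to the end
    of the input yields the parse and the satisfaction on the team together. *)
Lemma fact_sound i j : fact KF i j -> [/\ i <= j, j < n &
  exists2 psi, drop i w = encode name psi ++ drop j.+1 w & team_sat (team i) psi].
Proof.
have [d] := ubnP (n - i); elim: d i j => // d IH i j E F.
case: (F) => a [lta lti ltj A1 A2].
have {}IH i' j' : i < i' -> fact KF i' j' -> [/\ i' <= j', j' < n &
    exists2 psi, drop i' w = encode name psi ++ drop j'.+1 w & team_sat (team i') psi].
  by move=> lt F'; apply: IH => //; case: F' => a' [_ lti' _ _ _]; lia.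
have := cert_formula C lta lti ltj A1 A2; rewrite /formula_rule.
have X u : row_of u < m := row_lt _.
case ei: (onth w i) => [[x||||||||| ]|] //.
- move=> [/symbol_sound[le _ _ di _] H]; split=> //.
  exists (Lit (symbol i)) => // u [_ xu]; apply/(node_valE _ ei); exact: H xu.
- move=> [_ /symbol_sound[le _ ei1 di _] H]; split=> //; first lia.
  exists (NLit (symbol i.+1)); first by rewrite drop_onth ei di.
  apply/seteqP; split=> // u [[_ xu] /(node_valE _ ei1)]; exact/negP/H.
- move=> [z [F1 F2 H]]; have [le1 _ [psi1 d1 s1]] := IH _ _ (ltnSn i) F1.
  have [le2 _ [psi2 d2 s2]] := IH _ _ (leqW le1) F2.
  split=> //; first lia; exists (And psi1 psi2); first by rewrite drop_onth ei d1 d2 /= catA.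
  have eT i' : (forall b, b < m -> lX b.[i'] = lX b.[i]) -> team i' = team i.
    by move=> e; apply/seteqP; split=> u [vu xu]; split=> //; move: xu; rewrite e.
  split; [rewrite -(eT i.+1) //|rewrite -(eT z.+1) //] => b /H/andP[/eqP e1 /eqP e2]; exact.
- move=> [z [F1 F2 H]]; have [le1 _ [psi1 d1 s1]] := IH _ _ (ltnSn i) F1.
  have [le2 _ [psi2 d2 s2]] := IH _ _ (leqW le1) F2.
  split=> //; first lia; exists (Or psi1 psi2); first by rewrite drop_onth ei d1 d2 /= catA.
  exists (team i.+1), (team z.+1); split=> //.
  + apply/seteqP; split=> u.
      by case=> -[vu xu]; split=> //; have /andP[/eqP-> +] := H _ (X u); rewrite xu; case: lX.
    case=> vu xu; have /andP[/eqP + _] := H _ (X u); rewrite xu => /esym.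
    by case E1: (lX _.[i.+1]) => /= E2; [left|right].
  + apply/seteqP; split=> // u [[_ x1] [_ x2]].
    by have /andP[_] := H _ (X u); rewrite x1 x2.
- move=> F1; have [le _ [psi dp sp]] := IH _ _ (ltnSn i) F1; split=> //; first lia.
  exists (Box psi); first by rewrite drop_onth ei dp.
  by rewrite /= team_box //; lia.
- move=> [F1 H]; have [le _ [psi dp sp]] := IH _ _ (ltnSn i) F1; split=> //; first lia.
  exists (Diamond psi); first by rewrite drop_onth ei dp.
  have [|acc_next im] := team_diamond _ ei H; first lia.
  by exists (next i); split=> //; rewrite im.
- move=> [ej [z [[ltz bz a3z ez] Hb P H]]].
  case/andP: A1 => _ /eqP a1; move/eqP: A2 => a2; move/eqP: a3z => a3z.
  have bet k : k < n -> between a.[k] = (i < k < j).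
    move=> ltk; rewrite /between (l1_at lta lti a1 ltk) (l2_at lta ltj a2 ltk).
    by case: (ltngtP k i); case: (ltngtP k j).
  have /andP[ltiz ltzj] : i < z < j by rewrite -bet // ltnW.
  have sy k : i < k < j -> k != z -> is_symb (onth w k).
    move=> lk nk; have ltk : k < n by lia.
    apply: Hb => //; first by rewrite bet.
    rewrite /at3 (l3_at lta (ltnW ltz) a3z ltk); by case: ltngtP nk.
  have [||p [q [ps [qs [es dp dq Hpq]]]]] := chain_sound ltzj ez ej sy _ _ P; [lia|lia|].
  split=> //; first lia.
  pose P1 := [tuple of p :: in_tuple ps].
  have szq : size (q :: qs) == (size ps).+1 by rewrite /= es.
  pose Q1 := Tuple szq.
  exists (Incl P1 Q1).
    rewrite drop_onth ei dp [in drop z w]drop_onth ez dq [in drop j w]drop_onth ej /=.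
    by rewrite /symbols /= -!catA /= -!catA.
  move=> u [vu xu]; have [d' [ltd xd Hd]] := H _ (X u) xu.
  have [v Tv ev] := team_row ltd xd; exists v => // t.
  have [k' [l' [P2 [e1 e2] e3 e4]]] := Hpq t (ltn_ord t).
  have -> : tnth P1 t = symbol k' by rewrite (tnth_nth p) e3.
  have -> : tnth Q1 t = symbol l' by rewrite (tnth_nth q) e4.
  split=> [/(node_valE _ e1)|/(node_valE _ e2)] V.
    by apply/(node_valE _ e2); rewrite ev -(Hd _ _ P2).
  by apply/(node_valE _ e1); rewrite (Hd _ _ P2) -ev.
Qed.

Lemma cert_sound : exists phi, w = encode name phi /\ finitely_satisfiable phi.
Proof.
have [a [i [j [[lta lti ltj] A1 A2 H3 [b ltb xb]]]]] := cert_top C.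
have [|le _ [phi dw sp]] := @fact_sound i j; first by exists a.
case/andP: A1 => _ /eqP a1; move/eqP: A2 => a2.
have i0 : i = 0.
  have [+ _] := H3 0 (leq_ltn_trans (leq0n _) lti).
  by rewrite (l1_at lta lti a1 (leq_ltn_trans (leq0n _) lti)); case: (i).
have jn : j.+1 = n.
  have ltn1 : n.-1 < n by lia.
  have [_] := H3 _ ltn1; rewrite (l2_at lta ltj a2 ltn1).
  by case: ltngtP => // H _; lia.
exists phi; split; first by rewrite -[LHS]drop0 -{1}i0 dw jn drop_size cats0.
have [u Tu _] := team_row ltb xb.
by exists node_model, (team i); split=> //; [exact: finite_finset|exists u].
Qed.

End Soundness.

(** * A certificate from a model *)

Section Completeness.
Variables (Pi : Type) (name : Pi -> seq bool) (unname : seq bool -> Pi).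
Hypotheses (nameK : cancel name unname) (unnameK : cancel unname name).
Variables (phi0 : formula Pi) (M : kripke Pi) (T0 : set M).
Notation w := (encode name phi0).
Notation n := (size w).
Notation esz psi := (size (encode name psi)).
Notation symbols := (symbols name).

Lemma esz_gt0 psi : 0 < esz psi.
Proof. by case: psi. Qed.

(** Occurrences are identified by positions, since equal subformulas at different places may have
    different teams. *)
Inductive Occ : nat -> formula Pi -> Prop :=
| Occ_root : Occ 0 phi0
| Occ_andl i a b : Occ i (And a b) -> Occ i.+1 a
| Occ_andr i a b : Occ i (And a b) -> Occ (i.+1 + esz a) b
| Occ_orl i a b : Occ i (Or a b) -> Occ i.+1 a
| Occ_orr i a b : Occ i (Or a b) -> Occ (i.+1 + esz a) b
| Occ_box i a : Occ i (Box a) -> Occ i.+1 a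
| Occ_diamond i a : Occ i (Diamond a) -> Occ i.+1 a.

Lemma bits_encode psi s : bits (encode name psi ++ s) = [::].
Proof. by case: psi. Qed.

Lemma drop_add (T : Type) (s s1 s2 : seq T) i : drop i s = s1 ++ s2 ->
  drop (i + size s1) s = s2.
Proof. by move=> e; rewrite addnC -drop_drop e drop_size_cat. Qed.

Lemma drop_cons (T : Type) (s s2 : seq T) x i : drop i s = x :: s2 -> drop i.+1 s = s2.
Proof. by rewrite -cat1s => /drop_add; rewrite addn1. Qed.

Lemma onth_drop (T : Type) (s : seq T) i d : onth (drop i s) d = onth s (i + d).
Proof. by elim: s i => [|x s IH] [|i] //=; rewrite ?onth0n // ?addSn -?IH // drop0. Qed.

(** The clause on [bits] ensures that the last name inside [psi] is not prolonged by what
    follows. *)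
Lemma Occ_drop i psi : Occ i psi ->
  exists2 s, drop i w = encode name psi ++ s & bits s = [::].
Proof.
elim=> [|{}i a b _ [s e bs]|{}i a b _ [s e bs]|{}i a b _ [s e bs]|{}i a b _ [s e bs]
       |{}i a _ [s e bs]|{}i a _ [s e bs]].
- by exists [::]; rewrite ?drop0 ?cats0.
- exists (encode name b ++ s); last exact: bits_encode.
  by rewrite catA; apply: drop_cons e.
- by exists s => //; apply: drop_add; rewrite catA; apply: drop_cons e.
- exists (encode name b ++ s); last exact: bits_encode.
  by rewrite catA; apply: drop_cons e.
- by exists s => //; apply: drop_add; rewrite catA; apply: drop_cons e.
- by exists s => //; apply: drop_cons e.
- by exists s => //; apply: drop_cons e.
Qed.

Lemma Occ_end i psi : Occ i psi -> i + esz psi <= n.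
Proof.
case/Occ_drop=> s /(congr1 size); rewrite size_drop size_cat => e _.
by have := esz_gt0 psi; lia.
Qed.

Lemma Occ_lt i psi : Occ i psi -> i < n.
Proof. by move/Occ_end; have := esz_gt0 psi; lia. Qed.

Lemma Occ_onth i psi d : Occ i psi -> d < esz psi -> onth w (i + d) = onth (encode name psi) d.
Proof. by case/Occ_drop=> s e _ lt; rewrite -onth_drop e onth_cat lt. Qed.

Lemma Occ_head i psi : Occ i psi -> onth w i = ohead (encode name psi).
Proof. by move=> O; rewrite -[i]addn0 (Occ_onth O (esz_gt0 _)); case: psi {O}. Qed.

(** Finds the subformula starting at [i] by the sizes of the encodings. Being a function, it yields
    uniqueness in [Occ_inj]. *)
Fixpoint sub (psi : formula Pi) (o i : nat) : option (formula Pi) :=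
  if i == o then Some psi else
  match psi with
  | And a b | Or a b =>
      if i < o.+1 + esz a then sub a o.+1 i else sub b (o.+1 + esz a) i
  | Box a | Diamond a => sub a o.+1 i
  | _ => None
  end.

Lemma sub_Occ i psi : Occ i psi -> forall k, i <= k < i + esz psi -> sub phi0 0 k = sub psi i k.
Proof.
elim=> [//|{}i a b _ IH k|{}i a b _ IH k|{}i a b _ IH k|{}i a b _ IH k|{}i a _ IH k|{}i a _ IH k] lek;
  (rewrite IH /= ?size_cat; last lia); (rewrite gtn_eqF; last lia) => //;
  by case: ltnP => //; lia.
Qed.

Lemma Occ_inj i psi psi' : Occ i psi -> Occ i psi' -> psi = psi'.
Proof.
have E chi : Occ i chi -> sub phi0 0 i = Some chi.
  move=> O; rewrite (sub_Occ O) ?leqnn; last by have := esz_gt0 chi; lia.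
  by case: chi {O} => *; rewrite /= eqxx.
by move=> /E + /E => -> [].
Qed.

Lemma onth_symbols_modal (ps : seq Pi) d : is_modal (onth (symbols ps) d) = false.
Proof.
elim: ps d => [|p ps IH] d; first by rewrite onth0n.
rewrite [symbols _]/= onth_cat; case: ifP => // _.
case: d => // d /=; rewrite -/(onth _ d) onth_map; by case: onth.
Qed.

(** Connects the local conditions, which speak of modal tokens, with the semantics, which speaks of
    modal subformulas. *)
Lemma modal_Occ k : is_modal (onth w k) ->
  exists2 a, Occ k.+1 a & Occ k (Box a) \/ Occ k (Diamond a).
Proof.
move=> mk; have ltk : k < n by rewrite -onthTE; case: onth mk.
suff H psi i : Occ i psi -> i <= k < i + esz psi ->
    exists2 a, Occ k.+1 a & Occ k (Box a) \/ Occ k (Diamond a).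
  by apply: H Occ_root _; rewrite leq0n.
elim: psi i => [p|p|a IHa b IHb|a IHa b IHb|l p q|a IH|a IH] i O /andP[leik ltki].
all: have := mk; rewrite -{1}(subnKC leik) (Occ_onth O); last lia.
- by case: (k - i) => //= d; rewrite -/(onth _ d) onth_map; case: onth.
- by case: (k - i) => [|[|d]] //=; rewrite -/(onth _ d) onth_map; case: onth.
- have [<-|ne] := eqVneq i k; first by rewrite subnn.
  move=> _; case: (ltnP k (i.+1 + esz a)) => lt.
    by apply: IHa (Occ_andl O) _; lia.
  by apply: IHb (Occ_andr O) _; move: ltki; rewrite /= size_cat; lia.
- have [<-|ne] := eqVneq i k; first by rewrite subnn.
  move=> _; case: (ltnP k (i.+1 + esz a)) => lt.
    by apply: IHa (Occ_orl O) _; lia.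
  by apply: IHb (Occ_orr O) _; move: ltki; rewrite /= size_cat; lia.
- case: (k - i) => // d; rewrite -[onth _ _]/(onth (symbols p ++ TSub :: symbols q ++ [:: TClose]) d).
  rewrite onth_cat; case: ifP => _; first by rewrite onth_symbols_modal.
  case: (d - _) => // e; rewrite -[onth _ _]/(onth (symbols q ++ [:: TClose]) e).
  rewrite onth_cat; case: ifP => _; first by rewrite onth_symbols_modal.
  by case: (e - _) => [|[]].
- have [<-|ne] := eqVneq i k; first by move=> _; exists a; [exact: Occ_box O|left].
  by move=> _; apply: IH (Occ_box O) _; move: ltki => /=; lia.
- have [<-|ne] := eqVneq i k; first by move=> _; exists a; [exact: Occ_diamond O|right].
  by move=> _; apply: IH (Occ_diamond O) _; move: ltki => /=; lia.
Qed.

(** A Skolemised [team_sat]: for the occurrence at [i], [D i] stores its team, the left part of a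
    split and a choice function. *)
Fixpoint witnessed (D : nat -> set M * set M * (M -> M)) (psi : formula Pi) (o : nat) : Prop :=
  let T i := (D i).1.1 in
  match psi with
  | Lit p => (T o `<=` valuation M p)%classic
  | NLit p => (T o `&` valuation M p = set0)%classic
  | And a b => [/\ T o.+1 = T o, T (o.+1 + esz a) = T o,
      witnessed D a o.+1 & witnessed D b (o.+1 + esz a)]
  | Or a b => [/\ T o.+1 = (T o `&` (D o).1.2)%classic,
      T (o.+1 + esz a) = (T o `\` (D o).1.2)%classic,
      witnessed D a o.+1 & witnessed D b (o.+1 + esz a)]
  | Incl k p q => forall u, T o u -> exists2 v, T o v &
      forall i : 'I_k.+1, valuation M (tnth p i) u <-> valuation M (tnth q i) v
  | Box a => T o.+1 = successors (T o) /\ witnessed D a o.+1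
  | Diamond a => [/\ forall u, T o u -> acc u ((D o).2 u),
      T o.+1 = ((D o).2 @` T o)%classic & witnessed D a o.+1]
  end.

Lemma eq_witnessed D D' psi o : (forall i, o <= i < o + esz psi -> D i = D' i) ->
  witnessed D psi o -> witnessed D' psi o.
Proof.
have sz a b : 0 < esz a by apply: esz_gt0.
elim: psi o => [p|p|a IHa b IHb|a IHa b IHb|k p q|a IH|a IH] o e /=.
all: have eo : D o = D' o by apply: e; rewrite leqnn -addn1 leq_add2l esz_gt0.
1,2,5: by rewrite eo.
all: have e1 : D o.+1 = D' o.+1 by apply: e; rewrite /= ?size_cat; have := esz_gt0 a; lia.
1,2: have e2 : D (o.+1 + esz a) = D' (o.+1 + esz a)
  by apply: e; rewrite /= ?size_cat; have := esz_gt0 b; lia.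
all: rewrite eo e1 ?e2.
- case=> -> -> Wa Wb; split=> //; [apply: IHa Wa|apply: IHb Wb] => i lei; apply: e;
  by rewrite /= size_cat; lia.
- case=> -> -> Wa Wb; split=> //; [apply: IHa Wa|apply: IHb Wb] => i lei; apply: e;
  by rewrite /= size_cat; lia.
- by case=> -> W; split=> //; apply: IH W => i lei; apply: e => /=; lia.
- by case=> H -> W; split=> //; apply: IH W => i lei; apply: e => /=; lia.
Qed.

Definition splice X o m (d : X) (D1 D2 : nat -> X) i :=
  if i == o then d else if i < o.+1 + m then D1 i else D2 i.

Lemma splice0 X o m (d : X) D1 D2 : splice o m d D1 D2 o = d.
Proof. by rewrite /splice eqxx. Qed.
Lemma splice1 X o m (d : X) D1 D2 i : o < i < o.+1 + m -> splice o m d D1 D2 i = D1 i.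
Proof. by case/andP=> lt1 lt2; rewrite /splice gtn_eqF // lt2. Qed.
Lemma splice2 X o m (d : X) D1 D2 i : o.+1 + m <= i -> splice o m d D1 D2 i = D2 i.
Proof. by move=> le; rewrite /splice; case: eqP => [|_]; [lia | case: ltnP => //; lia]. Qed.

(** The choices hidden in [team_sat] are made once per occurrence and glued together, subformulas
    occupying disjoint intervals of positions. *)
Lemma team_sat_witnessed psi o (T : set M) : team_sat T psi ->
  exists2 D, (D o).1.1 = T & witnessed D psi o.
Proof.
elim: psi o T => [p|p|a IHa b IHb|a IHa b IHb|k p q|a IH|a IH] o T.
1,2,5: by move=> H; exists (fun _ => (T, set0, id)).
all: have sza := esz_gt0 a.
- move=> [/(IHa o.+1)[D1 t1 W1] /(IHb (o.+1 + esz a))[D2 t2 W2]].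
  exists (splice o (esz a) (T, set0, id) D1 D2); rewrite /= ?splice0 //.
  rewrite splice1 ?splice2 ?leqnn //; last lia; split=> //.
    by apply: eq_witnessed W1 => i lei; rewrite splice1 //; lia.
  by apply: eq_witnessed W2 => i lei; rewrite splice2 //; lia.
- move=> [S [S' [eU eI /(IHa o.+1)[D1 t1 W1] /(IHb (o.+1 + esz a))[D2 t2 W2]]]].
  exists (splice o (esz a) (T, S, id) D1 D2); rewrite /= ?splice0 //.
  rewrite splice1 ?splice2 ?leqnn //; last lia; split.
  + by rewrite t1 -eU /= classical_sets.setUK.
  + rewrite t2 -eU /=; apply/seteqP; split=> u.
      move=> S'u; split; first by right.
      by move=> Su; have : (S `&` S')%classic u by []; rewrite eI.
    by case=> -[].
  + by apply: eq_witnessed W1 => i lei; rewrite splice1 //; lia.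
  + by apply: eq_witnessed W2 => i lei; rewrite splice2 //; lia.
- move=> /(IH o.+1)[D1 t1 W1].
  exists (splice o (esz a) (T, set0, id) D1 D1); rewrite /= ?splice0 //.
  rewrite splice1; last lia; split=> //.
  by apply: eq_witnessed W1 => i lei; rewrite splice1 //; lia.
- move=> [f [fa /(IH o.+1)[D1 t1 W1]]].
  exists (splice o (esz a) (T, set0, f) D1 D1); rewrite /= ?splice0 //.
  rewrite splice1; last lia; split=> //.
  by apply: eq_witnessed W1 => i lei; rewrite splice1 //; lia.
Qed.

(** Membership runs from [o] down through the connectives, is divided at an Or by [sd], and starts
    afresh with [st] at the arguments of modalities. *)
Fixpoint spread (st sd : nat -> bool) (psi : formula Pi) (o : nat) (x : bool) (i : nat) : bool :=
  if i == o then x else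
  match psi with
  | And a b => if i < o.+1 + esz a then spread st sd a o.+1 x i
               else spread st sd b (o.+1 + esz a) x i
  | Or a b => if i < o.+1 + esz a then spread st sd a o.+1 (x && sd o) i
              else spread st sd b (o.+1 + esz a) (x && ~~ sd o) i
  | Box a | Diamond a => spread st sd a o.+1 (st o) i
  | _ => false
  end.

Lemma spread_head st sd psi o x : spread st sd psi o x o = x.
Proof. by case: psi => *; rewrite /= eqxx. Qed.

Lemma spread_Occ st sd x0 i psi : Occ i psi -> exists x, forall k, i <= k < i + esz psi ->
  spread st sd phi0 0 x0 k = spread st sd psi i x k.
Proof.
elim=> [|{}i a b _ [x IH]|{}i a b _ [x IH]|{}i a b _ [x IH]|{}i a b _ [x IH]|{}i a _ [x IH]|{}i a _ [x IH]].
- by exists x0.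
- exists x => k lek; rewrite IH /= ?size_cat; last lia.
  by rewrite gtn_eqF; [case: ltnP => //; lia|lia].
- exists x => k lek; rewrite IH /= ?size_cat; last lia.
  by rewrite gtn_eqF; [case: ltnP => //; lia|lia].
- exists (x && sd i) => k lek; rewrite IH /= ?size_cat; last lia.
  by rewrite gtn_eqF; [case: ltnP => //; lia|lia].
- exists (x && ~~ sd i) => k lek; rewrite IH /= ?size_cat; last lia.
  by rewrite gtn_eqF; [case: ltnP => //; lia|lia].
- by exists (st i) => k lek; rewrite IH /=; [rewrite gtn_eqF //; lia|lia].
- by exists (st i) => k lek; rewrite IH /=; [rewrite gtn_eqF //; lia|lia].
Qed.

Section Spread.
Variables (st sd : nat -> bool) (x0 : bool).
Notation X := (spread st sd phi0 0 x0).

Lemma spread_and i a b : Occ i (And a b) -> X i.+1 = X i /\ X (i.+1 + esz a) = X i.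
Proof.
move=> O; have [x E] := spread_Occ st sd x0 O.
have sa := esz_gt0 a; have sb := esz_gt0 b.
rewrite !E /= ?size_cat ?eqxx; try lia.
have -> : (i.+1 == i) = false by lia.
have -> : (i.+1 + esz a == i) = false by lia.
have -> : i.+1 < i.+1 + esz a by lia.
by rewrite ltnn !spread_head.
Qed.

Lemma spread_or i a b : Occ i (Or a b) ->
  X i.+1 = X i && sd i /\ X (i.+1 + esz a) = X i && ~~ sd i.
Proof.
move=> O; have [x E] := spread_Occ st sd x0 O.
have sa := esz_gt0 a; have sb := esz_gt0 b.
rewrite !E /= ?size_cat ?eqxx; try lia.
have -> : (i.+1 == i) = false by lia.
have -> : (i.+1 + esz a == i) = false by lia.
have -> : i.+1 < i.+1 + esz a by lia.
by rewrite ltnn !spread_head.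
Qed.

Lemma spread_modal i a : Occ i (Box a) \/ Occ i (Diamond a) -> X i.+1 = st i.
Proof.
have sa := esz_gt0 a.
case=> O; have [x E] := spread_Occ st sd x0 O; rewrite E /=; try lia;
by have -> : (i.+1 == i) = false by [lia]; rewrite spread_head.
Qed.

(** Membership has only two sources, the root and the modal arguments; the connectives pass it
    on. *)
Lemma spread_ind (P : nat -> Prop) : (x0 -> P 0) ->
  (forall i a, Occ i (Box a) \/ Occ i (Diamond a) -> st i -> P i.+1) ->
  (forall i a b, Occ i (And a b) -> P i -> P i.+1 /\ P (i.+1 + esz a)) ->
  (forall i a b, Occ i (Or a b) -> P i ->
     (sd i -> P i.+1) /\ (~~ sd i -> P (i.+1 + esz a))) ->
  forall i psi, Occ i psi -> X i -> P i.
Proof.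
move=> P0 Pm Pa Po i psi; elim=> [|{}i a b O IH|{}i a b O IH|{}i a b O IH|{}i a b O IH|{}i a O _|{}i a O _].
- by rewrite spread_head.
- by rewrite (spread_and O).1 => /IH/(Pa _ _ _ O)[].
- by rewrite (spread_and O).2 => /IH/(Pa _ _ _ O)[].
- by rewrite (spread_or O).1 => /andP[/IH/(Po _ _ _ O)[H _] /H].
- by rewrite (spread_or O).2 => /andP[/IH/(Po _ _ _ O)[_ H] /H].
- by rewrite (spread_modal (a := a) (or_introl O)); apply: Pm (or_introl O).
- by rewrite (spread_modal (a := a) (or_intror O)); apply: Pm (or_intror O).
Qed.
End Spread.

(** * Types of nodes and the rows made from them *)

Section Types.
Variable D : nat -> set M * set M * (M -> M).
Hypotheses (D0 : (D 0).1.1 = T0) (WD : witnessed D phi0 0).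
Notation T i := (D i).1.1.
Notation F i := (D i).2.

Lemma Occ_witnessed i psi : Occ i psi -> witnessed D psi i.
Proof. by elim=> //= {}i => [a b _ []|a b _ []|a b _ []|a b _ []|a _ []|a _ []]. Qed.

Definition side (u : M) (i : nat) : bool := `[< (D i).1.2 u >].

(* The types of the nodes of the unravelling: a node [u] together with the set
   of occurrences whose team contains it, the position through which it was
   entered and its depth. *)
Inductive typed : M -> (nat -> bool) -> nat -> nat -> Prop :=
| typed_root u : T 0 u ->
    typed u (spread (fun _ => false) (side u) phi0 0 true) n 0
| typed_next u X mk r v k : typed u X mk r -> is_modal (onth w k) -> X k -> acc u v ->
    (onth w k = Some TDiamond -> v = F k u) ->
    typed v (spread (fun i => (X i && is_box (onth w i)) || (i == k)) (side v) phi0 0 false)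
      k.+1 r.+1.

Lemma typed_spread u X mk r : typed u X mk r ->
  exists st x, X = spread st (side u) phi0 0 x.
Proof. by case=> *; eexists; eexists. Qed.

Lemma Occ_box_head i a : Occ i (Box a) -> onth w i = Some TBox.
Proof. exact: Occ_head. Qed.
Lemma Occ_diamond_head i a : Occ i (Diamond a) -> onth w i = Some TDiamond.
Proof. exact: Occ_head. Qed.

(** The depth bound is proved along with membership: each modality on the way occupies a position
    before its argument. *)
Lemma typed_team u X mk r : typed u X mk r -> forall i psi, Occ i psi -> X i -> T i u /\ r <= i.
Proof.
elim=> {u X mk r} [u T0u|u X mk r v k _ IH mk' xk uv ek]; apply: spread_ind => //.
- move=> i a b /Occ_witnessed[e1 e2 _ _] [Ti _]; by rewrite e1 e2.
- move=> i a b /Occ_witnessed[e1 e2 _ _] [Ti _]; rewrite e1 e2 /side; split=> [/asboolP|/asboolPn] H; by split.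
(* A modal argument receives the node from its point of entry or from a Box that holds at the
   predecessor. *)
- move=> i a O st; have [-> | [xi bi]] : i = k \/ X i /\ is_box (onth w i).
    by case/orP: st => [/andP[]|/eqP]; [right|left].
  + move: xk ek => xk ek.
    have [a' _ O'] := modal_Occ mk'; case: O' => O'.
      have [Tu ru] := IH _ _ O' xk; split; last by [].
      by have [-> _] := Occ_witnessed O'; exists u.
    have [Tu ru] := IH _ _ O' xk; split; last by [].
    have [_ -> _] := Occ_witnessed O'; exists u => //.
    by rewrite -ek // (Occ_diamond_head O').
  + case: O => O; last by move: bi; rewrite (Occ_diamond_head O).
    have [Tu ru] := IH _ _ O xi; split; last by [].
    by have [-> _] := Occ_witnessed O; exists u.
- move=> i a b /Occ_witnessed[e1 e2 _ _] [Ti le]; rewrite e1 e2; split; split=> //; lia.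
- move=> i a b /Occ_witnessed[e1 e2 _ _] [Ti le]; rewrite e1 e2 /side.
  by split=> [/asboolP|/asboolPn] H; split=> //; lia.
Qed.

(** A node may have many types, one for each history. The witness of an inclusion atom comes from
    the model with no history, and this supplies a suitable one. *)
Lemma typed_exists i psi v : Occ i psi -> T i v -> exists X mk r, typed v X mk r /\ X i.
Proof.
move=> O; elim: O v => [|{}i a b O IH|{}i a b O IH|{}i a b O IH|{}i a b O IH|{}i a O IH|{}i a O IH] v.
- move=> Tv; eexists; eexists; eexists; split; first exact: typed_root Tv.
  by rewrite spread_head.
- have [-> _ _ _] := Occ_witnessed O => /IH[X [mk [r [R x]]]]; exists X, mk, r; split=> //.
  by have [st [y e]] := typed_spread R; move: x; rewrite e (spread_and _ _ _ O).1.
- have [_ -> _ _] := Occ_witnessed O => /IH[X [mk [r [R x]]]]; exists X, mk, r; split=> //.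
  by have [st [y e]] := typed_spread R; move: x; rewrite e (spread_and _ _ _ O).2.
- have [-> _ _ _] := Occ_witnessed O => -[/IH[X [mk [r [R x]]]] s]; exists X, mk, r; split=> //.
  have [st [y e]] := typed_spread R; move: x; rewrite e (spread_or _ _ _ O).1 => ->.
  exact/asboolP.
- have [_ -> _ _] := Occ_witnessed O => -[/IH[X [mk [r [R x]]]] s]; exists X, mk, r; split=> //.
  have [st [y e]] := typed_spread R; move: x; rewrite e (spread_or _ _ _ O).2 => ->.
  exact/asboolPn.
- have [-> _] := Occ_witnessed O => -[u /IH[X [mk [r [R x]]]] uv].
  have ei := Occ_box_head O.
  eexists; eexists; eexists; split.
    apply: (typed_next (k := i) R _ x uv); rewrite ei //.
  by rewrite (spread_modal (a := a) _ _ _ (or_introl O)) eqxx orbT.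
- have [H -> _] := Occ_witnessed O => -[u Tu <-]; have [X [mk [r [R x]]]] := IH _ Tu.
  have ei := Occ_diamond_head O.
  eexists; eexists; eexists; split.
    by apply: (typed_next (k := i) R _ x (H u Tu)); rewrite ei.
  by rewrite (spread_modal (a := a) _ _ _ (or_intror O)) eqxx orbT.
Qed.

(** A type always contains some occurrence, and the depth is at most its position; hence the depth
    can be marked in a word of length [n]. *)
Lemma typed_depth u X mk r : typed u X mk r -> r < n.
Proof.
move=> R; have [i [psi [O x]]] : exists i psi, Occ i psi /\ X i.
  case: R => [v _|v Y mk' r' v' k R mk0 xk _ _].
    by exists 0, phi0; split; [exact: Occ_root|rewrite spread_head].
  have [a O O'] := modal_Occ mk0; exists k.+1, a; split=> //.
  by rewrite (spread_modal _ _ _ O') eqxx orbT.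
have [_ le] := typed_team R O x; exact: leq_ltn_trans le (Occ_lt O).
Qed.

(** With [p = n] no letter of the word is [None], which is how a root expresses that it was not
    entered through any position. *)
Definition ph (p i : nat) : phase :=
  if i < p then Some false else if i == p then None else Some true.

Lemma ph_here p i : (ph p i == None) = (i == p).
Proof. by rewrite /ph; case: ltngtP. Qed.
Lemma ph_after p i : (ph p i == Some true) = (p < i).
Proof. by rewrite /ph; case: ltngtP. Qed.
Lemma ph_before p i : (ph p i == Some false) = (i < p).
Proof. by rewrite /ph; case: ltngtP. Qed.

Lemma ph_step p i : phase_step (ph p i) (ph p i.+1).
Proof.
rewrite /phase_step /ph.
case: (ltngtP i p) => h1; case: (ltngtP i.+1 p) => h2 //; lia.
Qed.

(** The facts that are true of the input. In [ok_G], [t] counts the symbols already passed in both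
    lists. *)
Inductive okfact : bool * bool -> nat -> nat -> nat -> Prop :=
| ok_F i psi s : Occ i psi ->
    (forall l (P Q : l.+1.-tuple Pi), psi = Incl P Q -> s = i.+1 + size (symbols P)) ->
    okfact KF i (i + esz psi).-1 s
| ok_Y i s : onth w i = Some TProp -> okfact KY i (i + size (run w i)) s
| ok_G i l (P Q : l.+1.-tuple Pi) t : Occ i (Incl P Q) -> t <= l ->
    okfact KG (i.+1 + size (symbols (take t P)))
      ((i.+1 + size (symbols P)).+1 + size (symbols (take t Q))) i
| ok_N i j s : run w i <> run w j -> okfact KN i j s.

Definition value (u : M) (i : nat) : bool := `[< valuation M (unname (run w i)) u >].

Definition letter_of (u : M) (X : nat -> bool) mk r kd p q s (i : nat) : letter :=
  (X i, value u i, kd, (ph p i, ph q i, ph s i), (ph mk i, ph r i)).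

Lemma at1E u X mk r kd p q s i K :
  at1 K (letter_of u X mk r kd p q s i) = (kd == K) && (i == p).
Proof. by rewrite /at1 -ph_here. Qed.
Lemma at2E u X mk r kd p q s i : at2 (letter_of u X mk r kd p q s i) = (i == q).
Proof. by rewrite /at2 -ph_here. Qed.
Lemma at3E u X mk r kd p q s i : at3 (letter_of u X mk r kd p q s i) = (i == s).
Proof. by rewrite /at3 -ph_here. Qed.

(** Every type is combined with every true fact, so that each can be asked for separately. As words
    over [letter] they are finitely many, however large the model. *)
Definition words : {set n.-tuple letter} := [set t | `[< exists u X mk r kd p q s,
  [/\ typed u X mk r, okfact kd p q s &
   t = [tuple letter_of u X mk r kd p q s i | i < n]] >]].
Definition rows : seq (seq letter) := [seq tval t | t <- enum words].
Notation m := (size rows).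
Local Notation "a .[ i ]" := (lt_at rows a i).

Lemma rows_width : all (fun r => size r == n) rows.
Proof. by apply/allP => _ /mapP[t _ ->]; rewrite size_tuple. Qed.

Lemma rows_size : m <= #|letter| ^ n.
Proof. by rewrite size_map -cardE -card_tuple max_card. Qed.

Lemma row_spec b : b < m -> exists u X mk r kd p q s, [/\ typed u X mk r, okfact kd p q s &
  forall i, i < n -> b.[i] = letter_of u X mk r kd p q s i].
Proof.
move=> ltb; have /mapP[t + et] := mem_nth [::] ltb.
rewrite mem_enum inE => /asboolP[u [X [mk [r [kd [p [q [s [R K ett]]]]]]]]].
exists u, X, mk, r, kd, p, q, s; split=> // i lti.
rewrite /lt_at et ett -[i]/(nat_of_ord (Ordinal lti)).
by rewrite -tnth_nth tnth_mktuple.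
Qed.

Lemma row_intro u X mk r kd p q s : typed u X mk r -> okfact kd p q s ->
  exists2 b, b < m & forall i, i < n -> b.[i] = letter_of u X mk r kd p q s i.
Proof.
move=> R K; pose t := [tuple letter_of u X mk r kd p q s i | i < n].
have : tval t \in rows.
  apply/mapP; exists t => //; rewrite mem_enum inE; apply/asboolP.
  by exists u, X, mk, r, kd, p, q, s.
move=> tr; exists (index (tval t) rows); first by rewrite index_mem.
move=> i lti; rewrite /lt_at nth_index // -[i]/(nat_of_ord (Ordinal lti)).
by rewrite -tnth_nth tnth_mktuple.
Qed.

Hypothesis T0_inhabited : exists u, T0 u.

(** Any type can carry the fact, and the nonempty initial team supplies one. *)
Lemma fact_intro K i j s : okfact K i j s -> i < n -> j < n -> fact w rows K i j.
Proof.
move=> H lti ltj; have [u0 T0u] := T0_inhabited.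
rewrite -D0 in T0u; have [b ltb e] := row_intro (typed_root T0u) H.
by exists b; split; rewrite // e // ?at1E ?at2E !eqxx.
Qed.

Lemma fact_elim K i j : fact w rows K i j -> exists s, okfact K i j s.
Proof.
case=> b [ltb lti ltj]; have [u [X [mk [r [kd [p [q [s [_ H e]]]]]]]]] := row_spec ltb.
rewrite !e // at1E at2E => /andP[/eqP<- /eqP->] /eqP->.
by exists s.
Qed.

Lemma pair_intro i j l : okfact KG i j l -> l < n -> i < n -> j < n -> pair_fact w rows l i j.
Proof.
move=> H ltl lti ltj; have [u0 T0u] := T0_inhabited.
rewrite -D0 in T0u; have [b ltb e] := row_intro (typed_root T0u) H.
by exists b; split; rewrite // e // ?at1E ?at2E ?at3E !eqxx.
Qed.

Lemma pair_elim i j l : pair_fact w rows l i j -> [/\ okfact KG i j l, l < n, i < n & j < n].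
Proof.
case=> b [ltb [ltl lti ltj]]; have [u [X [mk [r [kd [p [q [s [_ H e]]]]]]]]] := row_spec ltb.
by rewrite !e // at1E at2E at3E => /andP[/eqP ek /eqP ei] /eqP ej /eqP el; subst.
Qed.

Lemma run_bits i z : i < z <= i + size (run w i) -> is_bit (onth w z).
Proof.
move E: (run w i) => s; elim: s i E => [|x s IH] i E lez; first by rewrite /= addn0 in lez; lia.
move: E; rewrite runE; case E1: (onth w i.+1) => [[y||||||||| ]|] // [_ E].
case: (eqVneq z i.+1) => [->|ne]; first by rewrite E1.
by apply: IH E _; move: lez => /=; lia.
Qed.

Lemma run_end i : is_bit (onth w (i + size (run w i)).+1) = false.
Proof.
move E: (run w i) => s; elim: s i E => [|x s IH] i.
  by rewrite runE addn0; case: onth => [[]|].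
rewrite runE; case E1: (onth w i.+1) => [[y||||||||| ]|] // [_ E].
by have := IH _ E; rewrite addSn addnS.
Qed.

Lemma run_lt i : i < n -> i + size (run w i) < n.
Proof.
move=> lti; case: (posnP (size (run w i))) => [->|pos]; first by rewrite addn0.
have := @run_bits i (i + size (run w i)); rewrite leqnn andbT => H.
by have := H ltac:(lia); rewrite -onthTE; case: onth.
Qed.

Lemma run_symbol p s i : drop i w = encode_symbol name p ++ s -> bits s = [::] ->
  run w i = name p /\ onth w i = Some TProp.
Proof.
move=> e bs; split; last by rewrite -[i]addn0 -onth_drop e.
rewrite /run (drop_cons e); elim: (name p) => //= x l ->; by [].
Qed.

Lemma value_run u i p : run w i = name p -> value u i <-> valuation M p u.
Proof. by move=> e; rewrite /value e nameK; split=> /asboolP. Qed.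

Lemma bits_symbols ps s : bits s = [::] -> bits (symbols ps ++ s) = [::].
Proof. by case: ps. Qed.

Lemma symbols_take p0 k ps s t : drop k w = symbols ps ++ s -> bits s = [::] -> t < size ps ->
  let i := k + size (symbols (take t ps)) in
  [/\ run w i = name (nth p0 ps t), onth w i = Some TProp &
      (i + size (run w i)).+1 = k + size (symbols (take t.+1 ps))].
Proof.
move=> e bs lt i.
have symbols_cons p l : symbols (p :: l) = encode_symbol name p ++ symbols l by [].
have sc l l' : symbols (l ++ l') = symbols l ++ symbols l'.
  by rewrite /symbols map_cat flatten_cat.
have ei : drop i w = encode_symbol name (nth p0 ps t) ++ (symbols (drop t.+1 ps) ++ s).
  apply: drop_add; rewrite e -{1}(cat_take_drop t ps) (drop_nth p0 lt) sc.
  by rewrite symbols_cons -!catA.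
have [er et] := run_symbol ei (bits_symbols _ bs); split=> //.
rewrite er (take_nth p0 lt) -cats1 sc size_cat symbols_cons size_cat /= size_map.
by rewrite /i addn0 addnA addnS.
Qed.

Lemma onth_symbols_symb (ps : seq Pi) d : d < size (symbols ps) -> is_symb (onth (symbols ps) d).
Proof.
elim: ps d => [//|p ps IH] d.
rewrite -[symbols (p :: ps)]/(encode_symbol name p ++ symbols ps) size_cat onth_cat => lt.
case: ltnP => le; last by apply: IH; lia.
case: d {lt} le => // d; rewrite /= size_map ltnS -/(onth _ d) onth_map => lt.
by have := onthTE (name p) d; rewrite lt; case: onth.
Qed.

Lemma Occ_incl i l (P Q : l.+1.-tuple Pi) : Occ i (Incl P Q) ->
  let z := i.+1 + size (symbols P) in let j := z.+1 + size (symbols Q) in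
  [/\ onth w z = Some TSub, onth w j = Some TClose, i + esz (Incl P Q) = j.+1,
      (forall k, i < k < j -> k != z -> is_symb (onth w k)) &
      exists s s', [/\ drop i.+1 w = symbols P ++ TSub :: s,
        drop z.+1 w = symbols Q ++ TClose :: s' & s = symbols Q ++ TClose :: s']].
Proof.
move=> O z j; have [s e bs] := Occ_drop O.
have e1 : drop i.+1 w = symbols P ++ TSub :: symbols Q ++ TClose :: s.
  apply: (drop_cons (x := TOpen)); rewrite e [encode _ _]/= -cat1s -!catA.
  by rewrite /symbols -cat1s -!catA /= -!catA.
have e2 : drop z w = TSub :: symbols Q ++ TClose :: s := drop_add e1.
have e3 : drop z.+1 w = symbols Q ++ TClose :: s := drop_cons e2.
have e4 : drop j w = TClose :: s := drop_add e3.
split.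
- by rewrite -[z]addn0 -onth_drop e2.
- by rewrite -[j]addn0 -onth_drop e4.
- by rewrite /= -/(symbols P) -/(symbols Q) size_cat /= size_cat /= /j /z; lia.
- move=> k lek nk; case: (ltnP k z) => lt.
    have -> : k = i.+1 + (k - i.+1) by lia.
    by rewrite -onth_drop e1 onth_cat ifT ?onth_symbols_symb //; rewrite /z in lt; lia.
  have -> : k = z.+1 + (k - z.+1) by lia.
  by rewrite -onth_drop e3 onth_cat ifT ?onth_symbols_symb //; rewrite /j in lek; lia.
- by exists (symbols Q ++ TClose :: s), s.
Qed.

Lemma letters_step u X mk r kd p q s i :
  letter_step (letter_of u X mk r kd p q s i) (letter_of u X mk r kd p q s i.+1).
Proof. by apply/and5P; split; apply: ph_step. Qed.

Definition incl_sides (psi : formula Pi) : seq Pi * seq Pi :=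
  if psi is Incl l P Q then (tval P, tval Q) else ([::], [::]).

Definition incl_end (psi : formula Pi) (i : nat) : nat :=
  if psi is Incl l P Q then i.+1 + size (symbols P) else 0.

Lemma fact_Occ i psi : Occ i psi -> fact w rows KF i (i + esz psi).-1.
Proof.
move=> O; have le := Occ_end O; have lt := esz_gt0 psi.
apply: (@fact_intro _ _ _ (incl_end psi i)); try lia.
by apply: ok_F => // l P Q ->.
Qed.

Lemma fact_run i : onth w i = Some TProp -> fact w rows KY i (i + size (run w i)).
Proof.
move=> ei; have lti : i < n by rewrite -onthTE ei.
exact: (fact_intro (ok_Y i ei) lti (run_lt lti)).
Qed.

Lemma child_intro u X mk r v k b d kd p q s kd' p' q' s' : b < m -> d < m ->
  typed u X mk r -> is_modal (onth w k) -> r.+1 < n ->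
  (forall i, i < n -> b.[i] = letter_of u X mk r kd p q s i) ->
  (forall i, i < n -> d.[i] = letter_of v
    (spread (fun i => (X i && is_box (onth w i)) || (i == k)) (side v) phi0 0 false)
    k.+1 r.+1 kd' p' q' s' i) ->
  child w rows b d.
Proof.
move=> ltb ltd R mk' ltr eb ed; split.
  move=> k' ltk' mo; have [a O O'] := modal_Occ mo; have lt := Occ_lt O.
  split=> //; rewrite eb // ed // /lX /lM /= (spread_modal _ _ _ O') ph_here.
  by rewrite eqSS.
exists r => //; rewrite eb ?ed //; last exact: ltnW.
by split; apply/eqP; rewrite [lR _]/(ph _ _) ph_here.
Qed.

Lemma child_exists u X mk r v k b kd p q s : b < m ->
  typed u X mk r -> okfact kd p q s ->
  is_modal (onth w k) -> X k -> acc u v -> (onth w k = Some TDiamond -> v = F k u) ->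
  (forall i, i < n -> b.[i] = letter_of u X mk r kd p q s i) ->
  exists d, [/\ d < m, child w rows b d & lM d.[k.+1] = None].
Proof.
move=> ltb R K mk' xk uv ek eb.
have R' := typed_next R mk' xk uv ek; have [d ltd ed] := row_intro R' K.
exists d; split=> //; first exact: child_intro ltb ltd R mk' (typed_depth R') eb ed.
have [a O _] := modal_Occ mk'; rewrite ed; last exact: Occ_lt O.
by apply/eqP; rewrite [lM _]/(ph _ _) ph_here.
Qed.

Lemma formula_rule_rows a i j : a < m -> i < n -> j < n -> at1 KF a.[i] -> at2 a.[j] ->
  formula_rule w rows a i j.
Proof.
move=> lta lti ltj.
have [u [X [mk [r [kd [p [q [s [_ K ea]]]]]]]]] := row_spec lta.
rewrite !ea // at1E at2E => /andP[/eqP ek /eqP ei] /eqP ej; subst kd p q.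
move E: KF K => kd K.
case: K E lti ltj ea => {i j s} [i psi s O es _ lti ltj ea|||] //.
have row_team b : b < m -> lX b.[i] -> exists u X mk r kd p q s,
    [/\ typed u X mk r, okfact kd p q s, X i, (D i).1.1 u &
     forall i, i < n -> b.[i] = letter_of u X mk r kd p q s i].
  move=> ltb; have [u' [X' [mk' [r' [kd' [p' [q' [s' [R K e]]]]]]]]] := row_spec ltb.
  rewrite e // => x; have [Tu _] := typed_team R O x.
  by exists u', X', mk', r', kd', p', q', s'.
have row_X b : b < m -> exists st sd x0, forall i, i < n -> lX b.[i] = spread st sd phi0 0 x0 i.
  move=> ltb; have [u' [X' [mk' [r' [kd' [p' [q' [s' [R K e]]]]]]]]] := row_spec ltb.
  have [st [x eX]] := typed_spread R; exists st, (side u'), x => i' lti'.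
  by rewrite e // -eX.
have W := Occ_witnessed O; rewrite /formula_rule (Occ_head O).
case: psi O es ltj ea W => [p|p|psi1 psi2|psi1 psi2|l P Q|psi|psi] O es ltj ea W.
- have [s' e bs] := Occ_drop O; have [er et] := run_symbol e bs.
  have <- : i + size (run w i) = (i + esz (Lit p)).-1 by rewrite er /= size_map addnS.
  split; first exact: fact_run.
  move=> b ltb /(row_team _ ltb)[v [Y [mk' [r' [kd' [p' [q' [s2 [R K _ Tv e2]]]]]]]]].
  by rewrite e2 //; apply/(value_run v er)/W.
- have [s' e bs] := Occ_drop O; have [er et] := run_symbol (drop_cons e) bs.
  have lti1 : i.+1 < n by rewrite -onthTE et.
  have <- : i.+1 + size (run w i.+1) = (i + esz (NLit p)).-1 by rewrite er /= size_map; lia.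
  split=> //; first exact: fact_run.
  move=> b ltb /(row_team _ ltb)[v [Y [mk' [r' [kd' [p' [q' [s2 [R K _ Tv e2]]]]]]]]].
  rewrite e2 //; apply/negP => /(value_run v er) V.
  by have : ((D i).1.1 `&` valuation M p)%classic v by []; rewrite W.
- have O1 := Occ_andl O; have O2 := Occ_andr O; have s1 := esz_gt0 psi1.
  exists (i.+1 + esz psi1).-1; split; first exact: fact_Occ.
    rewrite prednK; last lia.
    have -> : (i + esz (And psi1 psi2)).-1 = (i.+1 + esz psi1 + esz psi2).-1.
      by rewrite /= size_cat; lia.
    exact: fact_Occ.
  move=> b ltb; have [st [sd [x0 eX]]] := row_X b ltb.
  rewrite prednK; last lia.
  rewrite !eX ?(Occ_lt O1) ?(Occ_lt O2) // /p_and.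
  by have [-> ->] := spread_and st sd x0 O; rewrite !eqxx.
- have O1 := Occ_orl O; have O2 := Occ_orr O; have s1 := esz_gt0 psi1.
  exists (i.+1 + esz psi1).-1; split; first exact: fact_Occ.
    rewrite prednK; last lia.
    have -> : (i + esz (Or psi1 psi2)).-1 = (i.+1 + esz psi1 + esz psi2).-1.
      by rewrite /= size_cat; lia.
    exact: fact_Occ.
  move=> b ltb; have [st [sd [x0 eX]]] := row_X b ltb.
  rewrite prednK; last lia.
  rewrite !eX ?(Occ_lt O1) ?(Occ_lt O2) // /p_or.
  have [-> ->] := spread_or st sd x0 O.
  by case: (spread _ _ _ _ _ _); case: (sd i).
- have [zs jc ee sy [s1 [s2 [d1 d2 e12]]]] := Occ_incl O.
  have ez := es l P Q erefl; rewrite ez in ea; move: ea.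
  have -> : (i + esz (Incl P Q)).-1 = (i.+1 + size (symbols P)).+1 + size (symbols Q) by rewrite ee.
  set z := i.+1 + _ in zs jc d2 sy *; set j := z.+1 + _ in jc sy * => ea.
  have p0 := tnth P ord0.
  have bet k : k < n -> between a.[k] = (i < k < j).
    move=> ltk; rewrite ea // /between [l1 _]/(ph _ _) [l2 _]/(ph _ _).
    by rewrite ph_after ph_before.
  have ltjn : j < n by rewrite -onthTE jc.
  have ltz1 : z.+1 < n by lia.
  split; first exact: jc.
  exists z; split.
  + split=> //; first by rewrite bet; [lia|exact: ltnW].
    by rewrite ea ?at3E //; exact: ltnW.
  + by move=> k ltk; rewrite bet // ea // at3E; apply: sy.
  + have := ok_G O (leq0n l); rewrite !take0 /= !addn0 -/z => K.
    by apply: (pair_intro K lti _ ltz1); apply: leq_ltn_trans (ltnW ltz1); apply: leq_addr.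
  + move=> b ltb /(row_team _ ltb)[v [Y [mk' [r' [kd' [p' [q' [s3 [R K _ Tv e2]]]]]]]]].
    have [v' Tv' H] := W v Tv.
    (* The witness has a type in this team, and with the fact of the present row it forms a row. *)
    have [Y' [mk2 [r2 [R' x']]]] := typed_exists O Tv'.
    have [d ltd ed] := row_intro R' K; exists d; split=> //; first by rewrite ed.
    move=> k k' /pair_elim[K' _ ltk ltk'].
    move E: KG K' => kg K'; move E2: i K' => i2 K'.
    case: K' E E2 ltk ltk' => // i3 l' P' Q' t O' let' _ ei3 ltk ltk'; subst i3.
    (* A position determines its subformula, so all pair facts at [i] concern [P] and [Q]. *)
    have [eP eQ] := congr1 incl_sides (Occ_inj O' O).
    have el : l'.+1 = l.+1 by rewrite -(size_tuple P') eP size_tuple.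
    have ltl : t < l.+1 by rewrite -el.
    rewrite -eP in d1; rewrite -eQ in d2.
    have lt1 : t < size P' by rewrite eP size_tuple.
    have lt2 : t < size Q' by rewrite eQ size_tuple.
    have [rk _ _] := symbols_take p0 d1 erefl lt1.
    have [rk' _ _] := symbols_take p0 d2 erefl lt2.
    have ezz : i.+1 + size (symbols P') = z by rewrite eP.
    rewrite e2 ?ed // ezz.
    have [V1 V2] := H (Ordinal ltl).
    rewrite !(tnth_nth p0) /= -eP -eQ in V1 V2.
    apply/idP/idP => [/(value_run v rk)/V1 V|/(value_run v' rk')/V2 V].
      exact/(value_run v' rk').
    exact/(value_run v rk).
- by move: (fact_Occ (Occ_box O)); rewrite addSn -addnS.
- split; first by move: (fact_Occ (Occ_diamond O)); rewrite addSn -addnS.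
  move=> b ltb /(row_team _ ltb)[v [Y [mk' [r' [kd' [p' [q' [s2 [R K xi Tv e2]]]]]]]]].
  have ei := Occ_diamond_head O.
  have [Hf _ _] := W.
  by apply: (child_exists (v := F i v) ltb R K _ xi (Hf v Tv) _ e2); rewrite ei.
Qed.

Lemma chain_rows i j l : pair_fact w rows l i j ->
  exists z y, [/\ fact w rows KY i z, fact w rows KY j y &
    [/\ onth w z.+1 = Some TProp, onth w y.+1 = Some TProp & pair_fact w rows l z.+1 y.+1] \/
    (onth w z.+1 = Some TSub /\ onth w y.+1 = Some TClose)].
Proof.
case/pair_elim; move E: KG => kg K.
case: K E => // {i j l} l k P Q t O le _ ltl lti ltj.
have [zs jc _ _ [s1 [s2 [d1 d2 _]]]] := Occ_incl O.
have p0 := tnth P ord0.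
have ltP : t < size P by rewrite size_tuple.
have ltQ : t < size Q by rewrite size_tuple.
have [rP eP nP] := symbols_take p0 d1 erefl ltP.
have [rQ eQ nQ] := symbols_take p0 d2 erefl ltQ.
eexists; eexists; split; [exact: fact_run eP|exact: fact_run eQ|].
rewrite nP nQ; move: le; rewrite leq_eqVlt => /predU1P[et|lt]; [right|left].
  by rewrite et !take_oversize ?size_tuple.
have [|rP' eP' _] := symbols_take p0 d1 erefl (t := t.+1); first by rewrite size_tuple.
have [|rQ' eQ' _] := symbols_take p0 d2 erefl (t := t.+1); first by rewrite size_tuple.
split=> //; apply: pair_intro (ok_G O lt) ltl _ _; by rewrite -onthTE ?eP' ?eQ'.
Qed.

Lemma differ_rows i j : fact w rows KN i j ->
  match onth w i.+1, onth w j.+1 with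
  | Some (TBit x), Some (TBit y) => x = y -> fact w rows KN i.+1 j.+1
  | t, t' => is_bit t (+) is_bit t'
  end.
Proof.
case/fact_elim=> s; move E: KN => kn K; case: K E => // {i j s} i j s + _.
rewrite runE [run w j]runE.
case E1: (onth w i.+1) => [[x||||||||| ]|]; case E2: (onth w j.+1) => [[y||||||||| ]|] //=.
move=> ne exy; apply: (@fact_intro _ _ _ 0); rewrite -?onthTE ?E1 ?E2 //.
by apply: ok_N => er; apply: ne; rewrite exy er.
Qed.

Lemma cert_rows : cert w rows.
Proof.
split.
- move=> a i lta lti; have [u [X [mk [r [kd [p [q [s [_ _ e]]]]]]]]] := row_spec lta.
  by rewrite !e //; [exact: letters_step|exact: ltnW].
- exact: formula_rule_rows.
- move=> a i j lta lti ltj A1 A2.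
  have [s K] : exists s, okfact KY i j s by apply: fact_elim; exists a.
  have [u [X [mk [r [kd [p [q [s' [_ _ e]]]]]]]]] := row_spec lta.
  move: A1 A2; rewrite !e // at1E at2E => /andP[_ /eqP ei] /eqP ej.
  move: K ei ej e; move E: KY => ky K; case: K E lti ltj => // {i j s} i s ei _ lti ltj ep eq e.
  split=> //.
  + by rewrite [l2 _]/(ph _ _) ph_after -eq -leqNgt leq_addr.
  + by rewrite run_end.
  + move=> z ltz; rewrite e // => /eqP; rewrite [l1 _]/(ph _ _) ph_after -ep => lt1.
    rewrite [l2 _]/(ph _ _) ph_after -leqNgt -eq => le2.
    by apply: (@run_bits i); rewrite lt1.
- exact: chain_rows.
- exact: differ_rows.
- move=> b k l ltb ek el.
  have [u [X [mk [r [kd [p [q [s [_ _ e]]]]]]]]] := row_spec ltb.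
  have ltk : k < n by rewrite -onthTE ek.
  have ltl : l < n by rewrite -onthTE el.
  case: (eqVneq (run w k) (run w l)) => [er|ne]; [left|right].
    by rewrite !e // /lV /= /value er.
  by apply: (@fact_intro _ _ _ 0) => //; apply: ok_N; apply/eqP.
- move=> b ltb; have [u [X [mk [r [kd [p [q [s [R K e]]]]]]]]] := row_spec ltb.
  have ltr := typed_depth R.
  case: R ltr e => {u X mk r} [u _|u X mk r v k R mk' xk uv ek] ltr e.
    left; split; last by exists 0 => //; rewrite e //; apply/eqP; rewrite [lR _]/(ph _ _) ph_here.
    move=> k mk; have [a O O'] := modal_Occ mk; have lt := Occ_lt O.
    by rewrite e // /lX /= (spread_modal _ _ _ O').
  right; have [d ltd ed] := row_intro R K; exists d, k.
  have [a O O'] := modal_Occ mk'; have lt := Occ_lt O.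
  split=> //.
  + exact: child_intro ltd ltb R mk' ltr ed e.
  + by rewrite ed //; exact: ltnW.
  + by split=> //; rewrite e //; apply/eqP; rewrite [lM _]/(ph _ _) ph_here.
- have [u T0u] := T0_inhabited; rewrite -D0 in T0u.
  have n0 := Occ_lt Occ_root.
  have K : okfact KF 0 (0 + n).-1 (incl_end phi0 0).
    by apply: ok_F Occ_root _ => l P Q ->.
  have [a lta e] := row_intro (typed_root T0u) K.
  exists a, 0, n.-1; split.
  + by split=> //; rewrite prednK.
  + by rewrite e // at1E !eqxx.
  + by rewrite e ?prednK // at2E.
  + move=> z ltz; have -> : l1 a.[z] = ph 0 z by rewrite e.
    have -> : l2 a.[z] = ph (0 + n).-1 z by rewrite e.
    rewrite ph_before ph_after.
    by rewrite -!leqNgt; split=> //; rewrite -ltnS prednK.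
  + by exists a => //; rewrite e // /lX /= spread_head.
Qed.

End Types.

Lemma rows_exist : (exists u, T0 u) -> team_sat T0 phi0 -> exists rows,
  [/\ all (fun r => size r == n) rows, size rows <= #|letter| ^ n & cert w rows].
Proof.
move=> inh /(team_sat_witnessed 0)[D D0 W]; exists (rows D); split.
- exact: rows_width.
- exact: rows_size.
- exact: cert_rows.
Qed.

End Completeness.

(** One certificate serves every property between the two problems: soundness ends in a finite
    model, completeness starts from an arbitrary one. *)
Lemma NEXPTIME_encoded_problem (Pi : Type) (name : Pi -> seq bool)
    (P : formula Pi -> Prop) : bijective name ->
  (forall phi, finitely_satisfiable phi -> P phi) ->
  (forall phi, P phi -> satisfiable phi) ->
  NEXPTIME (encoded_problem name P).
Proof.
move=> [unname nameK unnameK] finP Psat.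
apply: (@NEXPTIME_sat token letter letter0 'I_5 'I_4 ord0 f_cert _ #|letter|).
  move=> w rows _ /sat_cert/(cert_sound unnameK)[phi [ew fs]].
  by exists phi; split=> //; apply: finP.
move=> _ [phi [-> /Psat[M [T [[u Tu] sT]]]]]; split; first exact: esz_gt0.
have [|rows [H1 H2 H3]] := rows_exist nameK _ sT; first by exists u.
by exists rows; split=> //; apply/sat_cert.
Qed.

Theorem theorem3 (Pi : Type) (name : Pi -> seq bool)
    (name_bij : bijective name) :
  NEXPTIME (encoded_problem name (@satisfiable Pi)) /\
  NEXPTIME (encoded_problem name (@finitely_satisfiable Pi)).
Proof.
have fin_sat phi : @finitely_satisfiable Pi phi -> satisfiable phi.
  by case=> M [T [_ T0 sT]]; exists M, T.
by split; apply: NEXPTIME_encoded_problem.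
Qed.
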